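(* Let $p$ be a prime, $P$ a nontrivial finite $p$-group and $k$ a field of characteristic $p$. Let $D$ be a finite-dimensional split basic $k$-algebra such that there is an embedding $\Phi:\mathrm{mod}(D)\to\underline{\mathrm{mod}}(kP)$ as distinguished abelian subcategory of $\underline{\mathrm{mod}}(kP)$. (i) We have $\ell(D)=1$; that is, $D$ is split local. (ii) Let $V$ be an indecomposable $kP$-module corresponding to a simple $D$-module under the functor $\Phi$. Then $V$ is an endotrivial $kP$-module. (iii) With $V$ as in (ii): if $\Phi$ is induced by a functor $Y\otimes_D-$ for some finitely generated $kP$-$D$-bimodule $Y$ which is projective as a right $D$-module, then there is an ideal $I$ of $kP$ containing its right annihilator in $kP$ such that $D\cong (kP)/I$ and such that $\Phi$ induces an equivalence between $\mathrm{mod}(D)$ and the distinguished abelian subcategory $V\otimes_k\mathrm{mod}((kP)/I)$.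
   Context: Algebras are nonzero, unital and associative; modules are unital left modules unless stated otherwise. For a finite-dimensional $k$-algebra $A$, $\mathrm{mod}(A)$ is the category of finitely generated $A$-modules, $\ell(A)$ is the number of isomorphism classes of simple $A$-modules, and $\underline{\mathrm{mod}}(A)$ is the stable module category: same objects as $\mathrm{mod}(A)$, and morphism spaces $\underline{\mathrm{Hom}}_A(U,V)=\mathrm{Hom}_A(U,V)/\mathrm{Hom}_A^{\mathrm{pr}}(U,V)$, where $\mathrm{Hom}_A^{\mathrm{pr}}(U,V)$ is the space of $A$-homomorphisms which factor through a projective $A$-module. Since $kP$ is selfinjective, $\underline{\mathrm{mod}}(kP)$ is triangulated with shift functor $\Sigma$ induced by sending a module to the cokernel of an injective envelope, and with exact triangles induced by short exact sequences in $\mathrm{mod}(kP)$. A distinguished abelian subcategory of a triangulated category $\mathcal{C}$ with shift functor $\Sigma$ is a full additive subcategory $\mathcal{D}$ of $\mathcal{C}$ which is abelian, such that for any short exact sequence $0\to X\xrightarrow{f} Y\xrightarrow{g} Z\to 0$ in $\mathcal{D}$ there exists a morphism $h:Z\to\Sigma(X)$ in $\mathcal{C}$ such that the triangle $X\xrightarrow{f} Y\xrightarrow{g} Z\xrightarrow{h}\Sigma(X)$ is exact in $\mathcal{C}$. A functor from an abelian category to $\mathcal{C}$ is an embedding as a distinguished abelian subcategory if it is fully faithful and the full subcategory of $\mathcal{C}$ given by its image is a distinguished abelian subcategory of $\mathcal{C}$. A functor $Y\otimes_D-:\mathrm{mod}(D)\to\mathrm{mod}(kP)$ induces $\Phi$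 by composition with the canonical functor $\mathrm{mod}(kP)\to\underline{\mathrm{mod}}(kP)$. An object corresponds to a simple $D$-module $T$ under $\Phi$ if it is isomorphic to $\Phi(T)$ in $\underline{\mathrm{mod}}(kP)$. A finitely generated $kP$-module $V$ is endotrivial if $V\otimes_k V^*\cong k\oplus U$ for some projective $kP$-module $U$. In that case $V\otimes_k-$ and $V^*\otimes_k-$ induce inverse equivalences on $\underline{\mathrm{mod}}(kP)$, and for a distinguished abelian subcategory $\mathcal{D}$ of $\underline{\mathrm{mod}}(kP)$, $V\otimes_k\mathcal{D}$ denotes the distinguished abelian subcategory which is the image of $\mathcal{D}$ under $V\otimes_k-$ (understood up to isomorphism in $\underline{\mathrm{mod}}(kP)$). If an ideal $I$ of $kP$ contains its right annihilator $r(I)=\{a\in kP\mid Ia=0\}$, then $\mathrm{mod}((kP)/I)$ is regarded as a distinguished abelian subcategory of $\underline{\mathrm{mod}}(kP)$ via restriction along $kP\to (kP)/I$ followed by the canonical functor $\mathrm{mod}(kP)\to\underline{\mathrm{mod}}(kP)$. *)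

(* Defs.v *)
From HB Require Import structures.
From mathcomp Require Import all_boot all_order all_algebra all_fingroup.
From mathcomp Require Import all_solvable all_field.
From mathcomp Require Import boolp.

Set Implicit Arguments.
Unset Strict Implicit.
Unset Printing Implicit Defensive.

Import GRing.Theory.
Local Open Scope ring_scope.

(* Morphism spaces are presented as quotients: [hom X Y] is a space of
   representatives, [null] is an ideal, and two representatives denote the
   same morphism when their difference is in [null].  The laws hold strictly
   on representatives. *)
Record lincat (k : fieldType) := LinCat {
  obj :> Type;
  hom : obj -> obj -> lmodType k;
  null : forall X Y : obj, hom X Y -> Prop;
  idm : forall X : obj, hom X X;
  compm : forall X Y Z : obj, hom Y Z -> hom X Y -> hom X Z;
  null0 : forall X Y : obj, @null X Y 0;
  null_lin : forall (X Y : obj) (c : k) (f g : hom X Y),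
    null f -> null g -> null (c *: f + g);
  null_compl : forall (X Y Z : obj) (g : hom Y Z) (f : hom X Y),
    null f -> null (compm g f);
  null_compr : forall (X Y Z : obj) (g : hom Y Z) (f : hom X Y),
    null g -> null (compm g f);
  comp_linl : forall (X Y Z : obj) (f : hom X Y) (c : k) (g g' : hom Y Z),
    compm (c *: g + g') f = c *: compm g f + compm g' f;
  comp_linr : forall (X Y Z : obj) (g : hom Y Z) (c : k) (f f' : hom X Y),
    compm g (c *: f + f') = c *: compm g f + compm g f';
  compA : forall (X Y Z W : obj) (h : hom Z W) (g : hom Y Z) (f : hom X Y),
    compm h (compm g f) = compm (compm h g) f;
  comp1m : forall (X Y : obj) (f : hom X Y), compm (idm Y) f = f;
  compm1 : forall (X Y : obj) (f : hom X Y), compm f (idm X) = f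
}.
Arguments hom {k C} X Y : rename.
Arguments null {k C X Y} f : rename.
Arguments idm {k C} X : rename.
Arguments compm {k C X Y Z} g f : rename.

Definition heq (k : fieldType) (C : lincat k) (X Y : C) (f g : hom X Y) : Prop :=
  null (f - g).
Notation "f ≈ g" := (heq f g) (at level 70, no associativity).
Notation "g ∘ f" := (compm g f) (at level 40, left associativity).

Section LinCatTheory.
Variables (k : fieldType) (C : lincat k).
Implicit Types X Y Z : C.

Lemma heq_refl X Y (f : hom X Y) : f ≈ f.
Proof. by rewrite /heq subrr; apply: null0. Qed.

Lemma heq_eq X Y (f g : hom X Y) : f = g -> f ≈ g.
Proof. by move=> ->; apply: heq_refl. Qed.

Lemma heq_sym X Y (f g : hom X Y) : f ≈ g -> g ≈ f.
Proof.
move=> /(null_lin (-1))/(_ (null0 _ _)).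
by rewrite addr0 scaleN1r opprB.
Qed.

Lemma heq_trans X Y (f g h : hom X Y) : f ≈ g -> g ≈ h -> f ≈ h.
Proof.
move=> fg gh; have := null_lin 1 fg gh.
by rewrite scale1r addrA subrK.
Qed.

Lemma heq_comp X Y Z (g g' : hom Y Z) (f f' : hom X Y) :
  g ≈ g' -> f ≈ f' -> g ∘ f ≈ g' ∘ f'.
Proof.
move=> gg ff; apply: (@heq_trans _ _ _ (g ∘ f')).
  have := null_compl g ff.
  by rewrite addrC -scaleN1r comp_linr scaleN1r addrC.
have := null_compr f' gg.
by rewrite addrC -scaleN1r comp_linl scaleN1r addrC.
Qed.

Definition is_iso X Y (f : hom X Y) : Prop :=
  exists g : hom Y X, g ∘ f ≈ idm X /\ f ∘ g ≈ idm Y.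

Definition isomorphic X Y : Prop := exists f : hom X Y, is_iso f.

Definition is_zero X : Prop := idm X ≈ 0.

Definition is_biproduct (I : finType) (X : I -> C) (S : C) : Prop :=
  exists (inj : forall i, hom (X i) S) (prj : forall i, hom S (X i)),
    [/\ forall i, prj i ∘ inj i ≈ idm (X i),
        forall i j, i != j -> prj i ∘ inj j ≈ 0
      & \sum_(i : I) (inj i ∘ prj i) ≈ idm S].

Definition is_biproduct2 X Y (S : C) : Prop :=
  is_biproduct (fun b : bool => if b then X else Y) S.

Definition indecomposable X : Prop :=
  ~ is_zero X /\
  forall Y Z, is_biproduct2 Y Z X -> is_zero Y \/ is_zero Z.

(* The case of the empty family gives a zero object. *)
Definition additive_cat : Prop :=
  forall (n : nat) (X : 'I_n -> C), exists S, is_biproduct X S.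

Definition monic X Y (f : hom X Y) : Prop :=
  forall W (g h : hom W X), f ∘ g ≈ f ∘ h -> g ≈ h.

Definition epic X Y (f : hom X Y) : Prop :=
  forall W (g h : hom Y W), g ∘ f ≈ h ∘ f -> g ≈ h.

Definition is_kernel X Y Z (f : hom Y Z) (i : hom X Y) : Prop :=
  f ∘ i ≈ 0 /\
  forall W (g : hom W Y), f ∘ g ≈ 0 ->
    exists2 u : hom W X, i ∘ u ≈ g & forall v : hom W X, i ∘ v ≈ g -> v ≈ u.

Definition is_cokernel X Y Z (f : hom X Y) (q : hom Y Z) : Prop :=
  q ∘ f ≈ 0 /\
  forall W (g : hom Y W), g ∘ f ≈ 0 ->
    exists2 u : hom Z W, u ∘ q ≈ g & forall v : hom Z W, v ∘ q ≈ g -> v ≈ u.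

Definition abelian_cat : Prop :=
  [/\ additive_cat,
      forall X Y (f : hom X Y), exists K (i : hom K X), is_kernel f i,
      forall X Y (f : hom X Y), exists Q (q : hom Y Q), is_cokernel f q,
      forall X Y (f : hom X Y), monic f ->
        exists Z (g : hom Y Z), is_kernel g f
    & forall X Y (f : hom X Y), epic f ->
        exists W (g : hom W X), is_cokernel g f].

Definition short_exact X Y Z (f : hom X Y) (g : hom Y Z) : Prop :=
  is_kernel g f /\ is_cokernel f g.

End LinCatTheory.

(* Functors between k-linear categories are understood to be k-linear. *)
Record functor (k : fieldType) (C D : lincat k) := Functor {
  fobj :> C -> D;
  fhom : forall X Y : C, hom X Y -> hom (fobj X) (fobj Y);
  fhom_heq : forall (X Y : C) (f g : hom X Y), f ≈ g -> fhom f ≈ fhom g;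
  fhom_lin : forall (X Y : C) (c : k) (f g : hom X Y),
    fhom (c *: f + g) ≈ c *: fhom f + fhom g;
  fhom1 : forall X : C, fhom (idm X) ≈ idm (fobj X);
  fhomM : forall (X Y Z : C) (g : hom Y Z) (f : hom X Y),
    fhom (g ∘ f) ≈ fhom g ∘ fhom f
}.
Arguments fhom {k C D} F {X Y} f : rename.

Section Functors.
Variable k : fieldType.
Implicit Types B C D : lincat k.

Definition id_functor C : functor C C.
Proof.
by refine (@Functor k C C (fun X => X) (fun X Y f => f) _ _ _ _) => // *;
  apply: heq_refl.
Defined.

Definition comp_functor B C D (G : functor C D) (F : functor B C) : functor B D.
Proof.
refine (@Functor k B D (fun X => G (F X)) (fun X Y f => fhom G (fhom F f))
  _ _ _ _).
- by move=> X Y f g fg; do 2!apply: fhom_heq.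
- move=> X Y c f g; apply: heq_trans (fhom_lin _ _ _ _).
  by apply: fhom_heq; apply: fhom_lin.
- move=> X; apply: heq_trans (fhom1 _ _).
  by apply: fhom_heq; apply: fhom1.
- move=> X Y Z g f; apply: heq_trans (fhomM _ _ _).
  by apply: fhom_heq; apply: fhomM.
Defined.

Definition nat_iso C D (F G : functor C D) : Prop :=
  exists eta : forall X : C, hom (F X) (G X),
    (forall X, is_iso (eta X)) /\
    (forall (X Y : C) (f : hom X Y), eta Y ∘ fhom F f ≈ fhom G f ∘ eta X).

Definition is_equivalence C D (F : functor C D) : Prop :=
  exists G : functor D C,
    nat_iso (comp_functor G F) (id_functor C) /\
    nat_iso (comp_functor F G) (id_functor D).

Definition faithful_functor C D (F : functor C D) : Prop :=
  forall (X Y : C) (f g : hom X Y), fhom F f ≈ fhom F g -> f ≈ g.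

Definition full_functor C D (F : functor C D) : Prop :=
  forall (X Y : C) (g : hom (F X) (F Y)), exists f : hom X Y, fhom F f ≈ g.

Definition full_sub C (Q : C -> Prop) : lincat k :=
  @LinCat k {X : C | Q X} (fun X Y => @hom k C (sval X) (sval Y))
    (fun X Y f => null f) (fun X => idm (sval X)) (fun X Y Z g f => g ∘ f)
    (fun X Y => @null0 k C _ _) (fun X Y => @null_lin k C _ _)
    (fun X Y Z => @null_compl k C _ _ _) (fun X Y Z => @null_compr k C _ _ _)
    (fun X Y Z => @comp_linl k C _ _ _) (fun X Y Z => @comp_linr k C _ _ _)
    (fun X Y Z W => @compA k C _ _ _ _)
    (fun X Y => @comp1m k C _ _) (fun X Y => @compm1 k C _ _).

Definition corestrict C D (F : functor C D) (Q : D -> Prop)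
    (FQ : forall X, Q (F X)) : functor C (full_sub Q) :=
  @Functor k C (full_sub Q) (fun X => exist Q (F X) (FQ X))
    (fun X Y f => fhom F f)
    (@fhom_heq k C D F) (@fhom_lin k C D F) (@fhom1 k C D F) (@fhomM k C D F).

Definition induces_equivalence C D (F : functor C D) (Q : D -> Prop) : Prop :=
  exists FQ : forall X, Q (F X), is_equivalence (corestrict FQ).

Definition fun_image C D (F : functor C D) : D -> Prop :=
  fun Z => exists X, F X = Z.

End Functors.

Record triangles (k : fieldType) (C : lincat k) := Triangles {
  shift : C -> C;
  exact_tri : forall X Y Z : C,
    hom X Y -> hom Y Z -> hom Z (shift X) -> Prop
}.
Arguments exact_tri {k C} T {X Y Z} f g h : rename.

Section Distinguished.
Variables (k : fieldType) (C : lincat k) (T : triangles C).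

Definition distinguished_abelian (Q : C -> Prop) : Prop :=
  abelian_cat (full_sub Q) /\
  forall (X Y Z : full_sub Q) (f : hom X Y) (g : hom Y Z), short_exact f g ->
    exists h : @hom k C (sval Z) (shift T (sval X)),
      @exact_tri k C T (sval X) (sval Y) (sval Z) f g h.

Definition distinguished_embedding (B : lincat k) (F : functor B C) : Prop :=
  [/\ faithful_functor F, full_functor F & distinguished_abelian (fun_image F)].

End Distinguished.

(* Over a finite-dimensional algebra, the finitely generated modules are those
   of finite dimension. *)
Record fdmod (k : fieldType) (A : falgType k) := FdMod {
  mcar :> vectType k;
  mact : {linear A -> 'End(mcar)};
  mact1 : mact 1 = \1%VF;
  mactM : forall a b, mact (a * b) = (mact a \o mact b)%VF
}.
Arguments mact {k A} V : rename.

Section Homs.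
Variables (k : fieldType) (A : falgType k).
Implicit Types U V W : fdmod A.

Definition mod_linear U V : {pred 'Hom(U, V)} :=
  fun f => `[< forall a x, f (mact U a x) = mact V a (f x) >].
Arguments mod_linear : clear implicits.

Fact mod_linear_submod U V : submod_closed (mod_linear U V).
Proof.
split=> [|c f g /asboolP fA /asboolP gA]; apply/asboolP => a x.
  by rewrite !lfunE linear0.
by rewrite !lfunE /= !scale_lfunE fA gA linearP.
Qed.
HB.instance Definition _ U V :=
  GRing.isSubmodClosed.Build k 'Hom(U, V) (mod_linear U V)
    (mod_linear_submod U V).

Record modhom U V :=
  ModHom { hval :> 'Hom(U, V); hvalP : hval \in mod_linear U V }.
HB.instance Definition _ U V := [isSub for @hval U V].
HB.instance Definition _ U V := [Choice of modhom U V by <:].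
HB.instance Definition _ U V := [SubChoice_isSubLmodule of modhom U V by <:].

End Homs.
Arguments mod_linear {k A} U V : rename.

Section ModCat.
Variables (k : fieldType) (A : falgType k).
Implicit Types U V W : fdmod A.

Lemma modhomP U V (f : modhom U V) a x : f (mact U a x) = mact V a (f x).
Proof. by have /asboolP := hvalP f; apply. Qed.

Fact modhom_id_subproof U : \1%VF \in mod_linear U U.
Proof. by apply/asboolP => a x; rewrite !lfunE. Qed.
Definition modhom_id U : modhom U U := ModHom (modhom_id_subproof U).

Fact modhom_comp_subproof U V W (g : modhom V W) (f : modhom U V) :
  (g \o f)%VF \in mod_linear U W.
Proof. by apply/asboolP => a x; rewrite !comp_lfunE !modhomP. Qed.
Definition modhom_comp U V W (g : modhom V W) (f : modhom U V) : modhom U W :=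
  ModHom (modhom_comp_subproof g f).

Fact modhom_comp_linl U V W (f : modhom U V) (c : k) (g g' : modhom V W) :
  modhom_comp (c *: g + g') f = c *: modhom_comp g f + modhom_comp g' f.
Proof.
by apply/val_inj; rewrite /= comp_lfunDl comp_lfunZl.
Qed.

Fact modhom_comp_linr U V W (g : modhom V W) (c : k) (f f' : modhom U V) :
  modhom_comp g (c *: f + f') = c *: modhom_comp g f + modhom_comp g f'.
Proof.
by apply/val_inj; rewrite /= comp_lfunDr comp_lfunZr.
Qed.

Fact modhom_compA U V W X (h : modhom W X) (g : modhom V W) (f : modhom U V) :
  modhom_comp h (modhom_comp g f) = modhom_comp (modhom_comp h g) f.
Proof. by apply/val_inj; rewrite /= comp_lfunA. Qed.

Fact modhom_comp1m U V (f : modhom U V) : modhom_comp (modhom_id V) f = f.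
Proof. by apply/val_inj; rewrite /= comp_lfun1l. Qed.

Fact modhom_compm1 U V (f : modhom U V) : modhom_comp f (modhom_id U) = f.
Proof. by apply/val_inj; rewrite /= comp_lfun1r. Qed.

(* The lifting property is only tested on finitely generated modules, which
   suffices for finitely generated modules over a finite-dimensional algebra;
   likewise for injective modules. *)
Definition projective_mod (Q : fdmod A) : Prop :=
  forall (V W : fdmod A) (g : modhom V W) (f : modhom Q W),
    limg g = fullv -> exists h : modhom Q V, modhom_comp g h = f.

Definition injective_mod (J : fdmod A) : Prop :=
  forall (U V : fdmod A) (i : modhom U V) (f : modhom U J),
    lker i = 0%VS -> exists h : modhom V J, modhom_comp h i = f.

Definition factors_projective U V (f : modhom U V) : Prop :=
  exists (Q : fdmod A) (u : modhom U Q) (v : modhom Q V),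
    projective_mod Q /\ f = modhom_comp v u.

Definition modcat : lincat k.
Proof.
refine (@LinCat k (fdmod A) (fun U V => modhom U V) (fun U V f => f = 0)
  modhom_id modhom_comp _ _ _ _ modhom_comp_linl modhom_comp_linr
  modhom_compA modhom_comp1m modhom_compm1) => //.
- by move=> U V c f g -> ->; rewrite scaler0 addr0.
- by move=> U V W g f ->; apply/val_inj; rewrite /= comp_lfun0r.
- by move=> U V W g f ->; apply/val_inj; rewrite /= comp_lfun0l.
Defined.

End ModCat.

Section DirectSum.
Variables (k : fieldType) (A : falgType k) (U V : fdmod A).

Definition dsum_act (a : A) (x : (U * V)%type) : (U * V)%type :=
  (mact U a x.1, mact V a x.2).

Fact dsum_act_linear a : linear (dsum_act a).
Proof. by move=> c x y; rewrite /dsum_act !linearP. Qed.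
HB.instance Definition _ a := GRing.isSemilinear.Build k _ _ _ (dsum_act a)
  (GRing.semilinear_linear (dsum_act_linear a)).

Definition dsum_mact (a : A) : 'End((U * V)%type) := linfun (dsum_act a).

Fact dsum_mact_linear : linear dsum_mact.
Proof.
move=> c a b; apply/lfunP => x; rewrite add_lfunE scale_lfunE !lfunE /=.
by rewrite /dsum_act !linearP !add_lfunE !scale_lfunE.
Qed.
HB.instance Definition _ := GRing.isSemilinear.Build k _ _ _ dsum_mact
  (GRing.semilinear_linear dsum_mact_linear).

Fact dsum_mact1 : dsum_mact 1 = \1%VF.
Proof.
apply/lfunP => x; rewrite !lfunE /= /dsum_act !mact1 !lfunE.
by case: x.
Qed.

Fact dsum_mactM a b : dsum_mact (a * b) = (dsum_mact a \o dsum_mact b)%VF.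
Proof.
by apply/lfunP => x; rewrite comp_lfunE !lfunE /= /dsum_act !mactM !comp_lfunE.
Qed.

Definition dsum_mod : fdmod A := @FdMod k A (U * V)%type
  dsum_mact dsum_mact1 dsum_mactM.

End DirectSum.

Section StableCat.
Variables (k : fieldType) (A : falgType k).
Implicit Types U V W : fdmod A.

Section Pairing.
Variables U V W : fdmod A.

Definition dpair_fun (f : modhom W U) (g : modhom W V) (x : W) : dsum_mod U V :=
  (f x, g x).
Fact dpair_linear f g : linear (dpair_fun f g).
Proof. by move=> c x y; rewrite /dpair_fun !linearP. Qed.
HB.instance Definition _ f g := GRing.isSemilinear.Build k _ _ _ (dpair_fun f g)
  (GRing.semilinear_linear (dpair_linear f g)).
Fact dpair_subproof f g : linfun (dpair_fun f g) \in mod_linear W (dsum_mod U V).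
Proof.
by apply/asboolP => a x; rewrite !lfunE /= /dpair_fun !modhomP.
Qed.
Definition dpair f g : modhom W (dsum_mod U V) := ModHom (dpair_subproof f g).

Definition dcopair_fun (f : modhom U W) (g : modhom V W) (x : dsum_mod U V) : W :=
  f x.1 + g x.2.
Fact dcopair_linear f g : linear (dcopair_fun f g).
Proof.
by move=> c x y; rewrite /dcopair_fun !linearP /= scalerDr addrACA.
Qed.
HB.instance Definition _ f g := GRing.isSemilinear.Build k _ _ _
  (dcopair_fun f g) (GRing.semilinear_linear (dcopair_linear f g)).
Fact dcopair_subproof f g :
  linfun (dcopair_fun f g) \in mod_linear (dsum_mod U V) W.
Proof.
apply/asboolP => a x; rewrite !lfunE /= /dcopair_fun.
by rewrite linearD !modhomP.
Qed.
Definition dcopair f g : modhom (dsum_mod U V) W := ModHom (dcopair_subproof f g).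

End Pairing.

Lemma modhomE U V (f g : modhom U V) : (forall x, f x = g x) -> f = g.
Proof. by move=> fg; apply/val_inj/lfunP. Qed.

Fact projective_dsum (Q R : fdmod A) :
  projective_mod Q -> projective_mod R -> projective_mod (dsum_mod Q R).
Proof.
move=> pQ pR V W g f gsurj.
have [h1 Eh1] := pQ V W g (modhom_comp f (dpair (modhom_id Q) 0)) gsurj.
have [h2 Eh2] := pR V W g (modhom_comp f (dpair 0 (modhom_id R))) gsurj.
exists (dcopair h1 h2); apply: modhomE => -[x y].
have Ex : g (h1 x) = f (x, 0).
  have := congr1 (fun h : modhom _ _ => h x) Eh1.
  by rewrite /= !comp_lfunE !lfunE /= /dpair_fun /= !lfunE.
have Ey : g (h2 y) = f (0, y).
  have := congr1 (fun h : modhom _ _ => h y) Eh2.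
  by rewrite /= !comp_lfunE !lfunE /= /dpair_fun /= !lfunE.
rewrite /= comp_lfunE lfunE /= /dcopair_fun linearD /= Ex Ey -linearD /=.
by congr (hval f _); congr pair; rewrite /= ?addr0 ?add0r.
Qed.

Definition zero_mod_act (a : A) : 'End('rV[k]_0) := 0.
Fact zero_mod_linear : linear zero_mod_act.
Proof. by move=> c a b; rewrite /zero_mod_act scaler0 addr0. Qed.
HB.instance Definition _ := GRing.isSemilinear.Build k _ _ _ zero_mod_act
  (GRing.semilinear_linear zero_mod_linear).
Fact zero_mod1 : zero_mod_act 1 = \1%VF.
Proof. by apply/lfunP => x; rewrite !thinmx0. Qed.
Fact zero_modM a b :
  zero_mod_act (a * b) = (zero_mod_act a \o zero_mod_act b)%VF.
Proof. by rewrite /zero_mod_act comp_lfun0l. Qed.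
Definition zero_mod : fdmod A := @FdMod k A _ zero_mod_act zero_mod1 zero_modM.

Fact projective_zero : projective_mod zero_mod.
Proof.
move=> V W g f _; exists 0; apply: modhomE => x.
by rewrite (thinmx0 x) !linear0.
Qed.

Fact factors_projective0 U V : factors_projective (0 : modhom U V).
Proof.
exists zero_mod, 0, 0; split; first exact: projective_zero.
by apply: modhomE => x; rewrite /= comp_lfun0l.
Qed.

Fact factors_projective_lin U V (c : k) (f g : modhom U V) :
  factors_projective f -> factors_projective g ->
  factors_projective (c *: f + g).
Proof.
move=> [Q [u [v [pQ ->]]]] [R [u' [v' [pR ->]]]].
exists (dsum_mod Q R), (dpair u u'), (dcopair (c *: v) v'); split.
  exact: projective_dsum.
apply: modhomE => x; rewrite /= add_lfunE scale_lfunE !comp_lfunE !lfunE /=.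
by rewrite /dcopair_fun /dpair_fun /= scale_lfunE.
Qed.

Fact factors_projective_compl U V W (g : modhom V W) (f : modhom U V) :
  factors_projective f -> factors_projective (modhom_comp g f).
Proof.
move=> [Q [u [v [pQ ->]]]]; exists Q, u, (modhom_comp g v); split=> //.
exact: modhom_compA.
Qed.

Fact factors_projective_compr U V W (g : modhom V W) (f : modhom U V) :
  factors_projective g -> factors_projective (modhom_comp g f).
Proof.
move=> [Q [u [v [pQ ->]]]]; exists Q, (modhom_comp u f), v; split=> //.
by rewrite modhom_compA.
Qed.

Definition stmod : lincat k :=
  @LinCat k (fdmod A) (fun U V => modhom U V)
    (@factors_projective k A)
    (@modhom_id k A) (@modhom_comp k A) factors_projective0
    factors_projective_lin factors_projective_compl factors_projective_compr
    (@modhom_comp_linl k A) (@modhom_comp_linr k A) (@modhom_compA k A)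
    (@modhom_comp1m k A) (@modhom_compm1 k A).

Fact stable_heq U V (f g : @hom k (modcat A) U V) :
  f ≈ g -> @heq k stmod U V f g.
Proof. by move=> /subr0_eq->; apply: heq_refl. Qed.

Definition stable_functor : functor (modcat A) stmod.
Proof.
by refine (@Functor k (modcat A) stmod (fun U => U) (fun U V f => f)
  stable_heq _ _ _) => *; apply: heq_refl.
Defined.

Definition ses_mod U V W (i : modhom U V) (q : modhom V W) : Prop :=
  [/\ lker i = 0%VS, limg i = lker q & limg q = fullv].

Definition submodule V (X : {vspace V}) : Prop :=
  forall a x, x \in X -> mact V a x \in X.

Definition essential U V (i : modhom U V) : Prop :=
  forall X : {vspace V}, submodule X -> (X :&: limg i = 0)%VS -> X = 0%VS.

(* An injective envelope of [U] together with a cokernel of it. *)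
Record injective_envelope U := InjectiveEnvelope {
  env_hull : fdmod A;
  env_coker : fdmod A;
  env_in : modhom U env_hull;
  env_out : modhom env_hull env_coker;
  env_injective : injective_mod env_hull;
  env_essential : essential env_in;
  env_ses : ses_mod env_in env_out
}.

(* [c] is induced on cokernels by an extension of [a] to the middle terms. *)
Definition ses_morphism U V W U' V' W' (i : modhom U V) (q : modhom V W)
    (i' : modhom U' V') (q' : modhom V' W') (a : modhom U U') (c : modhom W W') :
  Prop :=
  exists b : modhom V V',
    modhom_comp b i = modhom_comp i' a /\ modhom_comp c q = modhom_comp q' b.

Section Triangulated.
(* The shift functor depends on the choice of injective envelopes, which is
   therefore kept as explicit data; the choice is unique up to isomorphism. *)
Variable E : forall U, injective_envelope U.

Definition Sigma U : fdmod A := env_coker (E U).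

(* [s] represents the image of [a] under the shift functor. *)
Definition Sigma_hom U V (a : modhom U V) (s : modhom (Sigma U) (Sigma V)) :
  Prop :=
  ses_morphism (env_in (E U)) (env_out (E U)) (env_in (E V)) (env_out (E V)) a s.

Definition connecting U V W (i : modhom U V) (q : modhom V W)
    (d : modhom W (Sigma U)) : Prop :=
  ses_morphism i q (env_in (E U)) (env_out (E U)) (modhom_id U) d.

(* A triangle is exact if it is isomorphic in the stable category to one coming
   from a short exact sequence of modules. *)
Definition stable_exact (X Y Z : stmod) (f : hom X Y) (g : hom Y Z)
    (h : @hom k stmod Z (Sigma X)) : Prop :=
  exists (U V W : fdmod A) (i : modhom U V) (q : modhom V W)
    (d : modhom W (Sigma U)),
    ses_mod i q /\ connecting i q d /\
    exists (a : @hom k stmod X U) (b : @hom k stmod Y V)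
      (c : @hom k stmod Z W) (s : @hom k stmod (Sigma X) (Sigma U)),
      [/\ is_iso a, is_iso b, is_iso c & Sigma_hom a s] /\
      [/\ b ∘ f ≈ (i : @hom k stmod U V) ∘ a,
          c ∘ g ≈ (q : @hom k stmod V W) ∘ b
        & s ∘ h ≈ (d : @hom k stmod W (Sigma U)) ∘ c].

Definition stable_triangles : triangles stmod :=
  @Triangles k stmod Sigma stable_exact.

End Triangulated.
End StableCat.
Arguments stmod {k} A.
Arguments modcat {k} A.
Arguments stable_functor {k} A.

Section Algebras.
Variables (k : fieldType) (A : falgType k).

Definition simple_mod (S : fdmod A) : Prop :=
  fullv <> 0%VS :> {vspace S} /\
  forall X : {vspace S}, submodule X -> X = 0%VS \/ X = fullv.

Definition num_simple (n : nat) : Prop :=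
  exists S : 'I_n -> modcat A,
    [/\ forall i, simple_mod (S i),
        forall i j, isomorphic (S i) (S j) -> i = j
      & forall T : modcat A, simple_mod T -> exists i, isomorphic T (S i)].

Definition split_algebra : Prop :=
  forall S : fdmod A, simple_mod S ->
  forall f : modhom S S, exists c : k, f = c *: modhom_id S.

Fact amull1 : amull (1 : A) = \1%VF.
Proof. by apply/lfunP => x; rewrite !lfunE /= mul1r. Qed.
Fact amullM (a b : A) : amull (a * b) = (amull a \o amull b)%VF.
Proof. by apply/lfunP => x; rewrite comp_lfunE !lfunE /= mulrA. Qed.
Definition regular_mod : fdmod A := @FdMod k A A (@amull k A) amull1 amullM.

Definition basic_algebra : Prop :=
  exists (n : nat) (M : 'I_n -> modcat A),
    [/\ is_biproduct M (regular_mod : modcat A),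
        forall i, indecomposable (M i)
      & forall i j, isomorphic (M i) (M j) -> i = j].

Definition local_algebra : Prop :=
  forall a b : A, a \isn't a GRing.unit -> b \isn't a GRing.unit ->
    a + b \isn't a GRing.unit.

End Algebras.
Arguments num_simple {k} A n.
Arguments regular_mod {k} A.

Section QuotientSpace.
Variables (k : fieldType) (V : vectType k) (W : {vspace V}).

(* The quotient space V / W is realized on a complement of W. *)
Definition quotv : vectType k := subvs_of (W^C)%VS.

Definition quot_pi : 'Hom(V, quotv) :=
  linfun (vsproj (W^C)%VS \o daddv_pi (W^C)%VS W).

Definition quot_repr : 'Hom(quotv, V) := linfun vsval.

Lemma quot_piE v : vsval (quot_pi v) = daddv_pi (W^C)%VS W v.
Proof. by rewrite lfunE /= vsprojK ?memv_pi. Qed.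

Lemma quot_piK v : v - quot_repr (quot_pi v) \in W.
Proof.
rewrite lfunE /= quot_piE.
have WC : (W^C :&: W = 0)%VS by rewrite capvC capv_compl.
have vW : v \in (W^C + W)%VS by rewrite addvC addv_complf memvf.
by rewrite -{1}(daddv_pi_add WC vW) addrC addKr memv_pi.
Qed.

Lemma quot_pi_eq0 v : (quot_pi v == 0) = (v \in W).
Proof.
apply/eqP/idP => [v0 | vW].
  by have := quot_piK v; rewrite v0 linear0 subr0.
apply/val_inj; rewrite /= quot_piE.
have WC : (W^C :&: W = 0)%VS by rewrite capvC capv_compl.
have WC' : (W :&: W^C = 0)%VS by rewrite capv_compl.
have vT : v \in (W^C + W)%VS by rewrite addvC addv_complf memvf.
have := daddv_pi_add WC vT; rewrite (daddv_pi_id WC' vW).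
by move/(canRL (addrK _)); rewrite subrr.
Qed.

Lemma quot_reprK u : quot_pi (quot_repr u) = u.
Proof.
apply/val_inj; rewrite /= quot_piE lfunE /=.
by apply: daddv_pi_id; rewrite ?subvsP // capvC capv_compl.
Qed.

Lemma quot_pi_congr v w : v - w \in W -> quot_pi v = quot_pi w.
Proof. by rewrite -quot_pi_eq0 linearB subr_eq0 => /eqP. Qed.

End QuotientSpace.
Arguments quot_pi {k V} W.
Arguments quot_repr {k V} W.

(* Proper two-sided ideals: algebras are nonzero. *)
Record ideal (k : fieldType) (A : falgType k) := Ideal {
  ideal_space :> {vspace A};
  ideal_mull : forall a x : A, x \in ideal_space -> a * x \in ideal_space;
  ideal_mulr : forall a x : A, x \in ideal_space -> x * a \in ideal_space;
  ideal_proper : 1 \notin ideal_space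
}.

Definition quot_alg (k : fieldType) (A : falgType k) (I : ideal A) : Type :=
  quotv I.

Section QuotientAlgebra.
Variables (k : fieldType) (A : falgType k) (I : ideal A).
Notation Q := (quot_alg I).

HB.instance Definition _ := Vector.copy Q (quotv I).

Definition quot_proj (a : A) : Q := quot_pi I a.
Local Notation pi := quot_proj.
Local Notation rp := (quot_repr I).

Definition quot_one : Q := pi 1.
Definition quot_mul (x y : Q) : Q := pi (rp x * rp y).

Fact quot_proj_mul a b : pi (a * b) = quot_mul (pi a) (pi b).
Proof.
apply: quot_pi_congr.
set a' := rp (pi a); set b' := rp (pi b).
have -> : a * b - a' * b' = (a - a') * b + a' * (b - b').
  by rewrite mulrBl mulrBr addrA subrK.
by apply: memvD; [apply: ideal_mulr | apply: ideal_mull]; apply: quot_piK.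
Qed.

Fact quot_reprK' (x : Q) : pi (rp x) = x.
Proof. exact: quot_reprK. Qed.

Fact quot_mulA : associative quot_mul.
Proof.
move=> x y z; rewrite -[x]quot_reprK' -[y]quot_reprK' -[z]quot_reprK'.
by rewrite -!quot_proj_mul mulrA.
Qed.
Fact quot_mul1 : left_id quot_one quot_mul.
Proof. by move=> x; rewrite -[x]quot_reprK' -quot_proj_mul mul1r. Qed.
Fact quot_mulr1 : right_id quot_one quot_mul.
Proof. by move=> x; rewrite -[x]quot_reprK' -quot_proj_mul mulr1. Qed.
Fact quot_mulDl : left_distributive quot_mul +%R.
Proof.
by move=> x y z; rewrite /quot_mul linearD mulrDl /quot_proj linearD.
Qed.
Fact quot_mulDr : right_distributive quot_mul +%R.
Proof.
by move=> x y z; rewrite /quot_mul linearD mulrDr /quot_proj linearD.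
Qed.
Fact quot_one_neq0 : quot_one != 0.
Proof. by rewrite quot_pi_eq0 ideal_proper. Qed.
HB.instance Definition _ := GRing.Zmodule_isNzRing.Build Q
  quot_mulA quot_mul1 quot_mulr1 quot_mulDl quot_mulDr quot_one_neq0.

Fact quot_scaleAl (c : k) (x y : Q) : c *: (x * y) = (c *: x) * y.
Proof.
by rewrite /GRing.mul /= /quot_mul linearZ -scalerAl /quot_proj linearZ.
Qed.
HB.instance Definition _ := GRing.Lmodule_isLalgebra.Build k Q quot_scaleAl.
Fact quot_scaleAr (c : k) (x y : Q) : c *: (x * y) = x * (c *: y).
Proof.
by rewrite /GRing.mul /= /quot_mul linearZ -scalerAr /quot_proj linearZ.
Qed.
HB.instance Definition _ := GRing.Lalgebra_isAlgebra.Build k Q quot_scaleAr.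
HB.instance Definition _ := Algebra_isFalgebra.Build k Q.

Fact quot_proj_linear : linear quot_proj.
Proof. by move=> c a b; rewrite /quot_proj linearP. Qed.
HB.instance Definition _ := GRing.isSemilinear.Build k A Q _ quot_proj
  (GRing.semilinear_linear quot_proj_linear).
Fact quot_proj_monoid : monoid_morphism quot_proj.
Proof. by split=> // a b; apply: quot_proj_mul. Qed.
HB.instance Definition _ :=
  GRing.isMonoidMorphism.Build A Q quot_proj quot_proj_monoid.

Definition contains_right_annihilator : Prop :=
  forall a : A, (forall x, x \in (I : {vspace A}) -> x * a = 0) ->
    a \in (I : {vspace A}).

End QuotientAlgebra.
Arguments quot_proj {k A} I a.

Definition alg_isomorphic (k : fieldType) (A B : falgType k) : Prop :=
  exists f : {lrmorphism A -> B}, bijective f.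

Section Restriction.
Variables (k : fieldType) (A B : falgType k) (f : {lrmorphism A -> B}).
Variable V : fdmod B.

Definition res_act (a : A) : 'End(V) := mact V (f a).
Fact res_linear : linear res_act.
Proof. by move=> c a b; rewrite /res_act !linearP. Qed.
HB.instance Definition _ := GRing.isSemilinear.Build k _ _ _ res_act
  (GRing.semilinear_linear res_linear).
Fact res_act1 : res_act 1 = \1%VF.
Proof. by rewrite /res_act rmorph1 mact1. Qed.
Fact res_actM a b : res_act (a * b) = (res_act a \o res_act b)%VF.
Proof. by rewrite /res_act rmorphM mactM. Qed.
Definition res_mod : fdmod A := @FdMod k A V res_act res_act1 res_actM.

End Restriction.

(* mod(A/I), as the full subcategory of the stable category of A given by
   restriction along A -> A/I. *)
Definition quot_sub (k : fieldType) (A : falgType k) (I : ideal A) :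
    stmod A -> Prop :=
  fun X => exists N : fdmod (quot_alg I),
    @isomorphic k (stmod A) X (res_mod (quot_proj I) N).

Section Dual.
Variable k : fieldType.

Definition dualv (V : vectType k) : vectType k := 'Hom(V, k^o).

Section DualMap.
Variables V W : vectType k.

Definition dual_map_fun (f : 'Hom(V, W)) (phi : dualv W) : dualv V :=
  (phi \o f)%VF.
Fact dual_map_fun_linear f : linear (dual_map_fun f).
Proof.
by move=> c phi psi; rewrite /dual_map_fun comp_lfunDl comp_lfunZl.
Qed.
HB.instance Definition _ f := GRing.isSemilinear.Build k _ _ _
  (dual_map_fun f) (GRing.semilinear_linear (dual_map_fun_linear f)).

Definition dual_map (f : 'Hom(V, W)) : 'Hom(dualv W, dualv V) :=
  linfun (dual_map_fun f).

Lemma dual_mapE f phi : dual_map f phi = (phi \o f)%VF.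
Proof. by rewrite lfunE. Qed.

Fact dual_map_linear : linear dual_map.
Proof.
move=> c f g; apply/lfunP => phi.
by rewrite add_lfunE scale_lfunE !dual_mapE comp_lfunDr comp_lfunZr.
Qed.
HB.instance Definition _ := GRing.isSemilinear.Build k _ _ _ dual_map
  (GRing.semilinear_linear dual_map_linear).

End DualMap.

Lemma dual_map1 (V : vectType k) : dual_map (\1%VF : 'End(V)) = \1%VF.
Proof. by apply/lfunP => phi; rewrite dual_mapE comp_lfun1r lfunE. Qed.

Lemma dual_mapM (U V W : vectType k) (g : 'Hom(V, W)) (f : 'Hom(U, V)) :
  dual_map (g \o f) = (dual_map f \o dual_map g)%VF.
Proof. by apply/lfunP => phi; rewrite comp_lfunE !dual_mapE comp_lfunA. Qed.

End Dual.

Section Tensor.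
Variable k : fieldType.

(* The tensor product of finite-dimensional spaces, realized as the space of
   linear maps from the dual of V to W; [tens_universal] below is its
   universal property. *)
Definition tensv (V W : vectType k) : vectType k := 'Hom(dualv V, W).

Section Tens.
Variables V W : vectType k.

Definition tens_fun (v : V) (w : W) (phi : dualv V) : W := (phi v : k) *: w.
Fact tens_fun_linear v w : linear (tens_fun v w).
Proof.
by move=> c f g; rewrite /tens_fun add_lfunE scale_lfunE scalerDl -scalerA.
Qed.
HB.instance Definition _ v w := GRing.isSemilinear.Build k _ _ _
  (tens_fun v w) (GRing.semilinear_linear (tens_fun_linear v w)).
Definition tens (v : V) (w : W) : tensv V W := linfun (tens_fun v w).

Lemma tensE v w phi : tens v w phi = (phi v : k) *: w.
Proof. by rewrite lfunE. Qed.

Lemma tens_linl w c v v' : tens (c *: v + v') w = c *: tens v w + tens v' w.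
Proof.
apply/lfunP => phi.
by rewrite add_lfunE scale_lfunE !tensE linearP scalerDl -scalerA.
Qed.

Lemma tens_linr v c w w' : tens v (c *: w + w') = c *: tens v w + tens v w'.
Proof.
apply/lfunP => phi; rewrite add_lfunE scale_lfunE !tensE scalerDr.
by rewrite !scalerA mulrC.
Qed.

End Tens.

Section TensMap.
Variables V V' W W' : vectType k.

Definition tens_map_fun (f : 'Hom(V, V')) (g : 'Hom(W, W')) (t : tensv V W) :
  tensv V' W' := (g \o t \o dual_map f)%VF.
Fact tens_map_fun_linear f g : linear (tens_map_fun f g).
Proof.
move=> c s t; rewrite /tens_map_fun.
by rewrite comp_lfunDr -comp_lfunZr comp_lfunDl -comp_lfunZl.
Qed.
HB.instance Definition _ f g := GRing.isSemilinear.Build k _ _ _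
  (tens_map_fun f g) (GRing.semilinear_linear (tens_map_fun_linear f g)).
Definition tens_map f g : 'Hom(tensv V W, tensv V' W') :=
  linfun (tens_map_fun f g).

Lemma tens_mapE f g t : tens_map f g t = (g \o t \o dual_map f)%VF.
Proof. by rewrite lfunE. Qed.

Lemma tens_map_tens f g v w : tens_map f g (tens v w) = tens (f v) (g w).
Proof.
apply/lfunP => phi; rewrite tens_mapE !comp_lfunE !tensE linearZ.
by rewrite dual_mapE comp_lfunE.
Qed.

Lemma tens_map_linl g c f f' :
  tens_map (c *: f + f') g = c *: tens_map f g + tens_map f' g.
Proof.
apply/lfunP => t; rewrite add_lfunE scale_lfunE !tens_mapE linearP.
by rewrite comp_lfunDr comp_lfunZr.
Qed.

Lemma tens_map_linr f c g g' :
  tens_map f (c *: g + g') = c *: tens_map f g + tens_map f g'.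
Proof.
apply/lfunP => t; rewrite add_lfunE scale_lfunE !tens_mapE.
by rewrite !comp_lfunDl !comp_lfunZl.
Qed.

End TensMap.

Lemma tens_map1 (V W : vectType k) :
  tens_map (\1%VF : 'End(V)) (\1%VF : 'End(W)) = \1%VF.
Proof.
apply/lfunP => t.
by rewrite tens_mapE dual_map1 comp_lfun1r comp_lfun1l lfunE.
Qed.

Lemma tens_mapM (V V' V'' W W' W'' : vectType k)
    (f' : 'Hom(V', V'')) (f : 'Hom(V, V'))
    (g' : 'Hom(W', W'')) (g : 'Hom(W, W')) :
  tens_map (f' \o f) (g' \o g) = (tens_map f' g' \o tens_map f g)%VF.
Proof.
by apply/lfunP => t; rewrite comp_lfunE !tens_mapE dual_mapM !comp_lfunA.
Qed.

Definition dual_basis (V : vectType k) (i : 'I_(\dim {:V})) : dualv V :=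
  linfun (coord (vbasis {:V}) i : V -> k^o).

Lemma tens_decomp (V W : vectType k) (t : tensv V W) :
  t = \sum_(i < \dim {:V})
    tens (vbasis {:V})`_i (t (dual_basis i)).
Proof.
apply/lfunP => phi; rewrite sum_lfunE.
under eq_bigr do rewrite tensE -linearZ.
rewrite -linear_sum; congr (t _); apply/lfunP => v.
rewrite sum_lfunE {1}(coord_vbasis (memvf v)) linear_sum /=.
apply: eq_bigr => i _; rewrite linearZ scale_lfunE lfunE /=.
exact: mulrC.
Qed.

Fact linear_comb (V W : lmodType k) (f : V -> W) (n : nat) (c : 'I_n -> k)
    (x : 'I_n -> V) :
  linear f -> f (\sum_i c i *: x i) = \sum_i c i *: f (x i).
Proof.
move=> fl.
have f0 : f 0 = 0.
  by have := fl (-1) 0 0; rewrite scaler0 addr0 scaleN1r addNr.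
by elim/big_rec2: _ => // i y z _ <-; rewrite fl.
Qed.

Lemma tens_universal (V W Z : vectType k) (b : V -> W -> Z) :
  (forall w, linear (fun v => b v w)) -> (forall v, linear (b v)) ->
  exists! h : 'Hom(tensv V W, Z), forall v w, h (tens v w) = b v w.
Proof.
move=> bl br; pose e := vbasis {:V}.
pose h (t : tensv V W) : Z :=
  \sum_(i < \dim {:V}) b e`_i (t (dual_basis i)).
have hl : linear h.
  move=> c s t; rewrite /h scaler_sumr -big_split /=.
  by apply: eq_bigr => i _; rewrite add_lfunE scale_lfunE br.
pose hL := GRing.isSemilinear.Build k _ _ _ h (GRing.semilinear_linear hl).
pose hh : {linear tensv V W -> Z} := HB.pack h hL.
have hhE t : linfun hh t = h t by rewrite lfunE.
exists (linfun hh); split=> [v w | h' hh'].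
  rewrite hhE /h [v in RHS](coord_vbasis (memvf v)).
  rewrite (linear_comb _ _ (bl w)); apply: eq_bigr => i _.
  rewrite tensE lfunE /=.
  have := linear_comb (fun _ : 'I_1 => coord (vbasis {:V}) i v) (fun=> w) (br e`_i).
  by rewrite !big_ord1.
apply/lfunP => t; rewrite hhE [t in RHS]tens_decomp linear_sum /h.
by apply: eq_bigr => i _; rewrite /= hh'.
Qed.

End Tensor.

Section Bimodules.
Variables (k : fieldType) (A B : falgType k).

Record rmod := RMod {
  rcar :> vectType k;
  ract : {linear B -> 'End(rcar)};
  ract1 : ract 1 = \1%VF;
  ractM : forall b c, ract (b * c) = (ract c \o ract b)%VF
}.

Definition rlinear (M N : rmod) (f : 'Hom(M, N)) : Prop :=
  forall b x, f (ract M b x) = ract N b (f x).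

Definition projective_rmod (Q : rmod) : Prop :=
  forall (M N : rmod) (g : 'Hom(M, N)) (f : 'Hom(Q, N)),
    rlinear g -> rlinear f -> limg g = fullv ->
    exists2 h : 'Hom(Q, M), rlinear h & (g \o h)%VF = f.

(* The two actions of k on a bimodule agree. *)
Record bimod := BiMod {
  bi_right :> rmod;
  lact : {linear A -> 'End(bi_right)};
  lact1 : lact 1 = \1%VF;
  lactM : forall a b, lact (a * b) = (lact a \o lact b)%VF;
  lactC : forall a b,
    (lact a \o ract bi_right b)%VF = (ract bi_right b \o lact a)%VF
}.

Section BalancedTensor.
Variable Y : bimod.

(* The map y ⊗ m |-> yb ⊗ m - y ⊗ bm. *)
Definition balancing (M : fdmod B) (b : B) : 'End(tensv Y M) :=
  tens_map (ract Y b) \1%VF - tens_map \1%VF (mact M b).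

Definition balanced_rel (M : fdmod B) : {vspace tensv Y M} :=
  (\sum_(i < \dim {:B}) limg (balancing M (vbasis {:B})`_i))%VS.

Lemma balanced_relP (M : fdmod B) b y m :
  tens (ract Y b y) m - tens y (mact M b m) \in balanced_rel M.
Proof.
have -> : tens (ract Y b y) m - tens y (mact M b m) = balancing M b (tens y m).
  by rewrite add_lfunE opp_lfunE !tens_map_tens !id_lfunE.
rewrite (coord_vbasis (memvf b)).
have -> : balancing M (\sum_(i < \dim {:B}) coord (vbasis {:B}) i b *:
    (vbasis {:B})`_i) = \sum_(i < \dim {:B}) coord (vbasis {:B}) i b *:
    balancing M (vbasis {:B})`_i.
  pose bal := balancing M.
  have balL : linear bal.
    move=> c x z; rewrite /bal /balancing !linearP tens_map_linl tens_map_linr.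
    by rewrite opprD addrACA scalerBr.
  exact: (linear_comb _ _ balL).
rewrite sum_lfunE; apply: memv_sumr => i _.
by rewrite scale_lfunE memvZ // memv_img ?memvf.
Qed.

Lemma balanced_rel_map (M N : fdmod B) (f : 'End(Y)) (g : 'Hom(M, N)) t :
  (forall b, (f \o ract Y b)%VF = (ract Y b \o f)%VF) ->
  (forall b, (g \o mact M b)%VF = (mact N b \o g)%VF) ->
  t \in balanced_rel M -> tens_map f g t \in balanced_rel N.
Proof.
move=> fC gC /memv_sumP[u uP ->]; rewrite linear_sum.
apply: memv_sumr => i _ /=.
have /memv_imgP[s _ ->] := uP i isT.
apply/memv_imgP; exists (tens_map f g s); first exact: memvf.
rewrite -!comp_lfunE; congr (fun_of_lfun _ s).
rewrite /balancing comp_lfunDl comp_lfunDr comp_lfunNl comp_lfunNr.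
by rewrite -!tens_mapM fC gC !comp_lfun1l !comp_lfun1r.
Qed.

Definition btens (M : fdmod B) : vectType k := quotv (balanced_rel M).

Definition btens_map (M N : fdmod B) (f : 'End(Y)) (g : 'Hom(M, N)) :
    'Hom(btens M, btens N) :=
  (quot_pi (balanced_rel N) \o tens_map f g \o quot_repr (balanced_rel M))%VF.

Definition ends_compat (f : 'End(Y)) : Prop :=
  forall b, (f \o ract Y b)%VF = (ract Y b \o f)%VF.
Definition hom_compat (M N : fdmod B) (g : 'Hom(M, N)) : Prop :=
  forall b, (g \o mact M b)%VF = (mact N b \o g)%VF.

Fact ends_compat1 : ends_compat \1%VF.
Proof. by move=> b; rewrite comp_lfun1l comp_lfun1r. Qed.
Fact ends_compat_lact a : ends_compat (lact Y a).
Proof. by move=> b; apply: lactC. Qed.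
Fact hom_compat1 M : @hom_compat M M \1%VF.
Proof. by move=> b; rewrite comp_lfun1l comp_lfun1r. Qed.
Fact hom_compat_hom M N (g : modhom M N) : hom_compat g.
Proof. by move=> b; apply/lfunP => x; rewrite !comp_lfunE modhomP. Qed.
Hint Resolve ends_compat1 ends_compat_lact hom_compat1 hom_compat_hom : core.

Lemma btens_map_pi (M N : fdmod B) (f : 'End(Y)) (g : 'Hom(M, N)) t :
  ends_compat f -> hom_compat g ->
  btens_map f g (quot_pi (balanced_rel M) t) =
  quot_pi (balanced_rel N) (tens_map f g t).
Proof.
move=> fC gC; rewrite !comp_lfunE; apply: quot_pi_congr.
rewrite -linearB; apply: balanced_rel_map => //.
by rewrite -opprB rpredN quot_piK.
Qed.

Lemma btens_map_eq (M N : fdmod B) (h h' : 'Hom(btens M, btens N)) :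
  (forall t, h (quot_pi (balanced_rel M) t) = h' (quot_pi (balanced_rel M) t)) ->
  h = h'.
Proof. by move=> hh; apply/lfunP => x; rewrite -(quot_reprK x) hh. Qed.

Lemma btens_map1 (M : fdmod B) :
  btens_map (\1%VF : 'End(Y)) (\1%VF : 'Hom(M, M)) = \1%VF.
Proof.
by apply: btens_map_eq => t; rewrite btens_map_pi // tens_map1 !id_lfunE.
Qed.

Lemma btens_mapM (M N L : fdmod B) (f' f : 'End(Y)) (g' : 'Hom(N, L))
    (g : 'Hom(M, N)) :
  ends_compat f' -> ends_compat f -> hom_compat g' -> hom_compat g ->
  btens_map (f' \o f) (g' \o g) = (btens_map f' g' \o btens_map f g)%VF.
Proof.
move=> f'C fC g'C gC; apply: btens_map_eq => t.
rewrite [in RHS]comp_lfunE !btens_map_pi ?tens_mapM ?comp_lfunE // => b.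
  by rewrite -comp_lfunA fC comp_lfunA f'C comp_lfunA.
by rewrite -comp_lfunA gC comp_lfunA g'C comp_lfunA.
Qed.

Lemma btens_map_linl (M N : fdmod B) (g : 'Hom(M, N)) c (f f' : 'End(Y)) :
  btens_map (c *: f + f') g = c *: btens_map f g + btens_map f' g.
Proof.
rewrite /btens_map tens_map_linl comp_lfunDr -comp_lfunZr.
by rewrite comp_lfunDl -comp_lfunZl.
Qed.

Lemma btens_map_linr (M N : fdmod B) (f : 'End(Y)) c (g g' : 'Hom(M, N)) :
  btens_map f (c *: g + g') = c *: btens_map f g + btens_map f g'.
Proof.
rewrite /btens_map tens_map_linr comp_lfunDr -comp_lfunZr.
by rewrite comp_lfunDl -comp_lfunZl.
Qed.

Section BtensMod.
Variable M : fdmod B.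

Definition btens_act (a : A) : 'End(btens M) := btens_map (lact Y a) \1%VF.
Fact btens_act_linear : linear btens_act.
Proof. by move=> c a b; rewrite /btens_act linearP btens_map_linl. Qed.
HB.instance Definition _ := GRing.isSemilinear.Build k _ _ _ btens_act
  (GRing.semilinear_linear btens_act_linear).
Fact btens_act1 : btens_act 1 = \1%VF.
Proof. by rewrite /btens_act lact1 btens_map1. Qed.
Fact btens_actM a b : btens_act (a * b) = (btens_act a \o btens_act b)%VF.
Proof.
by rewrite /btens_act -btens_mapM // lactM comp_lfun1l.
Qed.

Definition btens_mod : fdmod A :=
  @FdMod k A (btens M) btens_act btens_act1 btens_actM.

End BtensMod.

Fact btens_hom_subproof (M N : fdmod B) (g : modhom M N) :
  btens_map \1%VF g \in mod_linear (btens_mod M) (btens_mod N).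
Proof.
apply/asboolP => a x; rewrite -[LHS]comp_lfunE -[RHS]comp_lfunE.
by rewrite -!btens_mapM // !comp_lfun1l !comp_lfun1r.
Qed.
Definition btens_hom (M N : fdmod B) (g : modhom M N) :
  modhom (btens_mod M) (btens_mod N) := ModHom (btens_hom_subproof g).

Definition btens_functor : functor (modcat B) (modcat A).
Proof.
refine (@Functor k (modcat B) (modcat A) btens_mod btens_hom _ _ _ _).
- by move=> M N f g /subr0_eq->; apply: heq_refl.
- by move=> M N c f g; apply: heq_eq; apply/val_inj; apply: btens_map_linr.
- by move=> M; apply: heq_eq; apply/val_inj; apply: btens_map1.
- move=> M N L g f; apply: heq_eq; apply/val_inj => /=.
  by rewrite -btens_mapM // comp_lfun1l.
Defined.

End BalancedTensor.
End Bimodules.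

Definition group_alg (k : fieldType) (P : finGroupType) : Type :=
  {ffun P -> k^o}.

Section GroupAlgebra.
Variables (k : fieldType) (P : finGroupType).
Local Notation kP := (group_alg k P).

HB.instance Definition _ := Vector.copy kP {ffun P -> k^o}.

Definition galg_coef (x : kP) (g : P) : k := (x : {ffun P -> k^o}) g.
Local Notation "x `_[ g ]" := (galg_coef x g)
  (at level 3, g at level 2, format "x `_[ g ]").

Definition galg_of (f : P -> k) : kP := [ffun g => f g].

Lemma galg_ofE f g : (galg_of f)`_[g] = f g.
Proof. by rewrite /galg_coef ffunE. Qed.
Lemma galg_eq (x y : kP) : (forall g, x`_[g] = y`_[g]) -> x = y.
Proof. by move=> xy; apply/ffunP. Qed.
Lemma galg_coef_lin c (x y : kP) g : (c *: x + y)`_[g] = c * x`_[g] + y`_[g].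
Proof. by rewrite /galg_coef !ffunE. Qed.
Lemma galg_coefD (x y : kP) g : (x + y)`_[g] = x`_[g] + y`_[g].
Proof. by rewrite /galg_coef !ffunE. Qed.
Lemma galg_coefZ c (x : kP) g : (c *: x)`_[g] = c * x`_[g].
Proof. by rewrite /galg_coef !ffunE. Qed.
Lemma galg_coef0 g : (0 : kP)`_[g] = 0.
Proof. by rewrite /galg_coef ffunE. Qed.

Definition galg_elt (g : P) : kP := galg_of (fun h => (h == g)%:R).

Definition galg_mul (x y : kP) : kP :=
  galg_of (fun g => \sum_(h : P) x`_[h] * y`_[(h^-1 * g)%g]).

Fact galg_mulA : associative galg_mul.
Proof.
move=> x y z; apply: galg_eq => g; rewrite !galg_ofE.
under eq_bigr => h _ do rewrite galg_ofE mulr_sumr.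
under [RHS]eq_bigr => h _ do rewrite galg_ofE mulr_suml.
rewrite exchange_big /= [RHS]exchange_big /= exchange_big /=.
apply: eq_bigr => h _.
rewrite [RHS](reindex_inj (mulgI h)) /=.
apply: eq_bigr => j _.
by rewrite mulKg mulrA invMg mulgA.
Qed.
Fact galg_mul1 : left_id (galg_elt 1%g) galg_mul.
Proof.
move=> x; apply: galg_eq => g; rewrite galg_ofE (bigD1 1%g) //= big1 => [|h h1].
  by rewrite galg_ofE eqxx mul1r invg1 mul1g addr0.
by rewrite galg_ofE (negbTE h1) mul0r.
Qed.
Fact galg_mulr1 : right_id (galg_elt 1%g) galg_mul.
Proof.
move=> x; apply: galg_eq => g; rewrite galg_ofE (bigD1 g) //= big1 => [|h hg].
  by rewrite galg_ofE mulVg eqxx mulr1 addr0.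
rewrite galg_ofE; case: eqP => [hg1|]; last by rewrite mulr0.
by case/eqP: hg; rewrite -[LHS]mulg1 -hg1 mulKVg.
Qed.
Fact galg_mulDl : left_distributive galg_mul +%R.
Proof.
move=> x y z; apply: galg_eq => g; rewrite galg_coefD !galg_ofE -big_split /=.
by apply: eq_bigr => h _; rewrite galg_coefD mulrDl.
Qed.
Fact galg_mulDr : right_distributive galg_mul +%R.
Proof.
move=> x y z; apply: galg_eq => g; rewrite galg_coefD !galg_ofE -big_split /=.
by apply: eq_bigr => h _; rewrite galg_coefD mulrDr.
Qed.
Fact galg_one_neq0 : galg_elt 1%g != 0.
Proof.
apply/eqP => /(congr1 (galg_coef^~ 1%g)); rewrite galg_ofE eqxx galg_coef0.
by move/eqP; rewrite oner_eq0.
Qed.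
HB.instance Definition _ := GRing.Zmodule_isNzRing.Build kP
  galg_mulA galg_mul1 galg_mulr1 galg_mulDl galg_mulDr galg_one_neq0.

Lemma galg_mulE (x y : kP) g :
  (x * y)`_[g] = \sum_(h : P) x`_[h] * y`_[(h^-1 * g)%g].
Proof. exact: galg_ofE. Qed.

Fact galg_scaleAl (c : k) (x y : kP) : c *: (x * y) = (c *: x) * y.
Proof.
apply: galg_eq => g; rewrite galg_coefZ !galg_mulE mulr_sumr.
by apply: eq_bigr => h _; rewrite galg_coefZ mulrA.
Qed.
HB.instance Definition _ := GRing.Lmodule_isLalgebra.Build k kP galg_scaleAl.
Fact galg_scaleAr (c : k) (x y : kP) : c *: (x * y) = x * (c *: y).
Proof.
apply: galg_eq => g; rewrite galg_coefZ !galg_mulE mulr_sumr.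
by apply: eq_bigr => h _; rewrite galg_coefZ mulrCA.
Qed.
HB.instance Definition _ := GRing.Lalgebra_isAlgebra.Build k kP galg_scaleAr.
HB.instance Definition _ := Algebra_isFalgebra.Build k kP.

Lemma galg_eltM g h : galg_elt (g * h)%g = galg_elt g * galg_elt h.
Proof.
apply: galg_eq => j; rewrite galg_mulE galg_ofE (bigD1 g) //= big1 => [|i ig].
  rewrite !galg_ofE eqxx mul1r addr0; congr (_%:R); congr nat_of_bool.
  by rewrite -[RHS](inj_eq (mulgI g)) mulKVg.
by rewrite galg_ofE (negbTE ig) mul0r.
Qed.

Section Representation.
Variables (V : vectType k) (rho : P -> 'End(V)).
Hypothesis rho1 : rho 1%g = \1%VF.
Hypothesis rhoM : forall g h, rho (g * h)%g = (rho g \o rho h)%VF.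

Definition rep_act (x : kP) : 'End(V) := \sum_(g : P) x`_[g] *: rho g.
Fact rep_act_linear : linear rep_act.
Proof.
move=> c x y; rewrite /rep_act scaler_sumr -big_split /=.
by apply: eq_bigr => g _; rewrite galg_coef_lin scalerDl scalerA.
Qed.
HB.instance Definition _ := GRing.isSemilinear.Build k _ _ _ rep_act
  (GRing.semilinear_linear rep_act_linear).
Lemma rep_act_elt g : rep_act (galg_elt g) = rho g.
Proof.
rewrite /rep_act (bigD1 g) //= big1 => [|h hg].
  by rewrite galg_ofE eqxx scale1r addr0.
by rewrite galg_ofE (negbTE hg) scale0r.
Qed.
Fact rep_act1 : rep_act 1 = \1%VF.
Proof. by rewrite -rho1; apply: rep_act_elt. Qed.
Fact rep_actM x y : rep_act (x * y) = (rep_act x \o rep_act y)%VF.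
Proof.
apply/lfunP => v; rewrite comp_lfunE !sum_lfunE.
under eq_bigr => g _ do rewrite galg_mulE scale_lfunE scaler_suml.
rewrite exchange_big /=; apply: eq_bigr => h _.
rewrite scale_lfunE linear_sum scaler_sumr (reindex_inj (mulgI h)) /=.
apply: eq_bigr => j _.
by rewrite mulKg rhoM comp_lfunE scale_lfunE linearZ scalerA.
Qed.
Definition rep_mod : fdmod kP := @FdMod k kP V rep_act rep_act1 rep_actM.

End Representation.

Lemma mact_elt1 (V : fdmod kP) : mact V (galg_elt 1%g) = \1%VF.
Proof. exact: mact1. Qed.
Lemma mact_eltM (V : fdmod kP) g h : mact V (galg_elt (g * h)%g) =
  (mact V (galg_elt g) \o mact V (galg_elt h))%VF.
Proof. by rewrite galg_eltM mactM. Qed.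

Definition trivial_mod : fdmod kP :=
  @rep_mod k^o (fun _ => \1%VF) erefl (fun _ _ => esym (comp_lfun1l _)).

Section TensorModule.
Variables V W : fdmod kP.

(* The diagonal action g (v ⊗ w) = g v ⊗ g w. *)
Definition tens_rep (g : P) : 'End(tensv V W) :=
  tens_map (mact V (galg_elt g)) (mact W (galg_elt g)).
Fact tens_rep1 : tens_rep 1%g = \1%VF.
Proof. by rewrite /tens_rep !mact_elt1 tens_map1. Qed.
Fact tens_repM g h : tens_rep (g * h)%g = (tens_rep g \o tens_rep h)%VF.
Proof. by rewrite /tens_rep !mact_eltM tens_mapM. Qed.
Definition tens_mod : fdmod kP := rep_mod tens_rep1 tens_repM.

End TensorModule.

Section DualModule.
Variable V : fdmod kP.

Definition dual_rep (g : P) : 'End(dualv V) :=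
  dual_map (mact V (galg_elt g^-1%g)).
Fact dual_rep1 : dual_rep 1%g = \1%VF.
Proof. by rewrite /dual_rep invg1 mact_elt1 dual_map1. Qed.
Fact dual_repM g h : dual_rep (g * h)%g = (dual_rep g \o dual_rep h)%VF.
Proof. by rewrite /dual_rep invMg mact_eltM dual_mapM. Qed.
Definition dual_mod : fdmod kP := rep_mod dual_rep1 dual_repM.

End DualModule.

Definition endotrivial (V : fdmod kP) : Prop :=
  exists2 U : fdmod kP, projective_mod U &
    is_biproduct2 (trivial_mod : modcat kP) U (tens_mod V (dual_mod V)).

(* The image of a full subcategory of the stable category under V ⊗ -, up to
   isomorphism. *)
Definition tens_sub (V : fdmod kP) (Q : stmod kP -> Prop) :
    stmod kP -> Prop :=
  fun X => exists2 Z : stmod kP, Q Z &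
    @isomorphic k (stmod kP) X (tens_mod V Z).

End GroupAlgebra.

(* Main.v *)
From HB Require Import structures.
From mathcomp Require Import all_boot all_order all_algebra all_fingroup.
From mathcomp Require Import all_solvable all_field.
From mathcomp Require Import boolp.
Require Import Defs.

(**
  Let [T] be a simple [D]-module.  Its endomorphism ring is [k], so [M = Phi T] is
  a module over the group algebra with stable endomorphism ring [k].  By
  Higman's criterion ([factors_projectiveP]) a map is stably zero exactly when it
  is a sum [\sum_g g theta g^-1] of conjugates of a linear map [theta].

  The key point is Carlson's theorem that [dim M] is then prime to [p]
  ([stably_scalar_dim]).  Consider the algebra [A] of linear endomorphisms of
  [M], on which [P] acts by conjugation: modulo traces, its fixed points are the
  scalars.  On a stable subspace whose fixed vectors are traces, the identity is a
  relative trace ([gtr_identity]).  From this one finds a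
  normal subgroup [Q] such that the identity is a [Q]-trace and such that
  multiplication by some fixed element [b] has nonzero trace on the fixed points
  [A^Q] ([projection_trace_neq0]); computed in [A], this trace is a multiple of
  [dim M].

  Once [dim V] is invertible in [k], the trace splits [End V] into scalars and a
  projective module ([trace_complement]), which says that [V] is endotrivial.
  Moreover, two simple modules [S] and [T] have images of dimension prime to [p],
  so [Hom(Phi S, Phi T)] is not projective and there is a stably nonzero map
  [Phi S -> Phi T]; fullness and Schur's lemma give [S = T].  So [D] has one
  simple module, and as it is basic and split, it is local.

  Assume now that [Phi] is [Y ⊗ -], and let [J] be the radical of [D].  Then
  [Hom(V, Y ⊗ T)] is stably isomorphic to [End V], so it is the sum of a line and
  a projective module.  This decomposition lifts, by projectivity of [Y] and
  nilpotence of [J], to a decomposition of [Hom(V, Y)] into a free right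
  [D]-module [v0 D] and a part on which the identity is a relative trace
  ([bimodule_splitting]).  The action of the group algebra on [v0 D] is given by
  a morphism of algebras [alpha] to [D] ([splitting_morphism]), and tensoring
  with a [D]-module [X] shows that [Hom(V, Y ⊗ X)] is stably the restriction of
  [X] along [alpha] ([splitting_stiso]).  As [Hom(V^*, Hom(V, -))] is stably the
  identity, [Phi X] is stably [V ⊗ X] ([tens_res_stiso]).

  The morphism [alpha] is surjective: otherwise some [D]-module over the dual
  numbers would have a commutative endomorphism ring, while the group algebra
  acts on it by scalars ([alpha_surjective]).  Its kernel [I] contains its right
  annihilator: if [I a = 0], then right multiplication by [alpha a] on [D]
  factors through the group algebra, so it is stably zero, and [Phi] is faithful
  ([ker_right_annihilator]).  Since [Phi] is full and faithful with values in
  [V ⊗ mod(kP / I)], and every object there is of the form [V ⊗ X] for a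
  [D]-module [X], it is an equivalence onto that subcategory ([Phi_equivalence]).
*)

Set Implicit Arguments.
Unset Strict Implicit.
Unset Printing Implicit Defensive.

Import GRing.Theory.
Local Open Scope ring_scope.

(** * Linear maps, traces and Fitting's lemma *)

Section LinearMap.
Variables (k : fieldType) (V W : vectType k).

(** [linfun] for a function with an explicit proof of linearity. *)
Definition lmap (f : V -> W) (fl : linear f) : 'Hom(V, W) :=
  linfun (HB.pack f (GRing.isSemilinear.Build k V W _ f
                       (GRing.semilinear_linear fl)) : {linear V -> W}).

Lemma lmapE f (fl : linear f) x : lmap fl x = f x.
Proof. by rewrite lfunE. Qed.

End LinearMap.

Section RankOne.
Variables (k : fieldType) (V W : vectType k).

Fact rank1_linear (w : W) (phi : 'Hom(V, k^o)) :
  linear (fun v => (phi v : k) *: w).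
Proof. by move=> c x y; rewrite linearP scalerDl scalerA. Qed.

Definition rank1 (w : W) (phi : 'Hom(V, k^o)) : 'Hom(V, W) :=
  lmap (rank1_linear w phi).

Lemma rank1E w phi v : rank1 w phi v = (phi v : k) *: w.
Proof. exact: lmapE. Qed.

Definition basisv (i : 'I_(\dim {:V})) : V := (vbasis {:V})`_i.

Lemma basisv_sum v : v = \sum_i (dual_basis i v : k) *: basisv i.
Proof.
rewrite {1}(coord_vbasis (memvf v)).
by apply: eq_bigr => i _; rewrite /dual_basis lfunE.
Qed.

Lemma dual_basisE (i j : 'I_(\dim {:V})) :
  dual_basis i (basisv j) = (i == j)%:R :> k.
Proof.
rewrite /dual_basis lfunE /= /basisv coord_free ?(basis_free (vbasisP _)) //.
by rewrite eq_sym.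
Qed.

Lemma exists_dual_neq0 (v : V) : v != 0 -> exists i, (dual_basis i v : k) != 0.
Proof.
move=> v0; apply: contrapT => nE; case/eqP: v0; rewrite [v]basisv_sum.
apply: big1 => i _; have [->|vi] := eqVneq (dual_basis i v : k) 0.
  exact: scale0r.
by case: nE; exists i.
Qed.

Lemma rank1_sum (f : 'Hom(V, W)) :
  f = \sum_i rank1 (f (basisv i)) (dual_basis i).
Proof.
apply/lfunP => v; rewrite sum_lfunE {1}(basisv_sum v) linear_sum.
by apply: eq_bigr => i _; rewrite linearZ rank1E.
Qed.

Lemma rank1_linl phi : linear (fun w => rank1 w phi).
Proof.
move=> c w w'; apply/lfunP => v; rewrite add_lfunE scale_lfunE !rank1E.
by rewrite scalerDr !scalerA mulrC.
Qed.

Lemma rank1_linr w : linear (rank1 w).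
Proof.
move=> c f f'; apply/lfunP => v.
by rewrite !(add_lfunE, scale_lfunE, rank1E) scalerDl scalerA.
Qed.

End RankOne.

Lemma comp_rank1 (k : fieldType) (V W X : vectType k) (f : 'Hom(W, X)) w
    (phi : 'Hom(V, k^o)) : (f \o rank1 w phi)%VF = rank1 (f w) phi.
Proof. by apply/lfunP => v; rewrite comp_lfunE !rank1E linearZ. Qed.

Section Trace.
Variable k : fieldType.
Implicit Types V W X : vectType k.

(** The trace of an endomorphism of a space without a chosen matrix. *)
Definition ltr V (f : 'End(V)) : k := \sum_i (dual_basis i (f (basisv i)) : k).

Lemma ltr_linear V : linear (@ltr V : 'End(V) -> k^o).
Proof.
move=> c f g; rewrite /ltr scaler_sumr -big_split /=.
by apply: eq_bigr => i _; rewrite add_lfunE scale_lfunE linearP.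
Qed.
HB.instance Definition _ V := GRing.isSemilinear.Build k 'End(V) k^o _ (@ltr V)
  (GRing.semilinear_linear (@ltr_linear V)).

Lemma ltr0 V : ltr (0 : 'End(V)) = 0.
Proof. exact: (linear0 (@ltr V : 'End(V) -> k^o)). Qed.
Lemma ltrD V (f g : 'End(V)) : ltr (f + g) = ltr f + ltr g.
Proof. exact: (linearD (@ltr V : 'End(V) -> k^o)). Qed.
Lemma ltrB V (f g : 'End(V)) : ltr (f - g) = ltr f - ltr g.
Proof. exact: (linearB (@ltr V : 'End(V) -> k^o)). Qed.
Lemma ltrZ V c (f : 'End(V)) : ltr (c *: f) = c * ltr f.
Proof. by have := ltr_linear c f 0; rewrite addr0 ltr0 addr0. Qed.
Lemma ltr_sum V I (r : seq I) (P : pred I) (f : I -> 'End(V)) :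
  ltr (\sum_(i <- r | P i) f i) = \sum_(i <- r | P i) ltr (f i).
Proof. exact: (linear_sum (@ltr V : 'End(V) -> k^o)). Qed.

Lemma ltrC V W (f : 'Hom(V, W)) (g : 'Hom(W, V)) :
  ltr (f \o g)%VF = ltr (g \o f)%VF.
Proof.
transitivity (\sum_i \sum_j (dual_basis i (f (basisv j)) : k) *
                            (dual_basis j (g (basisv i)) : k)).
  apply: eq_bigr => i _; rewrite comp_lfunE {1}(basisv_sum (g (basisv i))).
  rewrite !linear_sum /=; apply: eq_bigr => j _; rewrite !linearZ.
  exact: mulrC.
rewrite exchange_big /=; apply: eq_bigr => j _.
rewrite comp_lfunE {2}(basisv_sum (f (basisv j))) !linear_sum /=.
by apply: eq_bigr => i _; rewrite !linearZ.
Qed.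

Lemma ltr1 V : ltr (\1%VF : 'End(V)) = (\dim {:V})%:R.
Proof.
rewrite /ltr (eq_bigr (fun=> 1)) ?sumr_const ?card_ord // => i _.
by rewrite id_lfunE dual_basisE eqxx.
Qed.

Lemma ltr_rank1 V (v : V) phi : ltr (rank1 v phi) = phi v.
Proof.
rewrite {2}(basisv_sum v) linear_sum; apply: eq_bigr => i _.
by rewrite rank1E !linearZ; apply: mulrC.
Qed.

(** For an [f]-stable subspace [U] this is the trace of [f] on [U]: composition
    with a projection avoids the restriction of [f] to a subtype. *)
Definition str V (U : {vspace V}) (f : 'End(V)) : k := ltr (f \o projv U)%VF.

Lemma str_full V (f : 'End(V)) : str fullv f = ltr f.
Proof.
by congr ltr; apply/lfunP => v; rewrite comp_lfunE projv_id ?memvf.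
Qed.

Lemma str_eq V (U : {vspace V}) (f g : 'End(V)) :
  {in U, f =1 g} -> str U f = str U g.
Proof.
by move=> fg; congr ltr; apply/lfunP => v; rewrite !comp_lfunE fg ?memv_proj.
Qed.

Lemma str_proj V (U : {vspace V}) (f e : 'End(V)) :
  {in U, forall u, f u \in U} -> (forall v, e v \in U) -> {in U, e =1 id} ->
  str U f = ltr (f \o e)%VF.
Proof.
move=> fU eU e1; rewrite /str.
have -> : (f \o e = projv U \o (f \o e))%VF.
  by apply/lfunP => v; rewrite !comp_lfunE projv_id ?fU ?eU.
rewrite [RHS]ltrC -comp_lfunA; congr ltr; congr (_ \o _)%VF.
by apply/lfunP => v; rewrite comp_lfunE e1 ?memv_proj.
Qed.

(** A section of [x] on [x U] decomposes the projection onto [U] into one onto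
    [U ∩ ker x] and one onto a copy of [x U], on which [f] acts as [g]. *)
Lemma str_add V W (x : 'Hom(V, W)) (U : {vspace V}) (f : 'End(V)) (g : 'End(W)) :
  {in U, forall u, f u \in U} -> {in U, forall u, x (f u) = g (x u)} ->
  str U f = str (U :&: lker x) f + str (x @: U) g.
Proof.
move=> fU xf; pose y := (x \o projv U)%VF.
pose s := (projv U \o y^-1 \o projv (x @: U))%VF.
have yU : limg y = (x @: U)%VS by rewrite limg_comp limg_proj.
have sU w : s w \in U by rewrite !comp_lfunE memv_proj.
have xs w : x (s w) = projv (x @: U) w.
  rewrite !comp_lfunE -[LHS]comp_lfunE -/y limg_lfunVK //.
  by rewrite yU memv_proj.
clearbody s; pose eK := (projv U - (s \o x \o projv U))%VF.
have eKE v : eK v = projv U v - s (x (projv U v)).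
  by rewrite add_lfunE opp_lfunE !comp_lfunE.
have -> : str (U :&: lker x) f = ltr (f \o eK)%VF.
  apply: str_proj => [u | v | u].
  - rewrite !memv_cap !memv_ker => /andP[uU /eqP xu].
    by rewrite fU // xf // xu linear0 eqxx.
  - rewrite eKE memv_cap memvB ?memv_proj ?sU // memv_ker linearB /= xs.
    by rewrite [projv (x @: U) _]projv_id ?subrr ?memv_img ?memv_proj.
  - rewrite memv_cap memv_ker => /andP[uU /eqP xu].
    by rewrite eKE (projv_id uU) xu linear0 subr0.
have -> : str (x @: U) g = ltr (f \o s \o x \o projv U)%VF.
  rewrite /str -[in RHS]comp_lfunA [RHS]ltrC.
  have -> : ((x \o projv U) \o (f \o s) = x \o f \o s)%VF.
    by apply/lfunP => w; rewrite !comp_lfunE projv_id ?fU.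
  by congr ltr; apply/lfunP => w; rewrite !comp_lfunE xf // -xs.
rewrite -ltrD; congr ltr; apply/lfunP => v.
by rewrite add_lfunE !comp_lfunE eKE -linearD subrK.
Qed.

Lemma str0 V (U : {vspace V}) f : U = 0%VS -> str U f = 0.
Proof.
move=> ->; rewrite /str; have -> : (f \o projv 0 = 0)%VF; last exact: ltr0.
apply/lfunP => v; rewrite comp_lfunE zero_lfunE.
by have := memv_proj 0 v; rewrite memv0 => /eqP ->; rewrite linear0.
Qed.

Lemma str1 V (U : {vspace V}) : str U \1%VF = (\dim U)%:R.
Proof.
have := @str_proj V U \1%VF (projv U); rewrite comp_lfun1l => ->; last 3 first.
- by move=> u; rewrite id_lfunE.
- exact: memv_proj.
- by move=> u /projv_id.
pose i : 'Hom(subvs_of U, V) := linfun vsval.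
pose q : 'Hom(V, subvs_of U) := linfun (vsproj U).
have -> : projv U = (i \o q)%VF.
  by apply/lfunP => v; rewrite comp_lfunE !lfunE /= [vsproj _]unlock.
rewrite ltrC; have -> : (q \o i = \1)%VF.
  by apply/lfunP => v; rewrite comp_lfunE !lfunE /= vsvalK.
by rewrite ltr1 !dimvf.
Qed.

End Trace.

Section PolyEval.
Variable k : fieldType.
Implicit Types V W : vectType k.

Definition lpow V (f : 'End(V)) n : 'End(V) := iter n (comp_lfun f) \1%VF.

Arguments lpow : simpl never.

Lemma lpowS V (f : 'End(V)) n : lpow f n.+1 = (f \o lpow f n)%VF.
Proof. by []. Qed.

Lemma lpowE V (f : 'End(V)) n v : lpow f n v = iter n f v.
Proof. by elim: n => [|n IH]; rewrite ?id_lfunE // lpowS comp_lfunE IH. Qed.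

Lemma lpowSr V (f : 'End(V)) n : lpow f n.+1 = (lpow f n \o f)%VF.
Proof. by apply/lfunP => v; rewrite comp_lfunE !lpowE iterSr. Qed.

(** Horner evaluation requires a ring, and the endomorphisms of a space are one
    only when the space is nonzero. *)
Definition peval V (f : 'End(V)) (q : {poly k}) : 'End(V) :=
  \sum_(i < size q) q`_i *: lpow f i.

Lemma pevalE V (f : 'End(V)) (q : {poly k}) n : (size q <= n)%N ->
  peval f q = \sum_(i < n) q`_i *: lpow f i.
Proof.
move=> qn; rewrite /peval (big_ord_widen n (fun i => q`_i *: lpow f i)) //.
rewrite big_mkcond; apply: eq_bigr => i _; case: ltnP => // qi.
by rewrite nth_default // scale0r.
Qed.

Lemma peval_linear V (f : 'End(V)) : linear (peval f).
Proof.
move=> c q r; pose n := maxn (size (c *: q + r)) (maxn (size q) (size r)).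
rewrite !(@pevalE V f _ n) ?leq_max ?leqnn ?orbT //.
rewrite scaler_sumr -big_split; apply: eq_bigr => i _ /=.
by rewrite coefD coefZ scalerDl scalerA.
Qed.
HB.instance Definition _ V (f : 'End(V)) := GRing.isSemilinear.Build k _ _ _
  (peval f) (GRing.semilinear_linear (peval_linear f)).

Lemma pevalXn V (f : 'End(V)) n : peval f 'X^n = lpow f n.
Proof.
rewrite /peval size_polyXn big_ord_recr /= coefXn eqxx scale1r big1 ?add0r //.
by move=> i _; rewrite coefXn ltn_eqF ?scale0r.
Qed.

Lemma peval1 V (f : 'End(V)) : peval f 1 = \1%VF.
Proof. by rewrite -(expr0 'X) pevalXn. Qed.

Lemma pevalX V (f : 'End(V)) : peval f 'X = f.
Proof. by rewrite -['X]expr1 pevalXn /lpow /= comp_lfun1r. Qed.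

Lemma lpowD V (f : 'End(V)) m n : lpow f (m + n) = (lpow f m \o lpow f n)%VF.
Proof. by apply/lfunP => v; rewrite comp_lfunE !lpowE iterD. Qed.

Lemma pevalMX V (f : 'End(V)) q : peval f (q * 'X) = (peval f q \o f)%VF.
Proof.
rewrite (@pevalE _ f (q * 'X) (size q).+1); last first.
  by have [->|q0] := eqVneq q 0; rewrite ?mul0r ?size_poly0 // size_mulX.
rewrite big_ord_recl coefMX eqxx scale0r add0r; apply/lfunP => v.
rewrite comp_lfunE !sum_lfunE; apply: eq_bigr => i _.
by rewrite coefMX /= !scale_lfunE -comp_lfunE -lpowSr.
Qed.

Lemma pevalM V (f : 'End(V)) q r : peval f (q * r) = (peval f q \o peval f r)%VF.
Proof.
elim/poly_ind: r => [|r c IH]; first by rewrite mulr0 !linear0 comp_lfun0r.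
rewrite -alg_polyC mulrDr mulrA -scalerAr mulr1 !linearD !linearZ /= !pevalMX.
by rewrite IH peval1 comp_lfunDr -comp_lfunZr comp_lfun1r comp_lfunA.
Qed.

Lemma peval_comm V W (f : 'End(V)) (g : 'End(W)) (x : 'Hom(V, W)) q :
  (x \o f = g \o x)%VF -> (x \o peval f q = peval g q \o x)%VF.
Proof.
move=> xf; elim/poly_ind: q => [|q c IH].
  by rewrite !linear0 comp_lfun0r comp_lfun0l.
rewrite -alg_polyC !linearD !linearZ /= !peval1 !pevalMX.
rewrite comp_lfunDr comp_lfunDl -comp_lfunZr -comp_lfunZl comp_lfun1l comp_lfun1r.
by rewrite comp_lfunA IH -!comp_lfunA xf.
Qed.

(** The powers of [f] cannot all be independent in a space of finite dimension. *)
Lemma peval_annihilator V (f : 'End(V)) : exists2 q, q != 0 & peval f q = 0.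
Proof.
pose n := (\dim {: 'End(V)}).+1.
pose X : n.-tuple 'End(V) := [tuple lpow f i | i < n].
have /freeP nf : ~~ free X.
  rewrite /free neq_ltn (leq_trans _ (leqnn (size X))) // size_tuple ltnS.
  exact: dimvS (subvf _).
pose E (c : 'I_n -> k) := \sum_(i < n) c i *: X`_i = 0.
have [c [cE [i ci]]] : exists c : 'I_n -> k, E c /\ exists i, c i != 0.
  apply: contrapT => nE; apply: nf => c cE i.
  by have [//|ci] := eqVneq (c i) 0; case: nE; exists c; split=> //; exists i.
exists (\poly_(j < n) (c (inord j))).
  apply: contraNneq ci => /(congr1 (fun q : {poly k} => q`_i)).
  by rewrite coef_poly ltn_ord inord_val coef0 => ->.
rewrite (pevalE _ (size_poly _ _)) -[RHS]cE; apply: eq_bigr => j _.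
by rewrite coef_poly ltn_ord inord_val (nth_map j) ?size_enum_ord // nth_ord_enum.
Qed.

(** Fitting's lemma.  The projection is obtained from a Bezout relation between
    the power of [X] in an annihilating polynomial and the cofactor; as it is a
    polynomial in [f], it commutes with whatever commutes with [f]. *)
Lemma fitting V (f : 'End(V)) : exists n (q : {poly k}),
  let e := peval f (q * 'X^(n.+1)) in
  (e \o e = e)%VF /\ (lpow f n.+1 \o e = lpow f n.+1)%VF.
Proof.
have [r r0 fr] := peval_annihilator f.
have [n [s]] := multiplicity_XsubC r 0; rewrite r0 /= subr0 => s0 rE.
have : coprimep ('X^(n.+1)) s.
  by apply: coprimep_expl; rewrite coprimep_sym -['X]subr0 coprimep_XsubC.
case/Bezout_eq1_coprimepP=> -[u v] /= uv.
exists n, u; set e := peval f _.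
have sX : peval f ('X^(n.+1) * s) = 0.
  by rewrite exprS -mulrA [_ * s]mulrC -rE pevalM fr comp_lfun0r.
have e1 : e = \1%VF - peval f (v * s).
  by rewrite -(peval1 f) -uv linearD /= addrK.
split.
  rewrite {2}e1 comp_lfunDr comp_lfun1r comp_lfunNr -pevalM mulrACA pevalM sX.
  by rewrite comp_lfun0r subr0.
rewrite e1 comp_lfunDr comp_lfun1r comp_lfunNr -pevalXn -pevalM mulrCA pevalM sX.
by rewrite comp_lfun0r subr0.
Qed.

End PolyEval.

Section CharP.
Variables (k : fieldType) (p : nat).
Hypothesis pk : p \in [pchar k].

Lemma polyXsub1_expp n : ('X - 1) ^+ (p ^ n) = 'X^(p ^ n) - 1 :> {poly k}.
Proof.
have pn : [pchar {poly k}].-nat (p ^ n)%N.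
  by rewrite pnatX; apply/orP; left; rewrite pnatE ?(pcharf_prime pk) // pchar_poly.
by have := exprDn_pchar ('X - 1) 1 pn; rewrite subrK expr1n => ->; rewrite addrK.
Qed.

Lemma polyXsub1_expp1 : ('X - 1) ^+ p.-1 = \sum_(i < p) 'X^i :> {poly k}.
Proof.
have X1 : 'X - 1 != 0 :> {poly k} by rewrite -polyC1 polyXsubC_eq0.
apply: (mulfI X1); rewrite -exprS prednK ?prime_gt0 ?(pcharf_prime pk) //.
by rewrite -subrX1 -[p]expn1 polyXsub1_expp.
Qed.

End CharP.

Section Nilpotent.
Variable k : fieldType.

Lemma str_nilpotent (V : vectType k) n (U : {vspace V}) (f : 'End(V)) :
  {in U, forall u, f u \in U} -> {in U, forall u, iter n f u = 0} -> str U f = 0.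
Proof.
elim: n U => [|n IH] U fU fn.
  by apply: str0; apply/eqP; rewrite -subv0; apply/subvP => u /fn /= ->; apply: mem0v.
rewrite (@str_add _ _ _ f U f f) //.
rewrite (@str_eq _ _ _ f 0) => [|u]; last first.
  by rewrite memv_cap memv_ker zero_lfunE => /andP[_ /eqP].
rewrite /str comp_lfun0l ltr0 add0r; apply: IH => u /memv_imgP[w wU ->].
  by rewrite memv_img // fU.
by rewrite -iterSr fn.
Qed.

Lemma peval_exp (V : vectType k) (t : 'End(V)) q n :
  peval t (q ^+ n) = lpow (peval t q) n.
Proof.
by elim: n => [|n IH]; rewrite ?expr0 ?peval1 // exprS pevalM IH.
Qed.

Lemma peval_Xsub1 (V : vectType k) (t : 'End(V)) : peval t ('X - 1) = t - \1%VF.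
Proof. by rewrite linearB /= peval1 pevalX. Qed.

(** Here [(t - 1)^(p^n) = t^(p^n) - 1 = 0], so [t - 1] is nilpotent and has trace
    zero. *)
Lemma ltr_unipotent (p : nat) (V : vectType k) (t : 'End(V)) n :
  p \in [pchar k] -> lpow t (p ^ n) = \1%VF -> ltr t = (\dim {:V})%:R.
Proof.
move=> pk tn; rewrite -ltr1; apply/eqP; rewrite -subr_eq0; apply/eqP.
rewrite -ltrB -str_full.
apply: (@str_nilpotent _ (p ^ n)) => [u _ | u _]; first exact: memvf.
rewrite -lpowE -peval_Xsub1 -peval_exp polyXsub1_expp // linearB /= pevalXn peval1.
by rewrite tn subrr zero_lfunE.
Qed.

(** In characteristic [p] one has [(X - 1)^(p - 1) = 1 + X + ... + X^(p - 1)]. *)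
Lemma lpow_sub1 (p : nat) (V : vectType k) (t : 'End(V)) : p \in [pchar k] ->
  lpow (t - \1%VF) p.-1 = \sum_(i < p) lpow t i.
Proof.
move=> pk; rewrite -peval_Xsub1 -peval_exp polyXsub1_expp1 // linear_sum.
by apply: eq_bigr => i _; rewrite /= pevalXn.
Qed.

Lemma lpow_sub1_nil (p : nat) (V : vectType k) (t : 'End(V)) v :
  p \in [pchar k] -> iter p t v = v -> lpow (t - \1%VF) p v = 0.
Proof.
move=> pk tv; rewrite -peval_Xsub1 -peval_exp -(expn1 p) polyXsub1_expp // expn1.
by rewrite linearB /= pevalXn peval1 add_lfunE opp_lfunE id_lfunE lpowE tv subrr.
Qed.

End Nilpotent.

(** * Central elements of order p modulo a normal subgroup *)

Section PGroups.
Variables (P : finGroupType) (p : nat).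
Implicit Types G H K Q : {group P}.

(** The preimage of an element of order [p] in the centre of [G / K]. *)
Lemma central_step G K : (p.-group G)%g -> (K <| G)%g -> ~~ (G \subset K) ->
  exists t : P, [/\ t \in G, t \notin K, (t ^+ p)%g \in K &
    forall h, h \in G -> ([~ t, h])%g \in K].
Proof.
move=> pG nKG GK; have [sKG nK] := andP nKG.
have pGK : (p.-group (G / K))%g by apply: quotient_pgroup.
have ntGK : (G / K)%g != 1%g by apply: contra GK; rewrite -quotient_sub1 // => /eqP ->.
have ntZ : 'Z(G / K)%g != 1%g.
  by rewrite (center_nil_eq1 (pgroup_nil pGK)).
have pZ : (p.-group 'Z(G / K))%g := pgroupS (center_sub _) pGK.
have [pr_p pdvd _] := pgroup_pdiv pZ ntZ.
have [x xZ ox] := Cauchy pr_p pdvd.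
have xG : x \in (G / K)%g := subsetP (center_sub _) _ xZ.
have /morphimP[t nt tG xE] := xG.
exists t; split=> //.
- apply/negP => tK; have := ox; rewrite xE /= coset_id // order1 => p1.
  by move: pr_p; rewrite -p1.
- by apply: coset_idr; rewrite ?groupX // morphX //= -xE -ox expg_order.
move=> h hG; have nh := subsetP nK _ hG.
apply: coset_idr; first by rewrite groupR.
rewrite morphR //= -xE; apply/eqP/commgP.
by have /centerP[_] := xZ; apply; apply: mem_quotient.
Qed.

(** [Z] is the union of the cosets [g^i Q] for [i < p]; it is normal because the
    class of [g] is central in [G / Q]. *)
Lemma cyclic_step G Q (g : P) : prime p -> (Q <| G)%g -> g \in G ->
    g \notin Q -> (g ^+ p)%g \in Q -> (forall h, h \in G -> ([~ g, h])%g \in Q) ->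
  exists Z : {group P}, [/\ (Z <| G)%g, Q \proper Z, g \in Z,
    (forall z, z \in Z -> exists i q, q \in Q /\ z = (g ^+ i * q)%g) &
    forall (W : nmodType) (F : P -> W),
      \sum_(z in Z) F z = \sum_(i < p) \sum_(q in Q) F (g ^+ i * q)%g].
Proof.
move=> pr_p nQG gG gQ gp gC; have [sQG nQ] := andP nQG.
have ng : g \in 'N(Q)%g := subsetP nQ _ gG.
pose f (iq : 'I_p * P) := (g ^+ iq.1 * iq.2)%g.
pose Z : {set P} := f @: setX setT (Q : {set P}).
have fpE i q : q \in Q -> (g ^+ i * q)%g \in Z.
  move=> qQ; apply/imsetP; exists (Ordinal (ltn_pmod i (prime_gt0 pr_p)),
     ((g ^+ p) ^+ (i %/ p) * q)%g); first by rewrite in_setX in_setT /= groupM // groupX.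
  by rewrite /f /= mulgA -expgM -expgD mulnC addnC -divn_eq.
have QZ q : q \in Q -> q \in Z by move/(fpE 0); rewrite expg0 mul1g.
have inZ z : z \in Z -> exists i q, q \in Q /\ z = (g ^+ i * q)%g.
  by case/imsetP=> -[i q]; rewrite in_setX /= => /andP[_ qQ] ->; exists i, q.
have ZN z : z \in Z -> z \in 'N(Q)%g.
  by case/inZ=> i [q [qQ ->]]; apply: groupM; [exact: groupX | exact: (subsetP (normG Q))].
have gZ : group_set Z.
  apply/group_setP; split; first by rewrite QZ.
  move=> x y /inZ[i [q [qQ ->]]] /inZ[j [s [sQ ->]]].
  have -> : (g ^+ i * q * (g ^+ j * s) = g ^+ (i + j) * (q ^ (g ^+ j) * s))%g.
    by rewrite expgD conjgE !mulgA mulgK.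
  by rewrite fpE // groupM // memJ_norm // groupX.
exists (Group gZ); split=> //=.
- apply/andP; split.
    by apply/subsetP => z /inZ[i [q [qQ ->]]]; apply: groupM; [exact: groupX | exact: (subsetP sQG)].
  apply/subsetP => h hG; rewrite inE; apply/subsetP => _ /imsetP[z /inZ[i [q [qQ ->]]] ->].
  have nh := subsetP nQ _ hG.
  have nqh : (q ^ h)%g \in Q by rewrite memJ_norm.
  rewrite conjMg conjXg.
  have -> : (g ^ h = g * [~ g, h])%g by rewrite /commg conjgE !mulgA mulgV mul1g.
  elim: i (q ^ h)%g nqh => [|i IH] q' q'Q.
    by rewrite expg0 mul1g QZ.
  rewrite expgSr -mulgA; apply: (@group_setP _ _ gZ).2 => //.
    by have := IH 1%g (group1 _); rewrite mulg1.
  by rewrite -mulgA -{1}(expg1 g) fpE // groupM ?gC.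
- apply/properP; split; last by exists g; rewrite // -(mulg1 g) -(expg1 g) fpE.
  by apply/subsetP => q qQ; rewrite -(mul1g q) -(expg0 g) fpE.
- by rewrite -(mulg1 g) -(expg1 g) fpE.
move=> W F; rewrite /Z big_imset /=.
  rewrite (eq_bigl (fun iq : 'I_p * P => true && (iq.2 \in Q))) ?pair_big_dep //=.
  by move=> [i q]; rewrite in_setX in_setT.
move=> [i q] [j s]; rewrite !in_setX !in_setT /= => qQ sQ; rewrite /f /= => eij.
have ordg : #[coset Q g]%g = p.
  apply/prime_nt_dvdP => //; last first.
    by rewrite order_dvdn -morphX //= coset_id.
  by rewrite order_eq1; apply: contra gQ => /eqP /(coset_idr ng).
have ij : i = j.
  apply/ord_inj/eqP; have := congr1 (coset Q) eij.
  have [nq ns] := (subsetP (normG Q) _ qQ, subsetP (normG Q) _ sQ).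
  rewrite !morphM ?groupX //= !morphX //=.
  rewrite (coset_id qQ) (coset_id sQ) !mulg1 => /eqP.
  by rewrite eq_expg_mod_order ordg !modn_small.
by move: eij; rewrite ij => /mulgI ->.
Qed.

End PGroups.

(** * Fixed vectors and sums of conjugates *)

Section Representation.
Variables (k : fieldType) (P : finGroupType) (V : vectType k).
Variable r : P -> 'End(V).
Hypothesis r1 : r 1%g = \1%VF.
Hypothesis rM : forall g h, r (g * h)%g = (r g \o r h)%VF.
Implicit Types (U : {vspace V}) (G H K : {group P}).

Lemma rep1 v : r 1%g v = v. Proof. by rewrite r1 id_lfunE. Qed.
Lemma repM g h v : r (g * h)%g v = r g (r h v).
Proof. by rewrite rM comp_lfunE. Qed.
Lemma repK g v : r g^-1%g (r g v) = v.
Proof. by rewrite -repM mulVg rep1. Qed.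
Lemma repKV g v : r g (r g^-1%g v) = v.
Proof. by rewrite -repM mulgV rep1. Qed.
Lemma repX g n v : r (g ^+ n)%g v = iter n (r g) v.
Proof. by elim: n => [|n IH]; rewrite ?rep1 // expgS repM IH. Qed.

Definition rstable (H : {set P}) U := forall h, h \in H -> {in U, forall u, r h u \in U}.

Definition rfix (H : {set P}) : {vspace V} :=
  (\bigcap_(h in H) lker (r h - \1%VF))%VS.

Lemma rfixP (H : {set P}) v :
  reflect (forall h, h \in H -> r h v = v) (v \in rfix H).
Proof.
apply: (iffP idP) => [|vH].
  rewrite memvE => /subv_bigcapP vH h /vH.
  by rewrite -memvE memv_ker add_lfunE opp_lfunE id_lfunE subr_eq0 => /eqP.
rewrite memvE; apply/subv_bigcapP => h hH.
by rewrite -memvE memv_ker add_lfunE opp_lfunE id_lfunE vH // subrr.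
Qed.

Definition gsum (H : {set P}) : 'End(V) := \sum_(h in H) r h.

Lemma gsumE (H : {set P}) v : gsum H v = \sum_(h in H) r h v.
Proof. exact: sum_lfunE. Qed.

Lemma rep_gsum H g v : g \in H -> r g (gsum H v) = gsum H v.
Proof.
move=> gH; rewrite !gsumE linear_sum /=.
rewrite [RHS](reindex_inj (mulgI g)) /=; apply: eq_big => [h|h _].
  by rewrite groupMl.
by rewrite repM.
Qed.

Lemma gsum_fix H v : gsum H v \in rfix H.
Proof. by apply/rfixP => h hH; rewrite rep_gsum. Qed.

Lemma gsum_coset H K (W : nmodType) (F : P -> W) : H \subset K ->
  \sum_(g in K) F g =
  \sum_(C in rcosets H K) \sum_(h in H) F (h * repr C)%g.
Proof.
move=> sHK; rewrite (set_partition_big _ (rcosets_partition sHK)) /=.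
apply: eq_bigr => C /rcosetsP[x xK CE].
have yC : C = (H :* repr C)%g by rewrite CE rcoset_repr.
rewrite (reindex_inj (mulIg (repr C))) /=; apply: eq_bigl => h.
by rewrite {2}yC mem_rcoset mulgK.
Qed.

Lemma gsum_sub H K : H \subset K -> exists T : 'End(V), gsum K = (gsum H \o T)%VF.
Proof.
move=> sHK; exists (\sum_(C in rcosets H K) r (repr C)).
apply/lfunP => v; rewrite comp_lfunE gsumE (gsum_coset _ sHK) sum_lfunE.
rewrite linear_sum /=; apply: eq_bigr => C _; rewrite gsumE.
by apply: eq_bigr => h _; rewrite repM.
Qed.

(** The relative trace for the conjugation action on endomorphisms; by Higman's
    criterion its values are the maps that vanish stably. *)
Definition gtr (theta : 'End(V)) : 'End(V) :=
  \sum_(g : P) (r g \o theta \o r g^-1%g)%VF.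

Lemma gtrE theta v : gtr theta v = \sum_(g : P) r g (theta (r g^-1%g v)).
Proof. by rewrite sum_lfunE; apply: eq_bigr => g _; rewrite !comp_lfunE. Qed.

Lemma gtr_linear : linear gtr.
Proof.
move=> c f f'; apply/lfunP => v; rewrite add_lfunE scale_lfunE !gtrE scaler_sumr.
rewrite -big_split; apply: eq_bigr => g _.
by rewrite /= add_lfunE scale_lfunE linearP.
Qed.

Lemma gtr_compl (f theta : 'End(V)) : (forall g v, f (r g v) = r g (f v)) ->
  (f \o gtr theta)%VF = gtr (f \o theta)%VF.
Proof.
move=> fC; apply/lfunP => v; rewrite comp_lfunE !gtrE linear_sum.
by apply: eq_bigr => g _; rewrite /= fC comp_lfunE.
Qed.

Lemma gtr_rep theta g v : gtr theta (r g v) = r g (gtr theta v).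
Proof.
rewrite !gtrE linear_sum /= (reindex_inj (mulgI g)) /=; apply: eq_bigr => h _.
by rewrite invMg !repM repK.
Qed.

(** Grouping the conjugates by cosets of [H] leaves an outer sum over [H], as the
    inner action of [H] on [v] is trivial. *)
Lemma gtr_fix theta H v : v \in rfix H -> exists w, gtr theta v = gsum H w.
Proof.
move/rfixP=> vH; rewrite gtrE.
have sH : H \subset [group of [set: P]] by rewrite subsetT.
rewrite (eq_bigl (fun g => g \in [group of [set: P]])) => [|g]; last first.
  by rewrite inE.
rewrite (gsum_coset _ sH).
exists (\sum_(C in rcosets H [set: P]) r (repr C) (theta (r (repr C)^-1%g v))).
rewrite linear_sum /=; apply: eq_bigr => C _; rewrite gsumE.
apply: eq_bigr => h hH; rewrite repM invMg repM; congr (r _ (r _ (theta (r _ _)))).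
by rewrite vH ?groupV.
Qed.

Variable p : nat.
Hypothesis pk : p \in [pchar k].

(** Climb a chain of subgroups, each normal of index [p] in the next: an element
    of [p]-power order is unipotent, so it fixes a nonzero vector of the space
    fixed by the preceding subgroup. *)
Lemma rfix_pgroup_neq0 H U : (p.-group H)%g -> rstable H U -> U != 0%VS ->
  exists u, [/\ u \in U, u != 0 & u \in rfix H].
Proof.
have pr_p := pcharf_prime pk.
move: {2}_.+1 (ltnSn #|H|) => n; elim: n H => // n IH H; rewrite ltnS => leHn pH.
move=> HU U0; have [H1 | ntH] := eqVneq (H : {set P}) 1%g.
  exists (vpick U); rewrite memv_pick vpick0 U0; split=> //.
  by apply/rfixP => h; rewrite H1 inE => /eqP->; rewrite rep1.
have [_ _ [m oH]] := pgroup_pdiv pH ntH.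
have lm : (m <= logn p #|H|)%N by rewrite oH pfactorK.
have [K [_ nKH oK]] := normal_pgroup pH (normal_refl H) lm.
have sKH := normal_sub nKH.
have ltKH : (#|K| < #|H|)%N by rewrite oK oH ltn_exp2l ?prime_gt1.
have [g gH gK] : exists2 g, g \in H & g \notin K.
  by apply/subsetPn; apply/negP => /subset_leq_card; rewrite leqNgt ltKH.
have [u0 [u0U u00 u0K]] := IH K (leq_trans ltKH leHn) (pgroupS sKH pH)
  (fun h hK => HU h (subsetP sKH h hK)) U0.
pose x := r g - \1%VF.
have xE v : x v = r g v - v by rewrite add_lfunE opp_lfunE id_lfunE.
have xKU v : v \in (U :&: rfix K)%VS -> x v \in (U :&: rfix K)%VS.
  rewrite !memv_cap => /andP[vU /rfixP vK]; rewrite xE memvB ?HU //=.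
  apply/rfixP => h hK; rewrite linearB /= (vK h hK); congr (_ - _).
  rewrite -{2}(vK (h ^ g)%g) ?memJ_norm //; last first.
    exact: (subsetP (normal_norm nKH)).
  by rewrite -!repM conjgE mulKVg.
have [i [xi xSi]] : exists i, iter i x u0 != 0 /\ iter i.+1 x u0 = 0.
  have xn : exists i, iter i x u0 == 0.
    exists (p ^ m.+1)%N; rewrite -lpowE /x -peval_Xsub1 -peval_exp polyXsub1_expp //.
    rewrite linearB /= pevalXn peval1 add_lfunE opp_lfunE id_lfunE lpowE -repX.
    by rewrite -oH expg_cardG // rep1 subrr.
  case: (ex_minnP xn) => -[|i] xi min; first by rewrite /= (negPf u00) in xi.
  exists i; split; last exact/eqP.
  by apply/negP => /min; rewrite ltnn.
have yKU : iter i x u0 \in (U :&: rfix K)%VS.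
  by elim: i {xi xSi} => [|i IHi]; [rewrite memv_cap u0U | apply: xKU].
exists (iter i x u0); move: yKU; rewrite memv_cap => /andP[yU /rfixP yK]; split=> //.
have yg : r g (iter i x u0) = iter i x u0.
  by apply/eqP; rewrite -subr_eq0 -xE; apply/eqP.
pose S := [set h in H | r h (iter i x u0) == iter i x u0].
have gS : group_set S.
  apply/group_setP; split; first by rewrite inE group1 rep1 eqxx.
  move=> a b; rewrite !inE => /andP[aH /eqP ya] /andP[bH /eqP yb].
  by rewrite groupM // repM yb ya eqxx.
have sKS : K \subset Group gS.
  by apply/subsetP => h hK; rewrite inE (subsetP sKH) // yK // eqxx.
have sSH : Group gS \subset H by apply/subsetP => h; rewrite inE => /andP[].
have oS : #|Group gS| = #|H|.
  have := cardSg sSH; rewrite oH => /(dvdn_pfactor _ _ pr_p)[j le_jm oS].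
  have ltKS : (#|K| < #|Group gS|)%N.
    rewrite proper_card // /proper sKS; apply/subsetPn; exists g => //.
    by rewrite inE gH yg eqxx.
  rewrite oS; congr (p ^ _)%N; apply/eqP; rewrite eqn_leq le_jm.
  by move: ltKS; rewrite oK oS ltn_exp2l ?prime_gt1.
have SH : Group gS :=: H by apply/eqP; rewrite eqEcard sSH oS leqnn.
by apply/rfixP => h; rewrite -SH inE => /andP[_ /eqP].
Qed.

Hypothesis pP : (p.-group [set: P])%g.

(** Projectivity is read off from fixed vectors.  A section [s] of the trace map
    gives [e := gtr s] which is the identity on traces, so that [1 - e] kills all
    fixed vectors of [U].  As every nonzero stable subspace has a fixed vector,
    [1 - e] is nilpotent on [U]; and the relative traces form an ideal among the
    operators that commute with the group, which contains [1 - (1 - e)^n]. *)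
Lemma gtr_identity U :
  rstable [set: P] U ->
  (forall u, u \in U -> u \in rfix [set: P] -> u \in limg (gsum [set: P])) ->
  (forall theta, {in U, forall u, gtr theta u \in U}) ->
  exists theta, {in U, gtr theta =1 id}.
Proof.
move=> PU fixU trU; pose s := (gsum [set: P])^-1%VF; pose e := gtr s.
have e1 v : v \in limg (gsum [set: P]) -> e v = v.
  move=> vT; have fv g : r g v = v.
    by have /memv_imgP[w _ ->] := vT; rewrite rep_gsum ?inE.
  rewrite /e gtrE (eq_bigr (fun g => r g (s v))) => [|g _]; last by rewrite fv.
  rewrite -[RHS](limg_lfunVK vT) gsumE; apply: eq_bigl => g; by rewrite inE.
have nil W : (W <= U)%VS -> rstable [set: P] W -> {in W, forall w, e w \in W} ->
    exists n, {in W, forall w, iter n (\1 - e)%VF w = 0}.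
  have phiE v : (\1 - e)%VF v = v - e v by rewrite add_lfunE opp_lfunE id_lfunE.
  move: {2}_.+1 (ltnSn (\dim W)) => n; elim: n W => // n IH W.
  rewrite ltnS => leWn sWU PW eW; have [W0 | W0] := eqVneq W 0%VS.
    by exists 0 => w; rewrite W0 memv0 => /eqP.
  have [u [uW u0 ufix]] := rfix_pgroup_neq0 pP PW W0.
  have phiu : (\1 - e)%VF u = 0.
    by rewrite phiE e1 ?subrr // fixU // (subvP sWU).
  have phiW : ((\1 - e)%VF @: W <= W)%VS.
    by apply/subvP => _ /memv_imgP[w wW ->]; rewrite phiE memvB ?eW.
  have [||||m Wm] := IH ((\1 - e)%VF @: W)%VS.
  - apply: leq_trans leWn; rewrite -(limg_ker_dim (\1 - e)%VF W) -[X in (X < _)%N]add0n.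
    rewrite ltn_add2r lt0n dimv_eq0; apply: contraNneq u0 => K0.
    by rewrite -memv0 -K0 memv_cap uW memv_ker phiu eqxx.
  - exact: subv_trans sWU.
  - move=> g gP _ /memv_imgP[w wW ->]; apply/memv_imgP; exists (r g w).
      exact: PW.
    by rewrite !phiE linearB /= /e gtr_rep.
  - move=> _ /memv_imgP[w wW ->]; apply/memv_imgP; exists (e w); first exact: eW.
    by rewrite !phiE linearB.
  by exists m.+1 => w wW; rewrite iterSr Wm // memv_img.
have [n Un] := nil U (subvv U) PU (trU s).
have phiC m g v : lpow (\1%VF - e) m (r g v) = r g (lpow (\1%VF - e) m v).
  rewrite !lpowE; elim: m => //= m ->.
  by rewrite !add_lfunE !opp_lfunE !id_lfunE linearB /= /e gtr_rep.
have [theta thE] : exists theta, \1%VF - lpow (\1%VF - e) n = gtr theta.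
  elim: n {Un} => [|n [theta IH]].
    exists 0; rewrite subrr; apply/lfunP => v; rewrite gtrE zero_lfunE big1 // => g _.
    by rewrite zero_lfunE linear0.
  exists (theta + (lpow (\1%VF - e) n \o s)%VF).
  rewrite -[theta]scale1r gtr_linear scale1r -IH -gtr_compl // lpowSr.
  by rewrite comp_lfunDr comp_lfun1r comp_lfunNr opprD opprK addrA.
exists theta => u uU; rewrite -thE add_lfunE opp_lfunE id_lfunE lpowE Un //.
by rewrite subr0.
Qed.

End Representation.

(** * Regular traces of algebras with a p-group action *)

Section Multiplications.
Variables (k : fieldType) (A : falgType k).
Lemma amullE (a x : A) : amull a x = a * x. Proof. by rewrite lfunE. Qed.
Lemma amulrE (a x : A) : amulr a x = x * a. Proof. by rewrite lfunE. Qed.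
End Multiplications.

Section BinomialTrace.
Variables (k : fieldType) (p : nat) (A : falgType k).
Hypothesis pk : p \in [pchar k].
Variable t : 'End(A).
Hypothesis tM : forall a b, t (a * b) = t a * t b.
Hypothesis t1 : t 1 = 1.

(** The binomial coefficient [binom(a, j)], which makes sense for [j < p]. *)
Fixpoint bpoly (a : A) (j : nat) : A :=
  if j is i.+1 then (i.+1%:R : k)^-1 *: (bpoly a i * (a - i%:R)) else 1.

(** By Pascal's rule the difference operator [t - 1] takes [binom(a, j + 1)] to
    [binom(a, j)], so that its power [p - 1], which is the norm, takes
    [binom(a, p - 1)] to [1]. *)
Lemma exists_norm1 (C : {vspace A}) a : t a = a + 1 -> 1 \in C -> a \in C ->
  {in C &, forall x y, x * y \in C} ->
  exists2 y, y \in C & \sum_(i < p) iter i t y = 1.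
Proof.
move=> ta C1 Ca CM; have pr_p := pcharf_prime pk.
have CX j : bpoly a j \in C.
  elim: j => //= j IH; apply/memvZ/CM => //; apply: memvB => //.
  by rewrite -scaler_nat memvZ.
have tn n : t n%:R = n%:R by rewrite !raddfMn /= t1.
have Sn0 j : (j.+1 < p)%N -> (j.+1%:R : k) != 0.
  by move=> jp; rewrite -(dvdn_pcharf pk) gtnNdvd.
have sn (z : A) n : z *+ n = (n%:R : k) *: z by rewrite scaler_nat.
have Zj j (z : A) : (j.+1 < p)%N ->
    (j.+1%:R : k) *: ((j.+1%:R : k)^-1 *: z) = z.
  by move=> jp; rewrite scalerA mulfV ?Sn0 // scale1r.
have step j : (j < p)%N ->
    t (bpoly a j) = bpoly a j + (if j is i.+1 then bpoly a i else 0).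
  elim: j => [_|j IH jp]; first by rewrite /= t1 addr0.
  have j0 := Sn0 _ jp.
  have tZ c x : t (c *: x) = c *: t x by rewrite linearZ.
  have tB x y : t (x - y) = t x - t y by rewrite linearB.
  rewrite /= tZ tM (IH (ltnW jp)) tB ta tn.
  apply: (scalerI j0); rewrite scalerDr !Zj //.
  rewrite mulrDl [a + 1 - _]addrAC mulrDr mulr1 -!addrA; congr (_ + _).
  rewrite -sn mulrS; congr (_ + _).
  case: j {IH} jp j0 => [|i] jp j0; first by rewrite mul0r mulr0n.
  rewrite [RHS]sn [bpoly a i.+1]/= Zj 1?ltnW //; congr (_ * (a + _)).
  by rewrite -natr1 opprD addrNK.
exists (bpoly a p.-1) => //.
have -> : \sum_(i < p) iter i t (bpoly a p.-1) =
    lpow (t - \1%VF) p.-1 (bpoly a p.-1).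
  by rewrite lpow_sub1 // sum_lfunE; apply: eq_bigr => i _; rewrite lpowE.
have : (p.-1 < p)%N by rewrite prednK ?prime_gt0.
elim: p.-1 => [|j IH] jp; first by rewrite lpowE.
rewrite lpowSr comp_lfunE add_lfunE opp_lfunE id_lfunE step // addrAC subrr add0r.
exact/IH/ltnW.
Qed.

End BinomialTrace.

Section StableTrace.
Variables (k : fieldType) (V : vectType k) (U : {vspace V}).

Lemma strC (f g : 'End(V)) : {in U, forall u, f u \in U} ->
  {in U, forall u, g u \in U} -> str U (f \o g)%VF = str U (g \o f)%VF.
Proof.
move=> fU gU; rewrite /str.
have E (h h' : 'End(V)) : {in U, forall u, h' u \in U} ->
    (h \o h' \o projv U = (h \o projv U) \o (h' \o projv U))%VF.
  move=> hU; apply/lfunP => v; rewrite !comp_lfunE [in RHS]projv_id //.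
  by rewrite hU ?memv_proj.
by rewrite !E // ltrC.
Qed.

Lemma strD (f g : 'End(V)) : str U (f + g) = str U f + str U g.
Proof. by rewrite /str comp_lfunDl ltrD. Qed.
Lemma strB (f g : 'End(V)) : str U (f - g) = str U f - str U g.
Proof. by rewrite /str comp_lfunDl comp_lfunNl ltrB. Qed.
Lemma strZ c (f : 'End(V)) : str U (c *: f) = c * str U f.
Proof. by rewrite /str -comp_lfunZl ltrZ. Qed.

End StableTrace.

Section AlgebraAction.
Variables (k : fieldType) (P : finGroupType) (p : nat).
Hypotheses (pk : p \in [pchar k]) (pP : (p.-group [set: P])%g).
Variables (A : falgType k) (r : P -> 'End(A)).
Hypothesis r1 : r 1%g = \1%VF.
Hypothesis rM : forall g h, r (g * h)%g = (r g \o r h)%VF.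
Hypothesis rmul : forall g a b, r g (a * b) = r g a * r g b.

Lemma ralg1 g : r g 1 = 1.
Proof.
by rewrite -[LHS]mulr1 -{2}(repKV r1 rM g 1) -rmul mul1r (repKV r1 rM).
Qed.

(** Application of [q] permutes the summands cyclically. *)
Lemma norm_fixed (V : vectType k) n (q : 'End(V)) w : (0 < n)%N ->
  iter n q w = w -> \sum_(i < n) q (lpow q i w) = \sum_(i < n) lpow q i w.
Proof.
case: n => // n _ qw; under eq_bigr do rewrite lpowE -iterS.
under [RHS]eq_bigr do rewrite lpowE.
by rewrite big_ord_recr [RHS]big_ord_recl addrC qw.
Qed.

(** Induction on [C].  If [P] acts trivially on [C] then every line in [C] is
    stable, so [C] is the line of [1].  Otherwise some [t] acts on [C] with order
    [p] and commutes there with the action of [P].  The stable subspace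
    [C^t ∩ (t - 1) C] is nonzero, so it contains [1] and [t a = a + 1] for some
    [a]; with [y] of norm [1], the projection [s |-> \sum_i t^i (y s)] of [C]
    onto [C^t] compares the regular traces of the two algebras: the trace of [c]
    on [C^t] is the sum of the traces of [L_c t^i L_y] on [C], and those with
    [i <> 0] vanish, since [i] times such a map is its commutator with right
    multiplication by [a]. *)
Lemma regular_trace_neq0 :
  (forall U, rstable r [set: P] U -> 1 \notin U -> U = 0%VS) ->
  forall C : {vspace A}, 1 \in C -> {in C &, forall x y, x * y \in C} ->
  rstable r [set: P] C -> exists2 b, b \in C & str C (amull b) != 0.
Proof.
move=> simpleA C; have pr_p := pcharf_prime pk.
move: {2}_.+1 (ltnSn (\dim C)) => n; elim: n C => // n IH C; rewrite ltnS.
move=> leCn C1 CM PC.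
have [triv | ntriv] := pselect (forall g, {in C, r g =1 id}).
  exists 1 => //; have -> : C = <[1]>%VS.
    apply/eqP; rewrite eqEsubv -memvE C1 andbT; apply/subvP => c cC.
    have [|c1] := boolP (1 \in <[c]>%VS).
      case/vlineP=> z z1; apply/vlineP; exists z^-1.
      have z0 : z != 0.
        by apply: contra_eq_neq z1 => ->; rewrite scale0r oner_neq0.
      by rewrite z1 scalerA mulVf // scale1r.
    have := memv_line c; rewrite (simpleA _ _ c1) ?memv0 => [|g _ _ /vlineP[z ->]].
      by move/eqP->; apply: mem0v.
    by rewrite linearZ /= triv // memvZ ?memv_line.
  rewrite (@str_eq _ _ _ _ \1%VF) => [|x _]; last by rewrite amullE mul1r id_lfunE.
  by rewrite str1 dim_vline oner_neq0 oner_neq0.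
(* the kernel of the action on [C] *)
pose K := [set g : P | (C <= lker (r g - \1%VF))%VS].
have inK g : reflect {in C, r g =1 id} (g \in K).
  rewrite inE; apply: (iffP subvP) => gC c cC; have := gC c cC.
    by rewrite memv_ker add_lfunE opp_lfunE id_lfunE subr_eq0 => /eqP.
  by rewrite memv_ker add_lfunE opp_lfunE id_lfunE subr_eq0 => ->.
have gK : group_set K.
  apply/group_setP; split; first by apply/inK => c _; rewrite (rep1 r1).
  by move=> g h /inK gC /inK hC; apply/inK => c cC; rewrite (repM rM) hC // gC.
have nK : (Group gK <| [group of [set: P]])%g.
  apply/andP; split; first exact: subsetT.
  apply/subsetP => h _; rewrite inE; apply/subsetP => _ /imsetP[g /inK gC ->].
  apply/inK => c cC; rewrite conjgE !(repM rM) gC ?PC ?inE //.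
  by rewrite (repK r1 rM).
have PK : ~~ ([group of [set: P]] \subset Group gK).
  apply/negP => /subsetP PK; apply: ntriv => g.
  by apply/inK; apply: PK; rewrite inE.
have [t [_ tK tp tC]] := central_step pP nK PK.
have tp1 c : c \in C -> iter p (r t) c = c.
  by move=> cC; rewrite -(repX r1 rM); move/inK: tp; apply.
pose x := r t - \1%VF.
have xE c : x c = r t c - c by rewrite add_lfunE opp_lfunE id_lfunE.
have xC c : c \in C -> x c \in C by move=> cC; rewrite xE memvB ?PC ?inE.
have rtC h c : c \in C -> r h (r t c) = r t (r h c).
  move=> cC; have hc : r h c \in C by rewrite PC ?inE.
  have /inK/(_ _ cC) := tC h (in_setT _).
  rewrite commgEl (repM rM) => /(congr1 (r t)); rewrite (repKV r1 rM).
  by rewrite conjgE !(repM rM) => /(congr1 (r h)); rewrite (repKV r1 rM).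
pose C' := (C :&: lker x)%VS.
have inC' c : (c \in C') = (c \in C) && (r t c == c).
  by rewrite memv_cap memv_ker xE subr_eq0.
have C'1 : 1 \in C' by rewrite inC' C1 ralg1 eqxx.
have C'M : {in C' &, forall a b, a * b \in C'}.
  move=> a b; rewrite !inC' => /andP[aC /eqP ta] /andP[bC /eqP tb].
  by rewrite CM // rmul ta tb eqxx.
have PC' : rstable r [set: P] C'.
  move=> h hP c; rewrite !inC' => /andP[cC /eqP tc].
  by rewrite PC // -rtC // tc eqxx.
have ltC' : (\dim C' < n)%N.
  apply: leq_trans leCn; rewrite ltn_neqAle dimvS ?capvSl // andbT.
  apply: contra tK => dC; apply/inK => c; have : (C' == C).
    by rewrite -(dimv_leqif_eq (capvSl _ _)).
  by move/eqP <-; rewrite inC' => /andP[_ /eqP].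
have [c cC' trc] := IH _ ltC' C'1 C'M PC'.
have [a aC ta] : exists2 a, a \in C & r t a = a + 1.
  have U1 : 1 \in (C' :&: (x @: C))%VS.
    apply: contraT => U1; have U0 := simpleA _ _ U1.
    case/negP: tK; apply/inK => v vC; apply/eqP; rewrite -subr_eq0 -xE.
    have xnC i : iter i x v \in C by elim: i => //= i; apply: xC.
    have nil : exists i, iter i x v == 0.
      by exists p; rewrite -lpowE lpow_sub1_nil ?tp1.
    case: (ex_minnP nil) => -[|[|i]] xi min.
    - by move/eqP: xi => /= ->; rewrite linear0.
    - exact: xi.
    suff /min: iter i.+1 x v == 0 by rewrite ltnn.
    rewrite -memv0 -U0 => [|h hP u]; last first.
      case/memv_capP=> uC' /memv_imgP[w wC uE]; apply/memv_capP.
      split; [exact: PC' | apply/memv_imgP; exists (r h w); first exact: PC].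
      by rewrite uE !xE linearB /= rtC.
    apply/memv_capP; split; last by rewrite iterS memv_img.
    by rewrite memv_cap xnC memv_ker; apply: xi.
  have /memv_capP[_ /memv_imgP[a aC a1]] := U1.
  by exists a => //; rewrite a1 xE addrC subrK.
have [y yC ny] := exists_norm1 pk (rmul t) (ralg1 t) ta C1 aC CM.
have tiC i s : s \in C -> lpow (r t) i s \in C.
  by move=> sC; rewrite lpowE; elim: i => //= i IHi; rewrite PC ?inE.
have tiM i s s' : lpow (r t) i (s * s') = lpow (r t) i s * lpow (r t) i s'.
  by rewrite !lpowE; elim: i => //= i ->; rewrite rmul.
have tia i : lpow (r t) i a = a + i%:R.
  rewrite lpowE; elim: i => [|i IHi]; first by rewrite addr0.
  by rewrite iterS IHi linearD /= ta raddfMn /= ralg1 -addrA -natr1 [1 + _]addrC.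
have cC : c \in C by move: cC'; rewrite inC' => /andP[].
pose F i := (amull c \o lpow (r t) i \o amull y)%VF.
have FE i s : F i s = c * lpow (r t) i (y * s).
  by rewrite !comp_lfunE !amullE.
have FC i s : s \in C -> F i s \in C by move=> sC; rewrite FE CM ?tiC ?CM.
have strF : str C' (amull c) = \sum_(i < p) str C (F i).
  pose e := (\sum_(i < p) (lpow (r t) i \o amull y \o projv C)%VF).
  have eE v : e v = \sum_(i < p) lpow (r t) i (y * projv C v).
    by rewrite sum_lfunE; apply: eq_bigr => i _; rewrite !comp_lfunE amullE.
  rewrite (@str_proj _ _ _ _ e) => [|s sC'|v|s].
  - rewrite -ltr_sum; congr ltr; apply/lfunP => v.
    rewrite comp_lfunE amullE eE sum_lfunE mulr_sumr.
    by apply: eq_bigr => i _; rewrite comp_lfunE FE.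
  - by rewrite amullE C'M.
  - have ysC : y * projv C v \in C by rewrite CM ?memv_proj.
    rewrite inC' eE memv_suml => [|i _]; last exact: tiC.
    rewrite linear_sum /=; apply/eqP; move: (tp1 _ ysC); move: (y * _) => w tw.
    exact: norm_fixed (prime_gt0 pr_p) tw.
  - rewrite inC' => /andP[sC /eqP ts].
    rewrite eE projv_id // (eq_bigr (fun i : 'I_p => iter i (r t) y * s)) => [|i _].
      by rewrite -mulr_suml ny mul1r.
    rewrite tiM lpowE; congr (_ * _); rewrite lpowE.
    by elim: (i : nat) => //= j ->.
exists (c * y); first by rewrite CM.
(* only the term with [i = 0] contributes *)
have F0 (i : 'I_p) : (0 < i)%N -> str C (F i) = 0.
  move=> i0; have ik : (i%:R : k) != 0.
    by rewrite -(dvdn_pcharf pk) gtnNdvd.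
  apply: (mulfI ik); rewrite mulr0 -strZ.
  have RC s : s \in C -> amulr a s \in C by move=> sC; rewrite amulrE CM.
  rewrite -[RHS](subrr (str C (F i \o amulr a)%VF)) {2}strC -?strB //; last exact: FC.
  apply: str_eq => s sC; rewrite scale_lfunE add_lfunE opp_lfunE.
  rewrite [(F i \o _)%VF s]comp_lfunE [(_ \o F i)%VF s]comp_lfunE !amulrE !FE.
  rewrite mulrA [lpow _ _ (_ * a)]tiM tia !mulrDr mulrA.
  by rewrite addrAC subrr add0r mulr_natr mulrnAr scaler_nat.
rewrite (@str_eq _ _ _ _ (F (Ordinal (prime_gt0 pr_p)))) => [|s _].
  have <- : str C' (amull c) = str C (F (Ordinal (prime_gt0 pr_p))) => //.
  rewrite strF (bigD1 (Ordinal (prime_gt0 pr_p))) //= big1 ?addr0 // => i ne_i0.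
  by rewrite F0 // lt0n.
by rewrite FE lpowE /= amullE mulrA.
Qed.
End AlgebraAction.

(** * The trace form on points fixed by a normal subgroup *)

Section TraceForm.
Variables (k : fieldType) (P : finGroupType) (p : nat).
Hypotheses (pk : p \in [pchar k]) (pP : (p.-group [set: P])%g).
Variables (A : falgType k) (r : P -> 'End(A)).
Hypothesis r1 : r 1%g = \1%VF.
Hypothesis rM : forall g h, r (g * h)%g = (r g \o r h)%VF.
Hypothesis rmul : forall g a b, r g (a * b) = r g a * r g b.

Let T := [set: P].
(** The algebra to which this applies is the space of linear endomorphisms of a
    module: [fixE] says that its stable endomorphisms are the scalars, and [notT]
    that it is not projective. *)
Hypothesis fixE : forall a, a \in rfix r T -> exists c w, a = c *: 1 + gsum r T w.
Hypothesis notT : 1 \notin limg (gsum r T).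

Section QuotientStep.
Variable Z : {group P}.
Hypothesis nZ : (Z <| [group of T])%g.
Hypothesis notZ : 1 \notin limg (gsum r Z).

Lemma gsum_ideal_l a w : a \in rfix r Z -> gsum r Z (a * w) = a * gsum r Z w.
Proof.
move/rfixP=> aZ; rewrite !gsumE mulr_sumr; apply: eq_bigr => h hZ.
by rewrite rmul aZ.
Qed.

Lemma gsum_ideal_r a w : a \in rfix r Z -> gsum r Z (w * a) = gsum r Z w * a.
Proof.
move/rfixP=> aZ; rewrite !gsumE mulr_suml; apply: eq_bigr => h hZ.
by rewrite rmul aZ.
Qed.

Lemma limg_gsum_fix : (limg (gsum r Z) <= rfix r Z)%VS.
Proof. by apply/subvP => _ /memv_imgP[w _ ->]; apply: gsum_fix. Qed.

Lemma rfix_stable : rstable r T (rfix r Z).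
Proof.
move=> h hT v /rfixP vZ; apply/rfixP => z zZ.
rewrite -(repM rM) -{1}(mulKVg h (z * h)%g) -/(conjg z h) (repM rM) vZ //.
by rewrite memJ_norm // (subsetP (normal_norm nZ)).
Qed.

Lemma limg_gsum_stable : rstable r T (limg (gsum r Z)).
Proof.
move=> h hT _ /memv_imgP[w _ ->]; apply/memv_imgP; exists (r h w); rewrite ?memvf //.
rewrite !gsumE linear_sum /= [RHS](reindex_inj (conjg_inj h^-1%g)) /=.
apply: eq_big => [z|z _].
  by rewrite memJ_norm // groupV (subsetP (normal_norm nZ)).
by rewrite -!(repM rM) conjgE invgK -!mulgA mulVg mulg1.
Qed.

Lemma gsumT_sub w : gsum r T w \in limg (gsum r Z).
Proof.
have [S ->] := gsum_sub rM (normal_sub nZ).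
by rewrite comp_lfunE memv_img ?memvf.
Qed.

(** The subspace [U] satisfies the hypotheses of [gtr_identity]: relative traces
    map [Z]-fixed vectors to [Z]-traces, and a [P]-fixed vector of [U] is a scalar
    plus a [P]-trace, where the scalar is zero because [1] is not in [U].  So
    every vector of [U] is a value of a relative trace. *)
Lemma stable_fixed_trace U : rstable r T U -> (limg (gsum r Z) <= U)%VS ->
  (U <= rfix r Z)%VS -> 1 \notin U -> (U <= limg (gsum r Z))%VS.
Proof.
move=> PU sIU sUZ U1.
have trI theta u : u \in U -> gtr r theta u \in limg (gsum r Z).
  move=> uU; have [w ->] := gtr_fix rM theta (subvP sUZ _ uU).
  by rewrite memv_img ?memvf.
have [|||theta thE] := gtr_identity r1 rM pk pP (U := U).
- exact: PU.
- move=> u uU /fixE[c [w uE]]; have [c0|c0] := eqVneq c 0.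
    by rewrite uE c0 scale0r add0r memv_img ?memvf.
  case/negP: U1; have : c *: 1 \in U.
    by rewrite -(addrK (gsum r T w) (c *: 1)) -uE memvB // (subvP sIU) ?gsumT_sub.
  by move/(memvZ c^-1); rewrite scalerA mulVf // scale1r.
- by move=> theta u uU; apply: (subvP sIU); apply: trI.
by apply/subvP => u uU; rewrite -(thE u uU); apply: trI.
Qed.

Fact fixed_aspace_subproof : is_aspace (rfix r Z).
Proof.
apply/andP; split.
  by apply: has_algid1; apply/rfixP => z _; apply: (ralg1 r1 rM rmul).
apply/prodvP => a b /rfixP aZ /rfixP bZ; apply/rfixP => z zZ.
by rewrite rmul aZ ?bZ.
Qed.
Canonical fixed_aspace := ASpace fixed_aspace_subproof.
Local Notation AZ := (subvs_of fixed_aspace).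

Fact fixed_one : vsval (1 : AZ) = 1.
Proof.
apply/eqP; rewrite -[vsval 1]/(algid fixed_aspace) algid_eq1.
by apply/rfixP => z _; apply: (ralg1 r1 rM rmul).
Qed.

Definition trace_space : {vspace AZ} :=
  (linfun (vsval : AZ -> A) @^-1: limg (gsum r Z))%VS.

Fact in_trace_space (a : AZ) : (a \in trace_space) = (vsval a \in limg (gsum r Z)).
Proof. by rewrite -memv_preim lfunE. Qed.

Definition trace_ideal : ideal AZ.
Proof.
refine (@Ideal k AZ trace_space _ _ _) => [a x|a x|].
- rewrite !in_trace_space => /memv_imgP[w _ xE] /=.
  by rewrite xE -gsum_ideal_l ?subvsP // memv_img ?memvf.
- rewrite !in_trace_space => /memv_imgP[w _ xE] /=.
  by rewrite xE -gsum_ideal_r ?subvsP // memv_img ?memvf.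
- by rewrite in_trace_space fixed_one.
Defined.
Local Notation B := (quot_alg trace_ideal).
Local Notation pi := (quot_proj trace_ideal).

Definition fixed_act (g : P) (a : AZ) : AZ := vsproj fixed_aspace (r g (vsval a)).

Lemma fixed_actE g a : vsval (fixed_act g a) = r g (vsval a).
Proof. by rewrite vsprojK // rfix_stable ?inE // subvsP. Qed.

Fact quot_act_linear g :
  linear (fun x : B => pi (fixed_act g (quot_repr trace_ideal x))).
Proof.
move=> c x y; rewrite -linearP; congr pi; apply: subvs_inj.
by rewrite fixed_actE linearP /= linearP /= !fixed_actE.
Qed.
Definition quot_act g : 'End(B) := lmap (quot_act_linear g).

Lemma quot_actE g a : quot_act g (pi a) = pi (fixed_act g a).
Proof.
rewrite lmapE; apply: quot_pi_congr; rewrite in_trace_space /= !fixed_actE.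
rewrite -linearB /= limg_gsum_stable ?inE // -opprB memvN.
by rewrite -[_ - _]/(vsval (a - quot_repr trace_ideal (pi a))) -in_trace_space quot_piK.
Qed.

(** The trace is additive along [0 -> I -> A^Z -> A^Z / I -> 0], where [I] is the
    ideal of [Z]-traces. *)
Lemma trace_quot (b : AZ) :
  str (rfix r Z) (amull (vsval b)) =
  str (limg (gsum r Z)) (amull (vsval b)) + str fullv (amull (pi b)).
Proof.
pose i : 'Hom(AZ, A) := linfun vsval; pose q : 'Hom(AZ, B) := linfun pi.
have iE (U : {vspace AZ}) : {in U, forall u, b * u \in U} ->
    str (i @: U) (amull (vsval b)) = str U (amull b).
  move=> bU; rewrite [RHS](@str_add _ _ _ i U _ (amull (vsval b))).
  - rewrite [X in _ = X + _]str0 ?add0r //; apply/eqP; rewrite -subv0; apply/subvP => u.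
    rewrite memv_cap memv_ker lfunE /= => /andP[_ /eqP u0].
    by rewrite memv0; apply/eqP/subvs_inj.
  - by move=> u uU; rewrite amullE bU.
  - by move=> u uU; rewrite !amullE !lfunE.
have -> : rfix r Z = (i @: fullv)%VS.
  apply/vspaceP => a; apply/idP/memv_imgP => [aZ|[u _ ->]].
    by exists (vsproj fixed_aspace a); rewrite ?memvf // lfunE /= vsprojK.
  by rewrite lfunE /= subvsP.
have -> : limg (gsum r Z) = (i @: trace_space)%VS.
  apply/vspaceP => a; apply/idP/memv_imgP => [aI|[u]].
    exists (vsproj fixed_aspace a); last by rewrite lfunE /= vsprojK ?(subvP limg_gsum_fix).
    by rewrite in_trace_space vsprojK ?(subvP limg_gsum_fix).
  by rewrite in_trace_space => uI ->; rewrite lfunE.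
rewrite !iE => [|u uI|u _]; last exact: memvf.
  rewrite (@str_add _ _ _ q fullv _ (amull (pi b))).
  - have -> : (fullv :&: lker q)%VS = trace_space.
      apply/vspaceP => u; rewrite capfv memv_ker lfunE /=.
      exact: (quot_pi_eq0 trace_ideal u).
    have -> : (q @: fullv)%VS = fullv; last by [].
    apply/vspaceP => x; rewrite memvf; apply/memv_imgP.
    exists (quot_repr trace_ideal x); rewrite ?memvf // lfunE; exact/esym/quot_reprK.
  - by move=> u _; rewrite memvf.
  - by move=> u _; rewrite !amullE !lfunE /= rmorphM.
exact: (ideal_mull (i := trace_ideal)).
Qed.

(** [stable_fixed_trace] is the hypothesis of [regular_trace_neq0] for the algebra
    of [Z]-fixed points modulo [Z]-traces. *)
Lemma fixed_trace_neq0 : exists2 b, b \in rfix r Z &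
  str (rfix r Z) (amull b) != str (limg (gsum r Z)) (amull b).
Proof.
have qa1 : quot_act 1%g = \1%VF.
  apply/lfunP => x; rewrite -(quot_reprK x) quot_actE id_lfunE; congr pi.
  by apply: subvs_inj; rewrite /= fixed_actE (rep1 r1).
have qaM g h : quot_act (g * h)%g = (quot_act g \o quot_act h)%VF.
  apply/lfunP => x; rewrite -(quot_reprK x) comp_lfunE !quot_actE; congr pi.
  by apply: subvs_inj; rewrite /= !fixed_actE (repM rM).
have qamul g x y : quot_act g (x * y) = quot_act g x * quot_act g y.
  rewrite -(quot_reprK x) -(quot_reprK y) -[LHS]/(quot_act g (pi _ * pi _)).
  rewrite -rmorphM !quot_actE -rmorphM; congr pi.
  by apply: subvs_inj; rewrite /= !fixed_actE /= rmul.
have [||||b _ trb] := regular_trace_neq0 pk pP qa1 qaM qamul _ (C := fullv).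
- move=> U PU U1; pose q : 'Hom(AZ, B) := linfun pi.
  pose i : 'Hom(AZ, A) := linfun vsval.
  have inU u : (u \in (q @^-1: U)%VS) = (pi u \in U) by rewrite -memv_preim lfunE.
  have : (i @: (q @^-1: U) <= limg (gsum r Z))%VS.
    apply: stable_fixed_trace.
    - move=> h hT a /memv_imgP[u]; rewrite inU => uU ->.
      apply/memv_imgP; exists (fixed_act h u); last by rewrite !lfunE /= fixed_actE.
      by rewrite inU -quot_actE PU.
    - apply/subvP => a aI; apply/memv_imgP; exists (vsproj fixed_aspace a).
        rewrite inU (_ : pi _ = 0) ?mem0v //; apply/eqP.
        by rewrite quot_pi_eq0 in_trace_space vsprojK // (subvP limg_gsum_fix).
      by rewrite lfunE /= vsprojK // (subvP limg_gsum_fix).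
    - by apply/subvP => _ /memv_imgP[u _ ->]; rewrite lfunE /= subvsP.
    - apply: contra U1 => /memv_imgP[u]; rewrite inU lfunE /= => uU uE.
      have <- : pi u = 1; last by [].
      by rewrite -(rmorph1 (quot_proj trace_ideal)); congr pi; apply: subvs_inj; rewrite fixed_one -uE.
  move=> sUI; apply/eqP; rewrite -subv0; apply/subvP => x xU; rewrite memv0.
  have : vsval (quot_repr trace_ideal x) \in limg (gsum r Z).
    apply: (subvP sUI); apply/memv_imgP; exists (quot_repr trace_ideal x).
      by rewrite inU [pi _]quot_reprK.
    by rewrite [i _]lfunE.
  by rewrite -in_trace_space -(quot_pi_eq0 trace_ideal) quot_reprK.
- exact: memvf.
- by move=> x y _ _; apply: memvf.
- by move=> h _ x _; apply: memvf.
exists (vsval (quot_repr trace_ideal b)); first exact: subvsP.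
rewrite trace_quot -[X in _ != X]addr0 (inj_eq (addrI _)).
by have -> : pi (quot_repr trace_ideal b) = b := quot_reprK b.
Qed.

End QuotientStep.

(** Take [Q] normal and maximal such that [1] is a [Q]-trace, and [Z / Q] of order
    [p] and central in [P / Q], with generator [g].  With [x = g - 1] and [S] the
    [Q]-fixed points, the [Z]-traces are [x^(p - 1) S].  The element [1] is not in
    [x S], as otherwise [exists_norm1] would make it a [Z]-trace; by
    [stable_fixed_trace], the kernel of [x] on [x^i S] is then the ideal of
    [Z]-traces for all [i] strictly between [0] and [p].  Hence the trace of
    multiplication by [b] on [S] is its trace on the [Z]-fixed points plus
    [p - 1 = -1] times its trace on that ideal, and [fixed_trace_neq0] provides a
    [b] for which this is nonzero.  As [s |-> \sum_(h in Q) h (c s)] is a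
    projection onto [S], it can be computed on the whole algebra. *)
Lemma projection_trace_neq0 : exists (Q : {group P}) (c b : A),
  gsum r Q c = 1 /\ \sum_(h in Q) ltr (amull b \o r h \o amull c)%VF != 0.
Proof.
have pr_p := pcharf_prime pk.
pose ok (Q : {group P}) := (Q <| [group of T])%g && (1 \in limg (gsum r Q)).
have ok1 : ok 1%G.
  rewrite /ok normal1; apply/memv_imgP; exists 1; rewrite ?memvf // gsumE.
  by rewrite (big_pred1 1%g) ?(rep1 r1) // => x; rewrite inE.
have [Q /maxgroupP[okQ maxQ] _] := @maxgroup_exists _ ok 1%G ok1.
have /andP[nQ /memv_imgP[c _ cE]] := okQ.
have TQ : ~~ ([group of T] \subset Q).
  apply: contra notT => TQ; apply/memv_imgP; exists c; rewrite ?memvf // cE.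
  suff -> : T = Q by [].
  by apply/eqP; rewrite eqEsubset TQ subsetT.
have [g [gT gQ gp gC]] := central_step pP nQ TQ.
have [Z [nZ ltQZ gZ inZ sumZ]] := cyclic_step pr_p nQ gT gQ gp gC.
have notZ : 1 \notin limg (gsum r Z).
  apply/negP => Z1; have := maxQ Z; rewrite /ok nZ Z1 => /(_ isT (proper_sub ltQZ)).
  by move=> ZQ; rewrite ZQ properxx in ltQZ.
pose S := rfix r Q; pose x := r g - \1%VF.
have xE v : x v = r g v - v by rewrite add_lfunE opp_lfunE id_lfunE.
have SE : S = limg (gsum r Q).
  apply/vspaceP => s; apply/idP/idP; last exact/subvP/limg_gsum_fix.
  move=> sS; apply/memv_imgP; exists (s * c); rewrite ?memvf //.
  by rewrite gsum_ideal_l // -cE mulr1.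
have S1 : 1 \in S by rewrite SE cE memv_img ?memvf.
have SM : {in S &, forall a b, a * b \in S}.
  by move=> a b /rfixP aS /rfixP bS; apply/rfixP => h hQ; rewrite rmul aS ?bS.
have PS : rstable r T S := rfix_stable nQ.
have xS s : s \in S -> x s \in S by move=> sS; rewrite xE memvB ?PS ?inE.
have xnS i s : s \in S -> lpow x i s \in S.
  by move=> sS; rewrite lpowE; elim: i => //= i; apply: xS.
have fixZ v : (v \in rfix r Z) = (v \in (S :&: lker x)%VS).
  rewrite memv_cap memv_ker xE subr_eq0; apply/rfixP/andP => [vZ|[/rfixP vQ /eqP vg]].
    split; last by rewrite vZ.
    by apply/rfixP => q qQ; apply: vZ; apply: (subsetP (proper_sub ltQZ)).
  move=> z /inZ[i [q [qQ ->]]]; rewrite (repM rM) vQ // (repX r1 rM).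
  by elim: i => //= i ->.
have gsumZ w : gsum r Z w = lpow x p.-1 (gsum r Q w).
  rewrite lpow_sub1 // gsumE sumZ sum_lfunE; apply: eq_bigr => i _.
  rewrite gsumE linear_sum; apply: eq_bigr => q _ /=.
  by rewrite lpowE (repM rM) (repX r1 rM).
have IE : limg (gsum r Z) = (lpow x p.-1 @: S)%VS.
  rewrite SE -limg_comp; congr (lfun_img _ _).
  by apply/lfunP => w; rewrite comp_lfunE gsumZ.
have kerx_img : (rfix r Z :&: (x @: S) <= limg (gsum r Z))%VS.
  apply: stable_fixed_trace => //.
  - move=> h hT u /memv_capP[uZ /memv_imgP[s sS uE]]; apply/memv_capP.
    split; first exact: (rfix_stable nZ).
    apply/memv_imgP; exists (r h s); first exact: PS.
    rewrite uE !xE linearB /=; congr (_ - _).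
    have hs : r h s \in S by apply: PS.
    rewrite -(elimT (rfixP _ _ _) hs [~ g, h^-1]%g) ?gC ?inE // -!(repM rM).
    by rewrite commgEl mulKVg conjgE invgK -!mulgA mulVg mulg1.
  - apply/subvP => u uI; apply/memv_capP; split.
      exact: (subvP (limg_gsum_fix _)).
    move: uI; rewrite IE => /memv_imgP[s sS ->].
    have p1 : p.-1 = p.-2.+1 by case: (p) (prime_gt1 pr_p) => [|[|]].
    by rewrite p1 lpowS comp_lfunE memv_img ?xnS.
  - exact: capvSl.
  - apply: contra notZ => /memv_capP[_ /memv_imgP[a aS a1]].
    have ta : r g a = a + 1 by rewrite a1 xE addrC subrK.
    have [y yS ny] := exists_norm1 pk (rmul g) (ralg1 r1 rM rmul g) ta S1 aS SM.
    move: yS; rewrite SE => /memv_imgP[w _ yE].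
    apply/memv_imgP; exists w; rewrite ?memvf // gsumZ -yE -ny lpow_sub1 //.
    by rewrite sum_lfunE; apply: eq_bigr => i _; rewrite lpowE.
have [b bZ trb] := fixed_trace_neq0 nZ notZ.
have bS : b \in S by move: bZ; rewrite fixZ memv_cap => /andP[].
have bg : r g b = b by apply: (elimT (rfixP _ _ _) bZ).
have xb s : x (b * s) = b * x s by rewrite !xE rmul bg mulrBr.
pose D i := (lpow x i @: S)%VS.
have DS i : (D i <= S)%VS by apply/subvP => _ /memv_imgP[s sS ->]; apply: xnS.
have Db i s : s \in D i -> amull b s \in D i.
  case/memv_imgP=> u uS ->; apply/memv_imgP; exists (b * u); first exact: SM.
  by rewrite amullE !lpowE; elim: i => //= i <-; rewrite xb.
have strD i : str (D i) (amull b) =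
    str (D i :&: lker x) (amull b) + str (D i.+1) (amull b).
  rewrite (@str_add _ _ _ x (D i) _ (amull b)); first 1 last.
  - exact: Db.
  - by move=> u _; rewrite !amullE xb.
  by congr (_ + str _ _); rewrite /D lpowS limg_comp.
have Dker i : (0 < i < p)%N -> (D i :&: lker x)%VS = limg (gsum r Z).
  case: i => // i /= ip; apply/eqP; rewrite eqEsubv; apply/andP; split.
    apply/subvP => u /memv_capP[uD ux]; apply: (subvP kerx_img); apply/memv_capP.
    split; first by rewrite fixZ memv_cap ux (subvP (DS _) _ uD).
    by move: uD => /memv_imgP[s sS ->]; rewrite lpowS comp_lfunE memv_img ?xnS.
  apply/subvP => u uI; have := subvP (limg_gsum_fix _) _ uI.
  rewrite fixZ => /memv_capP[uS ux]; apply/memv_capP; split=> //.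
  move: uI; rewrite IE => /memv_imgP[s sS ->]; apply/memv_imgP.
  exists (lpow x (p.-1 - i.+1) s); first exact: xnS.
  rewrite -comp_lfunE -lpowD subnKC // -ltnS prednK ?prime_gt0 //.
have strp : str (D p) (amull b) = 0.
  apply: str0; apply/eqP; rewrite -subv0; apply/subvP => _ /memv_imgP[s sS ->].
  rewrite lpow_sub1_nil ?mem0v // -(repX r1 rM).
  by have /rfixP := sS; apply.
have strDp j : (j < p)%N -> str (D (p - j)%N) (amull b) =
    j%:R * str (limg (gsum r Z)) (amull b).
  elim: j => [|j IH] jp; first by rewrite subn0 strp mul0r.
  rewrite strD Dker; last by rewrite subn_gt0 jp ltn_subrL /= prime_gt0.
  by rewrite subnSK 1?ltnW // IH 1?ltnW // -natr1 mulrDl mul1r addrC.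
have D0 : D 0%N = S by rewrite /D [lpow x 0]/(\1%VF) lim1g.
exists Q; exists c; exists b; split; first by rewrite -cE.
suff -> : \sum_(h in Q) ltr (amull b \o r h \o amull c)%VF = str S (amull b).
  have p1 : (p - p.-1 = 1)%N by rewrite -subn1 subKn ?prime_gt0.
  have := strDp p.-1; rewrite p1 prednK ?prime_gt0 // leqnn => /(_ isT) D1.
  rewrite -D0 strD D0 D1.
  have -> : (S :&: lker x)%VS = rfix r Z by apply/vspaceP => v; rewrite fixZ.
  have -> : (p.-1%:R : k) = -1.
    apply/eqP; rewrite -addr_eq0 natr1 prednK ?prime_gt0 //.
    by rewrite -(dvdn_pcharf pk).
  by rewrite mulN1r subr_eq0.
rewrite (@str_proj _ _ _ _ (gsum r Q \o amull c)%VF) => [|s|s|s].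
- rewrite -ltr_sum; congr ltr; apply/lfunP => v.
  rewrite sum_lfunE comp_lfunE comp_lfunE gsumE linear_sum; apply: eq_bigr => h _.
  by rewrite !comp_lfunE.
- by move=> sS; rewrite amullE SM.
- by rewrite comp_lfunE; apply: gsum_fix.
- by move=> sS; rewrite comp_lfunE amullE gsum_ideal_r // -cE mul1r.
Qed.

End TraceForm.

(** * Higman's criterion *)

Section Sandwich.
Variable k : fieldType.
Implicit Types V W X Y : vectType k.

Fact sandwich_linear V W X Y (a : 'Hom(W, Y)) (b : 'Hom(X, V)) :
  linear (fun f : 'Hom(V, W) => (a \o f \o b)%VF).
Proof.
move=> c f g; apply/lfunP => v.
by rewrite add_lfunE scale_lfunE !comp_lfunE add_lfunE scale_lfunE linearP.
Qed.
Definition sandwich V W X Y (a : 'Hom(W, Y)) (b : 'Hom(X, V)) :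
  'Hom('Hom(V, W), 'Hom(X, Y)) := lmap (sandwich_linear a b).

Lemma sandwichE V W X Y (a : 'Hom(W, Y)) (b : 'Hom(X, V)) f :
  sandwich a b f = (a \o f \o b)%VF.
Proof. exact: lmapE. Qed.

Lemma ltr_sandwich V (a b : 'End(V)) : ltr (sandwich a b) = ltr a * ltr b.
Proof.
have r1 (u w : V) (phi psi : 'Hom(V, k^o)) :
    ltr (sandwich (rank1 u phi) (rank1 w psi)) = (phi u : k) * (psi w : k).
  have Ll : linear (fun f : 'End(V) => phi (f w)).
    by move=> c f g; rewrite add_lfunE scale_lfunE linearP.
  have -> : sandwich (rank1 u phi) (rank1 w psi) = rank1 (rank1 u psi) (lmap Ll).
    apply/lfunP => f; rewrite sandwichE rank1E lmapE; apply/lfunP => v.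
    rewrite !comp_lfunE scale_lfunE !rank1E !linearZ /= scalerA.
    by congr (_ *: _); apply: mulrC.
  by rewrite ltr_rank1 lmapE rank1E linearZ; apply: mulrC.
rewrite {2}(rank1_sum a) {2}(rank1_sum b) !ltr_sum mulr_suml.
have -> : sandwich a b = \sum_i \sum_j sandwich
    (rank1 (a (basisv i)) (dual_basis i)) (rank1 (b (basisv j)) (dual_basis j)).
  apply/lfunP => f; rewrite sandwichE sum_lfunE; apply/lfunP => v.
  rewrite {1}(rank1_sum a) {1}(rank1_sum b) sum_lfunE !comp_lfunE sum_lfunE.
  apply: eq_bigr => i _; rewrite !sum_lfunE !linear_sum.
  by apply: eq_bigr => j _ /=; rewrite sandwichE !comp_lfunE.
rewrite ltr_sum; apply: eq_bigr => i _; rewrite ltr_sum mulr_sumr.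
by apply: eq_bigr => j _; rewrite r1 !ltr_rank1.
Qed.

End Sandwich.

(** Algebras are nonzero, so the type carries a proof that the space is. *)
Definition endalg (k : fieldType) (V : vectType k) (V0 : (0 < dim V)%N) : Type :=
  'End(V).

Section EndAlgebra.
Variables (k : fieldType) (V : vectType k) (V0 : (0 < dim V)%N).
Local Notation A := (endalg V0).
HB.instance Definition _ := Vector.copy A 'End(V).
HB.instance Definition _ := GRing.Zmodule_isNzRing.Build A
  (@comp_lfunA _ _ _ _ _) (@comp_lfun1l _ _ _) (@comp_lfun1r _ _ _)
  (@comp_lfunDl _ _ _ _) (@comp_lfunDr _ _ _ _) (lfun1_neq0 V0).
Fact endalg_scaleAl c (f g : A) : c *: (f * g) = (c *: f) * g.
Proof. exact: comp_lfunZl. Qed.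
HB.instance Definition _ := GRing.Lmodule_isLalgebra.Build k A endalg_scaleAl.
Fact endalg_scaleAr c (f g : A) : c *: (f * g) = f * (c *: g).
Proof. exact: comp_lfunZr. Qed.
HB.instance Definition _ := GRing.Lalgebra_isAlgebra.Build k A endalg_scaleAr.
HB.instance Definition _ := Algebra_isFalgebra.Build k A.
End EndAlgebra.

Section GroupModules.
Variables (k : fieldType) (P : finGroupType).
Local Notation kP := (group_alg k P).
Implicit Types U V W X : fdmod kP.

Definition rho V (g : P) : 'End(V) := mact V (galg_elt k g).

Lemma rho1 V : rho V 1%g = \1%VF. Proof. exact: mact_elt1. Qed.
Lemma rhoM V g h : rho V (g * h)%g = (rho V g \o rho V h)%VF.
Proof. exact: mact_eltM. Qed.

Lemma rhoK V g v : rho V g^-1%g (rho V g v) = v.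
Proof. exact: (repK (rho1 V) (@rhoM V)). Qed.
Lemma rhoKV V g v : rho V g (rho V g^-1%g v) = v.
Proof. exact: (repKV (rho1 V) (@rhoM V)). Qed.

Lemma galg_sum (x : kP) : x = \sum_(g : P) galg_coef x g *: galg_elt k g.
Proof.
apply: galg_eq => g.
have coefS (I : finType) (F : I -> kP) : galg_coef (\sum_i F i) g = \sum_i galg_coef (F i) g.
  by elim/big_rec2: _ => [|i a b _ <-]; rewrite ?galg_coef0 // galg_coefD.
rewrite coefS (bigD1 g) //= big1 => [|h hg].
  by rewrite galg_coefZ galg_ofE eqxx mulr1 addr0.
by rewrite galg_coefZ galg_ofE eq_sym (negbTE hg) mulr0.
Qed.

Lemma mact_rho V (x : kP) : mact V x = \sum_(g : P) galg_coef x g *: rho V g.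
Proof. by rewrite {1}(galg_sum x) linear_sum; apply: eq_bigr => g _; rewrite linearZ. Qed.

Lemma rho_rep_mod (X : vectType k) (r : P -> 'End(X)) r1 rM g :
  rho (@rep_mod k P X r r1 rM) g = r g.
Proof. exact: rep_act_elt. Qed.

Lemma mod_linear_rho U V (f : 'Hom(U, V)) :
  (forall g x, f (rho U g x) = rho V g (f x)) -> f \in mod_linear U V.
Proof.
move=> fC; apply/asboolP => a x; rewrite !mact_rho !sum_lfunE linear_sum /=.
by apply: eq_bigr => g _; rewrite !scale_lfunE linearZ /= fC.
Qed.
Definition mkhom U V (f : 'Hom(U, V)) fC : modhom U V :=
  ModHom (@mod_linear_rho U V f fC).

Lemma modhom_rho U V (f : modhom U V) g x : f (rho U g x) = rho V g (f x).
Proof. exact: modhomP. Qed.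

Definition hom_rep U V (g : P) : 'End('Hom(U, V)) :=
  sandwich (rho V g) (rho U g^-1%g).
Lemma hom_repE U V g (f : 'Hom(U, V)) :
  hom_rep U V g f = (rho V g \o f \o rho U g^-1%g)%VF.
Proof. exact: sandwichE. Qed.
Fact hom_rep1 U V : hom_rep U V 1%g = \1%VF.
Proof.
apply/lfunP => f; rewrite sandwichE invg1 !rho1 comp_lfun1l comp_lfun1r.
by rewrite id_lfunE.
Qed.
Fact hom_repM U V g h : hom_rep U V (g * h)%g = (hom_rep U V g \o hom_rep U V h)%VF.
Proof.
by apply/lfunP => f; rewrite comp_lfunE !sandwichE invMg !rhoM !comp_lfunA.
Qed.
Definition hom_mod U V : fdmod kP := rep_mod (@hom_rep1 U V) (@hom_repM U V).

Lemma rho_hom U V g (f : 'Hom(U, V)) :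
  rho (hom_mod U V) g f = (rho V g \o f \o rho U g^-1%g)%VF.
Proof. by rewrite rho_rep_mod sandwichE. Qed.

(** The relative trace for maps between two modules; [gsum_hom] relates it to the
    fixed vectors of [Hom(U, V)]. *)
Definition htr U V (theta : 'Hom(U, V)) : 'Hom(U, V) :=
  \sum_(g : P) (rho V g \o theta \o rho U g^-1%g)%VF.

Lemma htrE U V (theta : 'Hom(U, V)) x :
  htr theta x = \sum_(g : P) rho V g (theta (rho U g^-1%g x)).
Proof. by rewrite sum_lfunE; apply: eq_bigr => g _; rewrite !comp_lfunE. Qed.

Lemma htr_linear U V : linear (@htr U V).
Proof.
move=> c f f'; apply/lfunP => x.
rewrite add_lfunE scale_lfunE !htrE scaler_sumr -big_split.
by apply: eq_bigr => g _; rewrite /= add_lfunE scale_lfunE linearP.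
Qed.
HB.instance Definition _ U V := GRing.isSemilinear.Build k _ _ _ (@htr U V)
  (GRing.semilinear_linear (@htr_linear U V)).

Lemma gsum_hom U V (theta : 'Hom(U, V)) :
  gsum (hom_rep U V) [set: P] theta = htr theta.
Proof.
rewrite gsumE /htr; apply: eq_big => [g|g _]; first by rewrite inE.
by rewrite sandwichE.
Qed.

Lemma htr_compl U V W (f : 'Hom(V, W)) (theta : 'Hom(U, V)) :
  (forall g x, f (rho V g x) = rho W g (f x)) ->
  (f \o htr theta = htr (f \o theta))%VF.
Proof.
move=> fC; apply/lfunP => x; rewrite comp_lfunE !htrE linear_sum.
by apply: eq_bigr => g _; rewrite /= fC comp_lfunE.
Qed.

Lemma htr_compr U V W (f : 'Hom(U, V)) (theta : 'Hom(V, W)) :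
  (forall g x, f (rho U g x) = rho V g (f x)) ->
  (htr theta \o f = htr (theta \o f))%VF.
Proof.
move=> fC; apply/lfunP => x; rewrite comp_lfunE !htrE.
by apply: eq_bigr => g _; rewrite -fC comp_lfunE.
Qed.

Lemma htr_rho U V (theta : 'Hom(U, V)) g x :
  htr theta (rho U g x) = rho V g (htr theta x).
Proof.
rewrite !htrE linear_sum /= (reindex_inj (mulgI g)); apply: eq_bigr => h _ /=.
by rewrite invMg !rhoM !comp_lfunE rhoK.
Qed.

(** The conjugates of a linear lifting add up to an equivariant one. *)
Lemma projective_htr (Q : fdmod kP) (theta : 'Hom(Q, Q)) : htr theta = \1%VF -> projective_mod Q.
Proof.
move=> th1 V W g f gsurj.
have gs w : g ((g : 'Hom(V, W))^-1%VF w) = w.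
  by rewrite limg_lfunVK // gsurj memvf.
exists (mkhom (htr_rho ((g : 'Hom(V, W))^-1 \o f \o theta)%VF)).
apply/val_inj; rewrite /= htr_compl; last exact: modhom_rho.
have -> : (g \o (g^-1 \o f \o theta) = f \o theta)%VF.
  by apply/lfunP => x; rewrite !comp_lfunE gs.
by rewrite -htr_compl ?th1 ?comp_lfun1r //; apply: modhom_rho.
Qed.

(** Functions from the group to [V] under translation; the map to [V] applies each
    group element to the value there and sums up, and every relative trace to [V]
    factors through it. *)
Section Coinduced.
Variable V : fdmod kP.

Fact coind_linear (g : P) :
  linear (fun phi : {ffun P -> V} => [ffun h => phi (g^-1 * h)%g] : {ffun P -> V}).
Proof. by move=> c f f'; apply/ffunP => h; rewrite !ffunE. Qed.
Definition coind_rep (g : P) : 'End({ffun P -> V}) := lmap (coind_linear g).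
Fact coind_rep1 : coind_rep 1%g = \1%VF.
Proof.
apply/lfunP => f; rewrite lmapE id_lfunE; apply/ffunP => h.
by rewrite ffunE invg1 mul1g.
Qed.
Fact coind_repM g h : coind_rep (g * h)%g = (coind_rep g \o coind_rep h)%VF.
Proof.
apply/lfunP => f; rewrite comp_lfunE !lmapE; apply/ffunP => x.
by rewrite !ffunE invMg mulgA.
Qed.
Definition coind : fdmod kP := rep_mod coind_rep1 coind_repM.

Lemma coindE g (phi : coind) h :
  (rho coind g phi : {ffun P -> V}) h = (phi : {ffun P -> V}) (g^-1 * h)%g.
Proof. by rewrite rho_rep_mod lmapE ffunE. Qed.

(** The conjugates of evaluation at the unit are the evaluations at all group
    elements, so they add up to the identity. *)
Fact coind_eval_linear :
  linear (fun phi : coind => [ffun h => if h == 1%g then (phi : {ffun P -> V}) h else 0] : coind).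
Proof.
move=> c f f'; apply/ffunP => h; rewrite !ffunE; case: ifP => // _.
by rewrite scaler0 addr0.
Qed.

Lemma ffun_sumE (I : finType) (F : I -> {ffun P -> V}) h :
  (\sum_i F i) h = \sum_i F i h.
Proof. by elim/big_rec2: _ => [|i a b _ <-]; rewrite ffunE. Qed.

Lemma htr_coind_eval : htr (lmap coind_eval_linear) = \1%VF.
Proof.
apply/lfunP => phi; rewrite htrE id_lfunE; apply/ffunP => h.
rewrite ffun_sumE (bigD1 h) //= big1.
  by rewrite addr0 coindE lmapE ffunE mulVg eqxx coindE invgK mulg1.
move=> g gh; rewrite coindE lmapE ffunE; case: eqP => // /(canRL (mulKVg _)) hg.
by rewrite hg mulg1 eqxx in gh.
Qed.

Lemma coind_projective : projective_mod coind.
Proof. exact: projective_htr htr_coind_eval. Qed.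

Fact coind_out_linear : linear (fun phi : coind => \sum_h rho V h ((phi : {ffun P -> V}) h)).
Proof.
move=> c f f'; rewrite scaler_sumr -big_split; apply: eq_bigr => h _.
by rewrite /= !ffunE linearP.
Qed.
Fact coind_out_rho g (phi : coind) :
  lmap coind_out_linear (rho coind g phi) = rho V g (lmap coind_out_linear phi).
Proof.
rewrite !lmapE linear_sum /= (reindex_inj (mulgI g)); apply: eq_bigr => h _ /=.
by rewrite coindE mulKg rhoM comp_lfunE.
Qed.
Definition coind_out : modhom coind V := mkhom coind_out_rho.

End Coinduced.

Section CoinducedIn.
Variables (U V : fdmod kP) (theta : 'Hom(U, V)).

Fact coind_in_linear :
  linear (fun x : U => [ffun h : P => theta (rho U h^-1%g x)] : coind V).
Proof. by move=> c x y; apply/ffunP => h; rewrite !ffunE !linearP. Qed.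
Fact coind_in_rho g x : lmap coind_in_linear (rho U g x) =
  rho (coind V) g (lmap coind_in_linear x).
Proof.
rewrite !lmapE; apply/ffunP => h; rewrite coindE !ffunE invMg invgK rhoM.
by rewrite comp_lfunE.
Qed.
Definition coind_in : modhom U (coind V) := mkhom coind_in_rho.

Lemma coind_outin x : coind_out V (coind_in x) = htr theta x.
Proof.
rewrite htrE /= !lmapE; apply: eq_bigr => h _.
by rewrite ffunE.
Qed.

End CoinducedIn.

(** Higman's criterion.  The map from a coinduced module onto a projective module
    splits, and the identity of a coinduced module is a relative trace. *)
Lemma factors_projectiveP U V (f : modhom U V) :
  factors_projective f <-> exists theta, hval f = htr theta.
Proof.
split=> [[Q [u [v [pQ ->]]]] | [theta fE]]; last first.
  exists (coind V), (coind_in theta), (coind_out V); split.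
    exact: coind_projective.
  by apply: modhomE => x; rewrite fE /= comp_lfunE coind_outin.
have surj : limg (coind_out Q) = fullv.
  apply/vspaceP => x; rewrite memvf; apply/memv_imgP.
  exists [ffun h => if h == 1%g then x else 0]; rewrite ?memvf //= lmapE.
  rewrite (bigD1 1%g) //= big1 ?ffunE ?eqxx ?rho1 ?id_lfunE ?addr0 // => h h1.
  by rewrite ffunE (negbTE h1) linear0.
have [s sE] := pQ _ _ (coind_out Q) (modhom_id Q) surj.
have idE : (hval (coind_out Q) \o htr (lmap (@coind_eval_linear Q)) \o s = \1)%VF.
  rewrite htr_coind_eval comp_lfun1r.
  by have /(congr1 (@hval _ _ _ _)) := sE.
have -> : hval (modhom_comp v u) =
    (v \o (coind_out Q \o htr (lmap (@coind_eval_linear Q)) \o s) \o u)%VF.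
  by rewrite idE comp_lfun1r.
eexists; rewrite htr_compl; last exact: modhom_rho.
rewrite htr_compr; last exact: modhom_rho.
rewrite htr_compl; last exact: modhom_rho.
by rewrite htr_compr; last exact: modhom_rho.
Qed.

End GroupModules.

(** * Modules whose stable endomorphism ring is the base field *)

Lemma modcompE (k : fieldType) (A : falgType k) (U V W : fdmod A)
    (g : modhom V W) (f : modhom U V) x : modhom_comp g f x = g (f x).
Proof. exact: comp_lfunE. Qed.

Section Submodules.
Variables (k : fieldType) (A : falgType k).

Section Sub.
Variables (V : fdmod A) (X : {vspace V}).
Hypothesis subX : submodule X.

Fact sub_act_linear a : linear (fun x : subvs_of X => vsproj X (mact V a (vsval x))).
Proof. by move=> c x y; rewrite !linearP. Qed.
Definition sub_act (a : A) : 'End(subvs_of X) := lmap (sub_act_linear a).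

Lemma sub_actE a x : vsval (sub_act a x) = mact V a (vsval x).
Proof. by rewrite lmapE vsprojK // subX ?subvsP. Qed.

Fact sub_act_lin : linear sub_act.
Proof.
move=> c a b; apply/lfunP => x; apply: subvs_inj.
by rewrite add_lfunE scale_lfunE linearP /= !sub_actE linearP add_lfunE scale_lfunE.
Qed.
HB.instance Definition _ := GRing.isSemilinear.Build k _ _ _ sub_act
  (GRing.semilinear_linear sub_act_lin).
Fact sub_act1 : sub_act 1 = \1%VF.
Proof. by apply/lfunP => x; apply: subvs_inj; rewrite sub_actE mact1 !id_lfunE. Qed.
Fact sub_actM a b : sub_act (a * b) = (sub_act a \o sub_act b)%VF.
Proof.
apply/lfunP => x; apply: subvs_inj.
by rewrite comp_lfunE !sub_actE mactM comp_lfunE.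
Qed.
Definition sub_mod : fdmod A := @FdMod k A (subvs_of X) sub_act sub_act1 sub_actM.

Fact sub_in_subproof : linfun (vsval : subvs_of X -> V) \in mod_linear sub_mod V.
Proof.
apply/asboolP => a x; have E y : linfun (vsval : subvs_of X -> V) y = vsval y.
  exact: lfunE.
by rewrite !E; apply: sub_actE.
Qed.
Definition sub_in : modhom sub_mod V := ModHom sub_in_subproof.

Lemma sub_inE x : sub_in x = vsval x. Proof. by rewrite /= lfunE. Qed.

Section Out.
Variables (W : fdmod A) (f : modhom W V).
Hypothesis fX : forall w, f w \in X.
Fact sub_out_linear : linear (fun w => vsproj X (f w)).
Proof. by move=> c x y; rewrite !linearP. Qed.
Fact sub_out_subproof : lmap sub_out_linear \in mod_linear W sub_mod.
Proof.
apply/asboolP => a x; apply: subvs_inj.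
by rewrite sub_actE !lmapE !vsprojK // modhomP.
Qed.
Definition sub_out : modhom W sub_mod := ModHom sub_out_subproof.
Lemma sub_outE w : vsval (sub_out w) = f w.
Proof. by rewrite /= lmapE vsprojK. Qed.
End Out.

End Sub.

Lemma submodule_ker U V (f : modhom (U : fdmod A) V) : submodule (lker f).
Proof.
by move=> a x; rewrite !memv_ker modhomP => /eqP->; rewrite linear0.
Qed.

Lemma submodule_img U V (f : modhom (U : fdmod A) V) : submodule (limg f).
Proof.
move=> a _ /memv_imgP[x _ ->]; rewrite -modhomP.
by rewrite memv_img ?memvf.
Qed.

End Submodules.
Arguments submodule_ker {k A U V} f.
Arguments submodule_img {k A U V} f.

Lemma is_biproduct2_intro (k : fieldType) (C : lincat k) (X Y S : C)
    (i : hom X S) (j : hom Y S) (p : hom S X) (q : hom S Y) :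
  p ∘ i ≈ idm X -> q ∘ j ≈ idm Y -> p ∘ j ≈ 0 -> q ∘ i ≈ 0 ->
  i ∘ p + j ∘ q ≈ idm S -> is_biproduct2 X Y S.
Proof.
move=> pi qj pj qi s.
exists (fun b : bool => if b return hom (if b then X else Y) S then i else j).
exists (fun b : bool => if b return hom S (if b then X else Y) then p else q).
by split=> [[]|[] []|] //; rewrite big_bool.
Qed.

(** The complement of [X] is the kernel of the retraction. *)
Lemma biproduct_retract (k : fieldType) (A : falgType k) (X S : fdmod A)
    (i : modhom X S) (p : modhom S X) : modhom_comp p i = modhom_id X ->
  is_biproduct2 (X : modcat A) (sub_mod (submodule_ker p)) S.
Proof.
move=> pi; have piE x : p (i x) = x.
  by have := congr1 (fun f : modhom _ _ => f x) pi; rewrite /= comp_lfunE id_lfunE.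
pose e : modhom S S := modhom_id S - modhom_comp i p.
have eE x : e x = x - i (p x) by rewrite /= add_lfunE opp_lfunE comp_lfunE id_lfunE.
have eK x : e x \in lker p by rewrite memv_ker eE linearB /= piE subrr.
apply: (@is_biproduct2_intro k (modcat A) X (sub_mod (submodule_ker p)) S i
  (sub_in (submodule_ker p)) p (sub_out (submodule_ker p) eK)).
- by apply: heq_eq.
- apply: heq_eq; apply: modhomE => x; apply: subvs_inj.
  rewrite modcompE sub_outE eE sub_inE id_lfunE.
  by have := subvsP x; rewrite memv_ker => /eqP->; rewrite linear0 subr0.
- apply: heq_eq; apply: modhomE => x; rewrite modcompE sub_inE zero_lfunE.
  by apply/eqP; rewrite -memv_ker subvsP.
- apply: heq_eq; apply: modhomE => x; apply: subvs_inj.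
  by rewrite modcompE sub_outE eE piE subrr zero_lfunE.
- apply: heq_eq; apply: modhomE => x; rewrite /= add_lfunE.
  rewrite -[(i \o p)%VF]/(hval (modhom_comp i p)) modcompE.
  rewrite -[(_ \o _)%VF]/(hval (modhom_comp (sub_in (submodule_ker p)) (sub_out (submodule_ker p) eK))).
  by rewrite modcompE sub_inE sub_outE eE id_lfunE addrC subrK.
Qed.

Section Carlson.
Variables (k : fieldType) (P : finGroupType) (p : nat).
Hypotheses (pk : p \in [pchar k]) (pP : (p.-group [set: P])%g).
Local Notation kP := (group_alg k P).
Implicit Types U V W M : fdmod kP.

Definition equivariant U V (f : 'Hom(U, V)) := forall g x, f (rho U g x) = rho V g (f x).

Definition stably_scalar M := forall f : 'Hom(M, M), equivariant f ->
  exists c theta, f = c *: \1%VF + htr theta.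

Lemma equivariant_fix U V (f : 'Hom(U, V)) :
  reflect (equivariant f) (f \in rfix (hom_rep U V) [set: P]).
Proof.
apply: (iffP (rfixP _ _ _)) => [fP g x | fP g _].
  have /lfunP/(_ (rho U g x)) := fP g (in_setT _).
  by rewrite sandwichE !comp_lfunE rhoK.
by apply/lfunP => x; rewrite sandwichE !comp_lfunE -fP rhoKV.
Qed.

(** Group elements act unipotently. *)
Lemma ltr_rho V g : ltr (rho V g) = (\dim {:V})%:R.
Proof.
have [n oP] := p_natP pP; apply: (@ltr_unipotent _ p _ _ n) => //.
apply/lfunP => v; rewrite lpowE -(repX (rho1 V) (@rhoM _ _ V)) -oP.
by rewrite expg_cardG ?inE // rho1.
Qed.

(** Apply [projection_trace_neq0] to the algebra of linear endomorphisms of [M].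
    On it, [a |-> b h (c a) h^-1] has trace [tr(b h c) tr(h^-1)], and [tr(h^-1)]
    is [dim M]; so [dim M] cannot vanish in [k]. *)
Lemma stably_scalar_dim M : stably_scalar M -> ~ (exists theta : 'Hom(M, M), htr theta = \1%VF) ->
  (\dim {:M})%:R != 0 :> k.
Proof.
move=> scM nprojM; have M0 : (0 < dim M)%N.
  rewrite -dimvf lt0n dimv_eq0; apply/eqP => M0; apply: nprojM.
  exists 0; apply/lfunP => v; apply/eqP; rewrite -subr_eq0 -memv0 -M0; exact: memvf.
pose A := endalg M0; pose r : P -> 'End(A) := @hom_rep _ _ M M.
have r1 : r 1%g = \1%VF := hom_rep1 M M.
have rM : forall g h, r (g * h)%g = (r g \o r h)%VF := @hom_repM _ _ M M.
have rE g (a : A) : r g a = (rho M g \o (a : 'End(M)) \o rho M g^-1%g)%VF.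
  exact: sandwichE.
have conjM g (f f' : 'End(M)) : (rho M g \o (f \o f') \o rho M g^-1%g =
    (rho M g \o f \o rho M g^-1%g) \o (rho M g \o f' \o rho M g^-1%g))%VF.
  by apply/lfunP => v; rewrite !comp_lfunE rhoK.
have rmul g (a b : A) : r g (a * b) = r g a * r g b.
  by rewrite !rE; apply: conjM.
have [||Q [c [b [_ trb]]]] := projection_trace_neq0 pk pP r1 rM rmul.
- move=> a /equivariant_fix/scM[c [theta aE]]; exists c, theta.
  by rewrite gsum_hom.
- apply/negP => /memv_imgP[theta _]; rewrite gsum_hom => thE.
  by apply: nprojM; exists theta.
apply: contraNneq trb => d0; rewrite big1 // => h _.
have -> : (amull b \o r h \o amull c)%VF =
    sandwich ((b : 'End(M)) \o rho M h \o (c : 'End(M)))%VF (rho M h^-1%g).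
  apply/lfunP => f; rewrite sandwichE !comp_lfunE !amullE rE -!comp_lfunA.
  rewrite -![_ * _]/(_ \o _)%VF.
  by apply/lfunP => v; rewrite !comp_lfunE.
by rewrite ltr_sandwich ltr_rho d0 mulr0.
Qed.

Hypothesis ntP : (1 < #|[set: P]|)%N.

Lemma card_group0 : (#|P|%:R : k) = 0.
Proof.
have [n oP] := p_natP pP; move: ntP; rewrite cardsT in oP *; rewrite oP.
case: n {oP} => // n _; apply/eqP; rewrite -(dvdn_pcharf pk).
by rewrite expnS dvdn_mulr.
Qed.

(** Conjugate maps have the same trace, and the group order vanishes in [k]. *)
Lemma ltr_htr V (theta : 'Hom(V, V)) : ltr (htr theta) = 0.
Proof.
rewrite ltr_sum (eq_bigr (fun=> ltr theta)) => [|g _].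
  by rewrite sumr_const -mulr_natr cardT -cardE card_group0 mulr0.
rewrite -comp_lfunA ltrC -comp_lfunA -rhoM mulVg rho1.
by rewrite comp_lfun1r.
Qed.

Lemma htr1 V : htr (\1%VF : 'Hom(V, V)) = 0.
Proof.
apply/lfunP => x; rewrite htrE (eq_bigr (fun=> x)) => [|g _]; last first.
  by rewrite id_lfunE rhoKV.
by rewrite sumr_const zero_lfunE -scaler_nat cardT -cardE card_group0 scale0r.
Qed.

(** Otherwise [gtr_identity] makes the identity of [Hom(M, N)] a relative trace,
    and then the product of the dimensions, which is the trace of that identity,
    vanishes in [k]. *)
Lemma exists_nonprojective_map M (N : fdmod kP) : (\dim {:M})%:R != 0 :> k ->
  (\dim {:N})%:R != 0 :> k ->
  exists f : modhom M N, ~ factors_projective f.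
Proof.
move=> dM dN; apply: contrapT => allP.
have [||//|theta thE] := gtr_identity (hom_rep1 M N) (@hom_repM _ _ M N) pk pP (U := fullv).
- by move=> h _ x _; apply: memvf.
- move=> f _ /equivariant_fix fC; apply: contrapT => nf; apply: allP.
  exists (mkhom fC) => /factors_projectiveP[theta /= fE]; apply: nf.
  by rewrite fE -gsum_hom memv_img ?memvf.
- by move=> theta u _; apply: memvf.
have : ltr (gtr (@hom_rep _ _ M N) theta) = 0.
  have -> : gtr (@hom_rep _ _ M N) theta = htr (theta : 'Hom(hom_mod M N, hom_mod M N)).
    by apply: eq_bigr => g _; rewrite !rho_rep_mod.
  exact: (@ltr_htr (hom_mod M N) theta).
have -> : gtr (@hom_rep _ _ M N) theta = \1%VF.
  by apply/lfunP => f; rewrite id_lfunE thE ?memvf.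
move/eqP; rewrite ltr1 dimvf /= natrM mulf_eq0 -!dimvf.
by rewrite (negbTE dM) (negbTE dN).
Qed.

Lemma rho_trivial g x : rho (trivial_mod k P) g x = x.
Proof. by rewrite rho_rep_mod id_lfunE. Qed.

(** The splitting of [End(W)] into scalars and maps of trace zero.  An equivariant
    map of trace zero is a sum of conjugates, which can be corrected by a scalar
    to be the sum of the conjugates of a map of trace zero, so [gtr_identity]
    applies to the maps of trace zero. *)
Lemma trace_complement W : stably_scalar W -> (\dim {:W})%:R != 0 :> k ->
  exists2 psi : 'Hom('Hom(W, W), 'Hom(W, W)), forall a, ltr (psi a) = 0 &
    forall a, a = ((\dim {:W})%:R^-1 * ltr a) *: \1%VF + gtr (hom_rep W W) psi a.
Proof.
move=> scW dW; pose d := (\dim {:W})%:R : k; pose S := hom_mod W W.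
pose q := (@ltr k W : 'End(W) -> k^o).
have lq t : linfun q t = ltr t by apply: lfunE.
have kerC : @submodule k _ S (lker (linfun q)).
  move=> x t; rewrite !memv_ker !lq => /eqP t0.
  rewrite (mact_rho S x) sum_lfunE ltr_sum big1 // => g _.
  rewrite scale_lfunE ltrZ rho_hom ltrC comp_lfunA -rhoM mulVg rho1 comp_lfun1l.
  by rewrite t0 mulr0.
set U := sub_mod kerC.
have kerq (t : 'End(W)) : (t \in lker (linfun q)) = (ltr t == 0).
  by rewrite memv_ker lq.
have valU g (u : U) : vsval (rho U g u) = hom_rep W W g (vsval u).
  by rewrite -(@rho_rep_mod k P _ _ (hom_rep1 W W) (@hom_repM _ _ W W)); apply: sub_actE kerC _ u.
have [|||theta thE] := gtr_identity (rho1 U) (@rhoM _ _ U) pk pP (U := fullv).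
- by move=> h _ x _; apply: memvf.
- move=> u _ /rfixP uF.
  have uC : equivariant (vsval u : 'Hom(W, W)).
    by apply/equivariant_fix/rfixP => g gP; rewrite -valU uF.
  have [c [theta uE]] := scW _ uC.
  have u0 : ltr (vsval u : 'End(W)) = 0 by apply/eqP; rewrite -kerq subvsP.
  have c0 : c = 0.
    move: u0; rewrite uE ltrD ltrZ ltr1 ltr_htr addr0 => /eqP.
    by rewrite mulf_eq0 (negbTE dW) orbF => /eqP.
  pose theta' : 'End(W) := theta - (d^-1 * ltr theta) *: \1%VF.
  have th'K : theta' \in lker (linfun q).
    by rewrite kerq ltrB ltrZ ltr1 mulrAC mulVf // mul1r subrr.
  apply/memv_imgP; exists (Subvs th'K : U); first exact: memvf.
  apply: subvs_inj; rewrite uE c0 scale0r add0r gsumE linear_sum /=.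
  have <- : htr (theta' : 'Hom(W, W)) = htr theta.
    by rewrite linearB linearZ /= htr1 scaler0 subr0.
  rewrite -gsum_hom gsumE; apply: eq_bigr => g _.
  by rewrite valU.
- by move=> theta u _; apply: memvf.
pose e (a : 'End(W)) := a - (d^-1 * ltr a) *: \1%VF.
have eK a : e a \in lker (linfun q).
  by rewrite kerq ltrB ltrZ ltr1 mulrAC mulVf // mul1r subrr.
have eL : linear e.
  move=> c a b; rewrite /e ltrD ltrZ mulrDr scalerDl opprD addrACA scalerBr.
  by rewrite scalerA mulrCA.
have psiL : linear (fun a : 'End(W) => vsval (theta (vsproj (lker (linfun q)) (e a)))).
  by move=> c a b; rewrite eL !linearP.
exists (lmap psiL) => a; first by rewrite lmapE; apply/eqP; rewrite -kerq subvsP.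
rewrite -[LHS](subrK ((d^-1 * ltr a) *: \1%VF)) addrC; congr (_ + _).
have eg g b : e (hom_rep W W g b) = hom_rep W W g (e b).
  have E1 : hom_rep W W g \1%VF = \1%VF.
    by rewrite hom_repE comp_lfun1r -rhoM mulgV rho1.
  have E2 : ltr (hom_rep W W g b) = ltr b.
    by rewrite hom_repE ltrC comp_lfunA -rhoM mulVg rho1 comp_lfun1l.
  by rewrite /e E2 [RHS]linearB /= [in RHS]linearZ /= E1.
pose u : U := Subvs (eK a); have ua : vsval u = e a by [].
rewrite gtrE -/(e a) -ua -{1}(thE u (memvf u)) gtrE linear_sum /=.
apply: eq_bigr => g _; rewrite valU lmapE eg; congr (hom_rep W W g (vsval (theta _))).
by apply: subvs_inj; rewrite valU ua vsprojK // -eg.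
Qed.

(** The identity of the kernel is the relative trace of the restriction of [psi]. *)
Lemma ker_projective (S X : fdmod kP) (q : modhom S X) (psi : 'End(S)) :
  (forall t, q (psi t) = 0) -> (forall t, q t = 0 -> htr psi t = t) ->
  projective_mod (sub_mod (submodule_ker q)).
Proof.
move=> qpsi psiK; set K := sub_mod _.
have thL : linear (fun u : K => vsproj (lker q) (psi (vsval u)) : K).
  by move=> c x y; rewrite !linearP.
have valK g (u : K) : vsval (rho K g u) = rho S g (vsval u).
  exact: sub_actE (submodule_ker q) _ u.
apply: (@projective_htr _ _ K (lmap thL)); apply/lfunP => u; apply: subvs_inj.
rewrite id_lfunE -[RHS]psiK; last by apply/eqP; rewrite -memv_ker subvsP.
rewrite !htrE linear_sum; apply: eq_bigr => g _ /=.
by rewrite valK lmapE vsprojK ?valK // memv_ker qpsi.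
Qed.

Section Dual.
Variable V : fdmod kP.

Lemma rho_dual g : rho (dual_mod V) g = dual_map (rho V g^-1%g).
Proof. by rewrite rho_rep_mod. Qed.

Lemma rho_tens W g : rho (tens_mod V W) g = hom_rep (dual_mod V) W g.
Proof.
rewrite rho_rep_mod; apply/lfunP => t.
by rewrite [RHS]sandwichE rho_dual invgK [LHS]tens_mapE.
Qed.

Lemma rho_tensE W g (t : tens_mod V W) : rho (tens_mod V W) g t =
  (rho W g \o (t : 'Hom(dual_mod V, W)) \o rho (dual_mod V) g^-1%g)%VF.
Proof. by rewrite rho_tens; exact: (@hom_repE _ _ (dual_mod V) W g t). Qed.

Lemma dim_dual : \dim {:dual_mod V} = \dim {:V}.
Proof. by rewrite !dimvf; apply: muln1. Qed.

(** Transposition is an equivariant anti-isomorphism of endomorphism algebras. *)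
Lemma stably_scalar_dual : stably_scalar V -> stably_scalar (dual_mod V).
Proof.
move=> scV f fC.
pose f0 : 'End(V) := \sum_i rank1 (basisv i) (f (dual_basis i)).
have f0E (phi : dualv V) : (phi \o f0)%VF = f phi.
  have phiE : phi = \sum_i (phi (basisv i) : k) *: dual_basis i.
    apply/lfunP => v; rewrite {1}(basisv_sum v) linear_sum sum_lfunE.
    by apply: eq_bigr => i _; rewrite linearZ scale_lfunE; apply: mulrC.
  rewrite {2}phiE linear_sum; apply/lfunP => v; rewrite comp_lfunE !sum_lfunE linear_sum.
  apply: eq_bigr => i _; rewrite rank1E linearZ linearZ scale_lfunE.
  exact: mulrC.
have dual_ext (a b : 'End(V)) : (forall phi : dualv V, (phi \o a = phi \o b)%VF) -> a = b.
  move=> ab; apply/lfunP => v; rewrite [LHS]basisv_sum [RHS]basisv_sum.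
  by apply: eq_bigr => i _; have /lfunP/(_ v) := ab (dual_basis i); rewrite !comp_lfunE => ->.
have f0C : equivariant f0.
  move=> g x; suff /lfunP/(_ x) : (f0 \o rho V g = rho V g \o f0)%VF.
    by rewrite !comp_lfunE.
  apply: dual_ext => phi.
  rewrite comp_lfunA f0E comp_lfunA f0E.
  have := fC g^-1%g phi; rewrite !rho_dual invgK !dual_mapE => ->.
  by [].
have [c [theta E]] := scV f0 f0C.
exists c, (dual_map theta); apply/lfunP => phi.
rewrite -f0E E add_lfunE scale_lfunE id_lfunE comp_lfunDr -comp_lfunZr comp_lfun1r.
congr (_ + _); rewrite htrE /htr; apply/lfunP => v.
rewrite comp_lfunE !sum_lfunE linear_sum /=.
apply: eq_bigr => g _; rewrite !comp_lfunE !rho_dual !dual_mapE invgK.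
by rewrite !comp_lfunE.
Qed.

(** [V ⊗ V^*] is the endomorphism space of [V^*], to which [trace_complement]
    applies. *)
Lemma stably_scalar_endotrivial : stably_scalar V -> (\dim {:V})%:R != 0 :> k ->
  endotrivial V.
Proof.
move=> scV dV; pose W := dual_mod V; have scW : stably_scalar W := stably_scalar_dual scV.
have dW : (\dim {:W})%:R != 0 :> k by rewrite dim_dual.
have [psi psi0 psiE] := trace_complement scW dW.
pose d := (\dim {:W})%:R : k; pose S := tens_mod V W.
have iL : linear (fun c : k^o => (c *: \1%VF : 'End(W)) : S).
  by move=> c x y; rewrite scalerDl scalerA.
have pL : linear (fun t : S => (d^-1 * ltr (t : 'End(W)) : k^o)).
  by move=> c x y; rewrite ltr_linear mulrDr scalerAr.
have iC g (x : trivial_mod k P) : lmap iL (rho (trivial_mod k P) g x) = rho S g (lmap iL x).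
  rewrite rho_trivial rho_tensE !lmapE; apply/lfunP => v.
  rewrite !comp_lfunE !scale_lfunE !id_lfunE linearZ /=.
  by congr (_ *: _); apply: esym; exact: (@rhoKV _ _ W g v).
have pC g (t : S) : lmap pL (rho S g t) = rho (trivial_mod k P) g (lmap pL t).
  rewrite rho_trivial rho_tensE !lmapE; congr (_ * _).
  by rewrite ltrC comp_lfunA -rhoM mulVg rho1 comp_lfun1l.
pose i : modhom (trivial_mod k P) S := mkhom iC.
pose q : modhom S (trivial_mod k P) := @mkhom k P S (trivial_mod k P) (lmap pL) pC.
have qi : modhom_comp q i = modhom_id (trivial_mod k P).
  apply: modhomE => x; rewrite modcompE [RHS]id_lfunE /= !lmapE.
  by rewrite ltrZ ltr1 mulrCA mulVf // mulr1.
exists (sub_mod (submodule_ker q)); last exact: (biproduct_retract qi).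
have qE (t : S) : q t = d^-1 * ltr (t : 'End(W)) :> k := lmapE pL t.
apply: (@ker_projective _ _ q psi) => [t|t qt].
  by rewrite qE psi0 mulr0.
rewrite [RHS](psiE (t : 'End(W))) -qE qt scale0r add0r.
by rewrite gtrE htrE; apply: eq_bigr => g _; rewrite !rho_tens.
Qed.

End Dual.

End Carlson.

(** * Basic algebras with a unique simple module *)

Lemma sub1_nil_unit (k : fieldType) (A : falgType k) (x : A) n :
  x ^+ n = 0 -> 1 - x \is a GRing.unit.
Proof.
move=> xn; have xs : (1 - x) * (\sum_(i < n) x ^+ i) = 1.
  have := subrX1 x n; rewrite xn sub0r => /(congr1 -%R).
  by rewrite opprK -mulNr opprB => <-.
apply/unitrP; exists (\sum_(i < n) x ^+ i); split=> //.
rewrite -[RHS]xs; apply: commr_sym; apply: commr_sum => i _; apply: commrX.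
by apply: commr_sym; apply: commrB => //; apply: commr1.
Qed.

Section Modules.
Variables (k : fieldType) (A : falgType k).
Implicit Types U V W S T : fdmod A.

Section Quot.
Variables (V : fdmod A) (X : {vspace V}).
Hypothesis subX : submodule X.

Fact quotm_act_linear a : linear (fun x => quot_pi X (mact V a (quot_repr X x))).
Proof. by move=> c x y; rewrite !linearP. Qed.
Definition quotm_act (a : A) : 'End(quotv X) := lmap (quotm_act_linear a).

Lemma quotm_actE a v : quotm_act a (quot_pi X v) = quot_pi X (mact V a v).
Proof.
rewrite lmapE; apply: quot_pi_congr; rewrite -linearB; apply: subX.
by rewrite -opprB rpredN quot_piK.
Qed.

Fact quotm_act_lin : linear quotm_act.
Proof.
move=> c a b; apply/lfunP => x; rewrite -(quot_reprK x) add_lfunE scale_lfunE.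
by rewrite !quotm_actE linearP add_lfunE scale_lfunE linearP.
Qed.
HB.instance Definition _ := GRing.isSemilinear.Build k _ _ _ quotm_act
  (GRing.semilinear_linear quotm_act_lin).
Fact quotm_act1 : quotm_act 1 = \1%VF.
Proof.
by apply/lfunP => x; rewrite -(quot_reprK x) quotm_actE mact1 !id_lfunE.
Qed.
Fact quotm_actM a b : quotm_act (a * b) = (quotm_act a \o quotm_act b)%VF.
Proof.
apply/lfunP => x; rewrite -(quot_reprK x) comp_lfunE !quotm_actE mactM.
by rewrite comp_lfunE.
Qed.
Definition quot_mod : fdmod A :=
  @FdMod k A (quotv X) quotm_act quotm_act1 quotm_actM.

Fact quot_in_subproof : quot_pi X \in mod_linear V quot_mod.
Proof. by apply/asboolP => a x; apply/esym/quotm_actE. Qed.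
Definition quot_in : modhom V quot_mod := ModHom quot_in_subproof.

Lemma limg_quot_in : limg quot_in = fullv.
Proof.
apply/vspaceP => x; rewrite memvf; apply/memv_imgP.
by exists (quot_repr X x); rewrite ?memvf //= quot_reprK.
Qed.

End Quot.

(** A submodule of maximal dimension among the proper ones is maximal. *)
Lemma exists_simple_quotient V : fullv <> 0%VS :> {vspace V} ->
  exists (T : fdmod A) (q : modhom V T), simple_mod T /\ limg q = fullv.
Proof.
move=> V0; pose proper n := `[< exists X : {vspace V},
  [/\ submodule X, X <> fullv & \dim X = n] >].
have ex : exists n, proper n.
  exists 0%N; apply/asboolP; exists 0%VS; split; last exact: dimv0.
    by move=> a x; rewrite !memv0 => /eqP->; rewrite linear0.
  by move=> E; apply: V0.
have bd n : proper n -> (n <= \dim {:V})%N.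
  by move/asboolP=> [X [_ _ <-]]; apply: dimvS; apply: subvf.
case: (ex_maxnP ex bd) => n /asboolP[X [subX Xf dX]] max.
exists (quot_mod subX), (quot_in subX); split; last exact: limg_quot_in.
split=> [E|Z subZ].
  apply: Xf; apply/vspaceP => v; rewrite memvf -quot_pi_eq0 -memv0 -E.
  exact: memvf.
pose Z' := (quot_in subX @^-1: Z)%VS.
have inZ' v : (v \in Z') = (quot_pi X v \in Z) by rewrite -memv_preim.
have sXZ : (X <= Z')%VS.
  by apply/subvP => x; rewrite inZ' -quot_pi_eq0 => /eqP->; apply: mem0v.
have [Z'f | Z'f] := pselect (Z' = fullv).
  right; apply/vspaceP => x; rewrite memvf -(quot_reprK x) -inZ' Z'f.
  exact: memvf.
left; apply/eqP; rewrite -subv0; apply/subvP => x xZ; rewrite memv0.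
have sub' : submodule Z'.
  by move=> a x'; rewrite !inZ' -quotm_actE //; apply: subZ.
have /max dZ : proper (\dim Z') by apply/asboolP; exists Z'.
have : (X == Z')%VS by rewrite eqEdim sXZ dX.
rewrite eqEsubv => /andP[_ /subvP sZX].
have /sZX : quot_repr X x \in Z' by rewrite inZ' quot_reprK.
by rewrite -(quot_pi_eq0 X) quot_reprK.
Qed.

Lemma modhom_inverse U V (f : modhom U V) : lker f = 0%VS -> limg f = fullv ->
  exists g : modhom V U, modhom_comp g f = modhom_id U /\
                         modhom_comp f g = modhom_id V.
Proof.
move=> f0 f1; have fK : cancel f (f : 'Hom(U, V))^-1%VF.
  by apply: lker0_lfunK; rewrite f0.
have fV v : f ((f : 'Hom(U, V))^-1%VF v) = v by rewrite limg_lfunVK ?f1 ?memvf.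
have gA : (f : 'Hom(U, V))^-1%VF \in mod_linear V U.
  by apply/asboolP => a v; rewrite -{1}(fV v) -modhomP fK.
exists (ModHom gA); split; apply: modhomE => x; rewrite modcompE id_lfunE.
  exact: fK.
exact: fV.
Qed.

Lemma schur S T (f : modhom S T) : simple_mod S -> simple_mod T -> f != 0 ->
  isomorphic (S : modcat A) T.
Proof.
move=> [S0 simS] [T0 simT] f0.
have f_eq0 : (f : 'Hom(S, T)) != 0 by apply: contra f0 => /eqP E; apply/eqP/val_inj.
have [||g [gf fg]] := @modhom_inverse _ _ f.
- have [//|E] := simS _ (submodule_ker f).
  case/eqP: f_eq0; apply/lfunP => x; apply/eqP.
  by rewrite zero_lfunE -memv_ker E memvf.
- have [E|//] := simT _ (submodule_img f).
  case/eqP: f_eq0; apply/lfunP => x; apply/eqP.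
  by rewrite zero_lfunE -memv0 -E memv_img ?memvf.
by exists f, g; split; apply: heq_eq.
Qed.

Lemma lpow_modhom V (f : modhom V V) n : lpow f n \in mod_linear V V.
Proof.
apply/asboolP => a x; rewrite !lpowE.
by elim: n => //= n ->; rewrite modhomP.
Qed.

Lemma peval_modhom V (f : modhom V V) q : peval f q \in mod_linear V V.
Proof.
by apply: rpred_sum => i _; apply: rpredZ; apply: lpow_modhom.
Qed.

(** The image of the Fitting idempotent is a direct summand. *)
Lemma fitting_indecomposable V (f : modhom V V) : indecomposable (V : modcat A) ->
  (exists n, lpow f n = 0) \/
  exists g, modhom_comp g f = modhom_id V /\ modhom_comp f g = modhom_id V.
Proof.
move=> [_ indV]; have [n [q []]] := fitting f.
set e := peval _ _ => ee fe; pose E : modhom V V := ModHom (peval_modhom f (q * 'X^(n.+1))).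
have eeE v : E (E v) = E v by rewrite -[LHS]comp_lfunE ee.
have eI v : E v \in limg E by rewrite memv_img ?memvf.
have sE : submodule (limg E) := submodule_img E.
have eK u : u \in limg E -> E u = u.
  by case/memv_imgP=> v _ ->; apply: eeE.
have pi : modhom_comp (sub_out sE eI) (sub_in sE) = modhom_id (sub_mod sE).
  apply: modhomE => x; apply: subvs_inj; rewrite modcompE sub_outE sub_inE id_lfunE.
  by rewrite eK ?subvsP.
case: (indV _ _ (biproduct_retract pi)) => /subr0_eq z0; [left | right].
  exists n.+1; rewrite -fe; have -> : e = 0; last exact: comp_lfun0r.
  apply/lfunP => v; rewrite zero_lfunE -[e v]/(E v) -(sub_outE sE eI v).
  have := congr1 (fun h : modhom _ _ => h (sub_out sE eI v)) z0.
  by rewrite id_lfunE zero_lfunE => ->.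
have e1 v : E v = v.
  have kv : v - E v \in lker (sub_out sE eI).
    rewrite memv_ker; apply/eqP/subvs_inj; rewrite sub_outE.
    have -> : E (v - E v) = E v - E (E v) by rewrite linearB.
    by rewrite eeE subrr.
  pose K := sub_mod (submodule_ker (sub_out sE eI)).
  have := congr1 (fun h : modhom K K => vsval (h (Subvs kv : K))) z0.
  by rewrite id_lfunE zero_lfunE => /eqP; rewrite subr_eq0 => /eqP/esym.
have f0 : lker f = 0%VS.
  apply/eqP; rewrite -subv0; apply/subvP => v; rewrite memv_ker memv0 => /eqP fv.
  rewrite -(e1 v) /= exprSr mulrA pevalM pevalX comp_lfunE fv linear0.
  exact: eqxx.
by apply: modhom_inverse => //; apply: lker0_limgf; rewrite f0.
Qed.

Lemma projective_retract U V (i : modhom U V) (p : modhom V U) :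
  modhom_comp p i = modhom_id U -> projective_mod V -> projective_mod U.
Proof.
move=> pi pV W X g f gsurj; have [h hE] := pV W X g (modhom_comp f p) gsurj.
exists (modhom_comp h i).
by rewrite modhom_compA hE -modhom_compA pi modhom_compm1.
Qed.

Lemma projective_regular : projective_mod (regular_mod A).
Proof.
move=> V W g f gsurj; pose v := (g : 'Hom(V, W))^-1%VF (f 1).
have gv : g v = f 1 by rewrite limg_lfunVK ?gsurj ?memvf.
have hL : linear (fun a : regular_mod A => mact V a v).
  by move=> c a b; rewrite linearP add_lfunE scale_lfunE.
have hE a : lmap hL a = mact V a v by apply: lmapE.
have hA : lmap hL \in mod_linear (regular_mod A) V.
  apply/asboolP => a b; rewrite !hE -[RHS]comp_lfunE -mactM.
  by congr (mact V _ v); apply: amullE.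
exists (ModHom hA); apply: modhomE => a; rewrite modcompE [ModHom hA a]hE modhomP gv.
rewrite -(modhomP f); congr (hval f _).
by rewrite [LHS]amullE mulr1.
Qed.

Section UniqueSimple.
Variable T : fdmod A.
Hypotheses (simT : simple_mod T)
  (uniqT : forall S, simple_mod S -> isomorphic (S : modcat A) T).

Lemma onto_simple V : fullv <> 0%VS :> {vspace V} ->
  exists q : modhom V T, limg q = fullv.
Proof.
case/exists_simple_quotient=> S [q [/uniqT[f [g [_ /subr0_eq fg]]] qs]].
exists (modhom_comp f q); apply/vspaceP => x; rewrite memvf.
have : g x \in limg q by rewrite qs memvf.
case/memv_imgP=> v _ gx; apply/memv_imgP; exists v; first exact: memvf.
rewrite modcompE -gx; have := congr1 (fun h : modhom _ _ => h x) fg.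
by rewrite modcompE id_lfunE.
Qed.

(** Lift the maps onto the simple module along each other: the composites induce
    the identity on the simple quotient, so they are not nilpotent. *)
Lemma projective_indecomposable_iso U V :
  indecomposable (U : modcat A) -> indecomposable (V : modcat A) ->
  projective_mod U -> projective_mod V -> isomorphic (U : modcat A) V.
Proof.
move=> iU iV pU pV.
have nz W : indecomposable (W : modcat A) -> fullv <> 0%VS :> {vspace W}.
  move=> [W0 _] WE; apply: W0; apply: heq_eq; apply: modhomE => x.
  by rewrite zero_lfunE id_lfunE; apply/eqP; rewrite -memv0 -WE memvf.
have [qU sU] := onto_simple (nz U iU); have [qV sV] := onto_simple (nz V iV).
have [f fE] := pU _ _ qV qU sV; have [g gE] := pV _ _ qU qV sU.
have iso W (q : modhom W T) (h : modhom W W) : indecomposable (W : modcat A) ->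
    limg q = fullv -> modhom_comp q h = q ->
    exists h', modhom_comp h' h = modhom_id W /\ modhom_comp h h' = modhom_id W.
  move=> iW sq qh; have [[n hn]|//] := fitting_indecomposable h iW.
  have qn v : q (lpow h n v) = q v.
    rewrite lpowE; elim: n v {hn} => //= n IH v.
    by rewrite -[LHS]modcompE qh IH.
  case: simT => -[]; rewrite -sq; apply/vspaceP => x; rewrite memv0.
  apply/memv_imgP/eqP => [[v _ ->]|->]; first by rewrite -qn hn zero_lfunE linear0.
  by exists 0; rewrite ?memvf ?linear0.
have [|h [hgf _]] := iso U qU (modhom_comp g f) iU sU.
  by rewrite modhom_compA gE fE.
have [|h' [_ fgh]] := iso V qV (modhom_comp f g) iV sV.
  by rewrite modhom_compA fE gE.
pose l := modhom_comp h g; pose r := modhom_comp g h'.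
have lf : modhom_comp l f = modhom_id U by rewrite -modhom_compA.
have fr : modhom_comp f r = modhom_id V by rewrite modhom_compA.
have lr : l = r by rewrite -[l]modhom_compm1 -fr modhom_compA lf modhom_comp1m.
exists f, l; split; apply: heq_eq; first exact: lf.
by rewrite lr.
Qed.

(** The indecomposable summands of the regular module are all isomorphic, so there
    is only one and the regular module is indecomposable.  Apply Fitting's lemma
    to right multiplication by [a]. *)
Lemma basic_nil_or_unit : basic_algebra A -> forall a : A,
  (exists n, a ^+ n = 0) \/ a \is a GRing.unit.
Proof.
move=> [n [M [[inj [prj [pij _ ip]]] indM distinct]]] a.
have pM i : projective_mod (M i).
  exact: projective_retract (subr0_eq (pij i)) projective_regular.
have eqM (i j : 'I_n) : i = j.
  by apply: distinct; apply: projective_indecomposable_iso.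
have [i0 _] : exists i : 'I_n, True.
  case: (n) M inj prj ip {pij indM distinct pM eqM} => [|m] M inj prj ip; last by exists ord0.
  move: ip; rewrite big_ord0 => /subr0_eq/(congr1 (fun h : modhom (regular_mod A) (regular_mod A) => h (1 : A))).
  by rewrite zero_lfunE id_lfunE => /eqP; rewrite eq_sym oner_eq0.
have ip1 : modhom_comp (inj i0) (prj i0) = modhom_id (regular_mod A).
  apply: etrans (subr0_eq ip); rewrite (bigD1 i0) //= big1 ?addr0 // => i.
  by rewrite (eqM i i0) eqxx.
have RL : amulr a \in mod_linear (regular_mod A) (regular_mod A).
  by apply/asboolP => b x; rewrite /= !lfunE /= mulrA.
pose R := ModHom RL.
pose f := modhom_comp (prj i0) (modhom_comp R (inj i0)).
have ipE x : inj i0 (prj i0 x) = x by rewrite -modcompE ip1 id_lfunE.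
have RE x : R x = x * a by rewrite /= lfunE.
have [[m fm]|[g [gf fg]]] := fitting_indecomposable f (indM i0); [left|right].
  exists m; have Rm x : iter m R x = x * a ^+ m.
    elim: m {fm} => [|m IH]; first by rewrite mulr1.
    by rewrite iterS IH RE exprSr mulrA.
  have -> : a ^+ m = iter m R 1 by rewrite Rm mul1r.
  have <- : inj i0 (iter m f (prj i0 1)) = iter m R 1.
    elim: m {fm Rm} => [|m IH]; first exact: ipE.
    by rewrite !iterS -IH /f !modcompE ipE.
  by rewrite -lpowE fm zero_lfunE linear0.
pose G := modhom_comp (inj i0) (modhom_comp g (prj i0)).
have pi0 : modhom_comp (prj i0) (inj i0) = modhom_id (M i0) := subr0_eq (pij i0).
have pi1 x : prj i0 (inj i0 x) = x by rewrite -modcompE pi0 id_lfunE.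
have gfE x : g (f x) = x by rewrite -modcompE gf id_lfunE.
have fgE x : f (g x) = x by rewrite -modcompE fg id_lfunE.
have fE y : f y = prj i0 (R (inj i0 y)) by rewrite !modcompE.
have GE y : G y = inj i0 (g (prj i0 y)) by rewrite !modcompE.
have GR x : G (R x) = x by rewrite GE -{1}(ipE x) -fE gfE ipE.
have RG x : R (G x) = x by rewrite -[LHS]ipE GE -fE fgE ipE.
have Gm x y : G (x * y) = x * G y.
  by have := modhomP G x y; rewrite ![mact _ _ _]amullE.
apply/unitrP; exists (G 1); split; first by rewrite -RE RG.
by rewrite -Gm mulr1 -[a]mul1r -RE GR.
Qed.

Lemma basic_local : basic_algebra A -> local_algebra A.
Proof.
move=> bA a b na nb; apply/negP => nab; pose u := (a + b)^-1.
have uU : u \is a GRing.unit by rewrite unitrV.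
have [[n ua]|] := basic_nil_or_unit bA (u * a); last by rewrite unitrMr // (negPf na).
have ub : u * b = 1 - u * a.
  by rewrite -(mulVr nab) -/u mulrDr addrAC subrr add0r.
by case/negP: nb; rewrite -(unitrMr _ uU) ub (sub1_nil_unit ua).
Qed.

End UniqueSimple.
End Modules.

(** * Images of simple modules in the stable category *)

Section StableMaps.
Variables (k : fieldType) (P : finGroupType).
Local Notation kP := (group_alg k P).
Implicit Types U V W : fdmod kP.

(** Equality in the stable category, in the form given by Higman's criterion.  It
    is stated for linear maps, so that no proof of equivariance is carried
    along. *)
Definition steq U V (f g : 'Hom(U, V)) := exists theta, f = g + htr theta.

Lemma stab_heqP U V (f g : @hom k (stmod kP) U V) :
  f ≈ g <-> steq (hval f) (hval g).
Proof.
split=> [/factors_projectiveP[theta E] | [theta E]].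
  by exists theta; rewrite -E addrC subrK.
by apply/factors_projectiveP; exists theta; rewrite /= E addrC addKr.
Qed.

Lemma steq_refl U V (f : 'Hom(U, V)) : steq f f.
Proof. by exists 0; rewrite linear0 addr0. Qed.

Lemma steq_sym U V (f g : 'Hom(U, V)) : steq f g -> steq g f.
Proof. by case=> theta ->; exists (- theta); rewrite linearN addrK. Qed.

Lemma steq_trans U V (f g h : 'Hom(U, V)) : steq f g -> steq g h -> steq f h.
Proof.
by move=> [s ->] [t ->]; exists (t + s); rewrite linearD addrA.
Qed.

Lemma steqZ U V c (f g : 'Hom(U, V)) : steq f g -> steq (c *: f) (c *: g).
Proof. by case=> s ->; exists (c *: s); rewrite linearZ scalerDr. Qed.

Lemma steq_comp U V W (f f' : 'Hom(V, W)) (g g' : 'Hom(U, V)) :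
  equivariant f -> equivariant g' -> steq f f' -> steq g g' ->
  steq (f \o g)%VF (f' \o g')%VF.
Proof.
move=> fC gC [s fE] [t gE]; exists ((s \o g') + (f \o t))%VF.
rewrite linearD /= -htr_compr // -htr_compl // {1}gE comp_lfunDr.
by rewrite {1}fE comp_lfunDl addrA.
Qed.

Lemma equivariant_comp U V W (f : 'Hom(V, W)) (g : 'Hom(U, V)) :
  equivariant f -> equivariant g -> equivariant (f \o g)%VF.
Proof. by move=> fC gC h x; rewrite !comp_lfunE gC fC. Qed.

Lemma equivariant1 U : equivariant (\1%VF : 'Hom(U, U)).
Proof. by move=> h x; rewrite !id_lfunE. Qed.

Lemma equivariantZ U V c (f : 'Hom(U, V)) : equivariant f -> equivariant (c *: f).
Proof. by move=> fC h x; rewrite !scale_lfunE fC linearZ. Qed.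

Lemma equivariant_modhom U V (f : modhom U V) : equivariant f.
Proof. by move=> g x; apply: modhom_rho. Qed.

Definition stiso U V := exists (f : 'Hom(U, V)) (g : 'Hom(V, U)),
  [/\ equivariant f, equivariant g, steq (g \o f)%VF \1%VF & steq (f \o g)%VF \1%VF].

Lemma stisoP U V : @isomorphic k (stmod kP) U V <-> stiso U V.
Proof.
split=> [[f [g [/stab_heqP gf /stab_heqP fg]]] | [f [g [fC gC gf fg]]]].
  by exists f, g; split=> //; apply: equivariant_modhom.
exists (mkhom fC : @hom k (stmod kP) U V), (mkhom gC : @hom k (stmod kP) V U).
by split; apply/stab_heqP.
Qed.

Lemma stiso_sym U V : stiso U V -> stiso V U.
Proof. by case=> f [g [fC gC gf fg]]; exists g, f. Qed.

Lemma stiso_trans U V W : stiso U V -> stiso V W -> stiso U W.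
Proof.
move=> [f [g [fC gC gf fg]]] [f' [g' [f'C g'C g'f' f'g']]].
have E (X Y Z : fdmod kP) (a : 'Hom(X, Y)) (b : 'Hom(Y, X)) (c : 'Hom(Y, Z))
    (d : 'Hom(Z, Y)) : equivariant a -> equivariant b -> equivariant c -> equivariant d ->
    steq (b \o a)%VF \1%VF -> steq (d \o c)%VF \1%VF ->
    steq ((b \o d) \o (c \o a))%VF \1%VF.
  move=> aC bC cC dC ba dc.
  have -> : ((b \o d) \o (c \o a) = b \o ((d \o c) \o a))%VF by rewrite !comp_lfunA.
  apply: steq_trans ba; rewrite -[X in steq _ (_ \o X)]comp_lfun1l.
  apply: steq_comp => //; [|exact: steq_refl|].
    by rewrite comp_lfun1l.
  by apply: steq_comp => //; [exact: equivariant_comp | exact: steq_refl].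
exists (f' \o f)%VF, (g \o g')%VF; split; try exact: equivariant_comp.
  exact: E.
exact: E.
Qed.

Lemma stiso_refl_eq U V (f : 'Hom(U, V)) (g : 'Hom(V, U)) :
  equivariant f -> equivariant g -> (g \o f)%VF = \1%VF -> (f \o g)%VF = \1%VF ->
  stiso U V.
Proof.
by move=> fC gC gf fg; exists f, g; split=> //; rewrite ?gf ?fg; apply: steq_refl.
Qed.

Lemma stably_scalar_iso U V : stiso U V -> stably_scalar V -> stably_scalar U.
Proof.
move=> [f [g [fC gC gf fg]]] scV h hC.
have [|c [theta E]] := scV (f \o h \o g)%VF; first by do !apply: equivariant_comp.
suff [t ->] : steq h (c *: \1%VF) by exists c, t.
have h1 : steq (g \o (f \o h \o g) \o f)%VF h.
  rewrite -{2}[h]comp_lfun1l -[X in steq _ X]comp_lfun1r !comp_lfunA -comp_lfunA.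
  apply: steq_comp => //; first by do !apply: equivariant_comp.
    exact: equivariant1.
  by apply: steq_comp => //; [exact: equivariant_comp | exact: steq_refl].
apply: steq_trans (steq_sym h1) _.
have E' : steq (f \o h \o g)%VF (c *: \1%VF) by exists theta.
have h2 : steq (g \o (f \o h \o g) \o f)%VF (g \o (c *: \1%VF) \o f)%VF.
  apply: steq_comp => //; [by do !apply: equivariant_comp| |exact: steq_refl].
  apply: steq_comp => //; last exact: steq_refl.
  by apply: equivariantZ; apply: equivariant1.
apply: steq_trans h2 _; rewrite -comp_lfunZr comp_lfun1r -comp_lfunZl.
exact: steqZ.
Qed.

Lemma projective_iso U V : stiso U V -> steq (\1%VF : 'Hom(U, U)) 0 ->
  steq (\1%VF : 'Hom(V, V)) 0.
Proof.
move=> [f [g [fC gC gf fg]]] U0; apply: steq_trans (steq_sym fg) _.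
have : steq ((f \o \1) \o g)%VF ((f \o 0) \o g)%VF.
  apply: steq_comp => //; last exact: steq_refl.
    by apply: equivariant_comp => //; apply: equivariant1.
  apply: steq_comp => //; last exact: steq_refl.
  by move=> h x; rewrite !zero_lfunE linear0.
by rewrite comp_lfun1r comp_lfun0r comp_lfun0l.
Qed.

End StableMaps.

Section EmbeddingSimple.
Variables (p : nat) (P : finGroupType) (k : fieldType) (D : falgType k).
Hypotheses (pk : p \in [pchar k]) (pP : (p.-group [set: P])%g)
  (ntP : (1 < #|[set: P]|)%N).
Local Notation kP := (group_alg k P).
Variable Phi : functor (modcat D) (stmod kP).
Hypotheses (PhiF : faithful_functor Phi) (PhiFull : full_functor Phi).
Hypothesis splitD : split_algebra D.

Lemma fhomZ (X Y : modcat D) c (f : hom X Y) : fhom Phi (c *: f) ≈ c *: fhom Phi f.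
Proof.
have F0 : fhom Phi (0 : hom X Y) ≈ 0.
  have := fhom_lin Phi (-1) 0 (0 : hom X Y).
  by rewrite scaler0 addr0 scaleN1r addNr.
have := fhom_lin Phi c f 0; rewrite addr0 => E; apply: heq_trans E _.
rewrite -[X in _ ≈ X]addr0 /heq opprD addrACA subrr add0r.
exact: F0.
Qed.

Lemma simple_neq0 (T : fdmod D) : simple_mod T -> modhom_id T <> 0.
Proof.
move=> [T0 _] id0; apply: T0; apply/vspaceP => x; rewrite memvf memv0.
have := congr1 (fun h : modhom T T => h x) id0.
by rewrite id_lfunE zero_lfunE => ->; rewrite eqxx.
Qed.

Lemma Phi_stably_scalar T : simple_mod T -> stably_scalar (Phi T : fdmod kP).
Proof.
move=> simT f fC; have [h hE] := PhiFull (mkhom fC : @hom k (stmod kP) (Phi T) (Phi T)).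
have [c hc] := splitD simT h; exists c.
have : (mkhom fC : @hom k (stmod kP) (Phi T) (Phi T)) ≈ c *: idm (Phi T).
  apply: heq_trans (heq_sym hE) _; rewrite hc; apply: heq_trans (fhomZ _ _) _.
  rewrite /heq -scalerBr -[_ *: _]addr0.
  by apply: null_lin; [exact: (fhom1 Phi T) | exact: null0].
by case/stab_heqP=> theta E; exists theta; apply: E.
Qed.

(** A projective image would identify the identity and the zero map of [T]. *)
Lemma Phi_nonprojective T : simple_mod T ->
  ~ steq (\1%VF : 'Hom(Phi T : fdmod kP, Phi T : fdmod kP)) 0.
Proof.
move=> simT st0; apply: (simple_neq0 simT); apply: subr0_eq.
apply: PhiF; apply: heq_trans (fhom1 Phi T) _.
apply: heq_trans (_ : 0 ≈ _); first exact/stab_heqP.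
apply: heq_sym; have := fhomZ 0 (idm (T : modcat D)).
by rewrite !scale0r.
Qed.

Lemma correspondent_dim (V : fdmod kP) T : simple_mod T -> stiso V (Phi T) ->
  stably_scalar V /\ (\dim {:V})%:R != 0 :> k.
Proof.
move=> simT iso; have scV := stably_scalar_iso iso (Phi_stably_scalar simT).
split=> //; apply: (stably_scalar_dim pk pP scV) => -[theta th1].
apply: (Phi_nonprojective simT); apply: projective_iso iso _.
by exists theta; rewrite add0r th1.
Qed.

(** By [exists_nonprojective_map] there is a stably nonzero map between the images
    of two simple modules; it comes from a map of [D]-modules, and Schur's lemma
    applies. *)
Lemma unique_simple S T : simple_mod S -> simple_mod T -> isomorphic (S : modcat D) T.
Proof.
move=> simS simT.
have refl (X : fdmod kP) : stiso X X.
  by apply: (@stiso_refl_eq _ _ _ _ \1%VF \1%VF); rewrite ?comp_lfun1l //; apply: equivariant1.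
have [_ dS] := correspondent_dim simS (refl (Phi S)).
have [_ dT] := correspondent_dim simT (refl (Phi T)).
have [f nf] := exists_nonprojective_map pk pP ntP dS dT.
have [h hE] := PhiFull (f : @hom k (stmod kP) (Phi S) (Phi T)).
apply: (schur (f := h) simS simT); apply/eqP => h0; apply: nf.
have : (f : @hom k (stmod kP) (Phi S) (Phi T)) ≈ 0.
  apply: heq_trans (heq_sym hE) _; rewrite h0.
  by have := fhomZ 0 (0 : @hom k (modcat D) S T); rewrite !scale0r.
by rewrite /heq subr0.
Qed.

Lemma exists_simple : exists T : fdmod D, simple_mod T.
Proof.
have [|T [_ [simT _]]] := @exists_simple_quotient k D (regular_mod D); last by exists T.
move=> E; pose u : regular_mod D := (1 : D).
by have := memvf u; rewrite E memv0 (negPf (oner_neq0 D)).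
Qed.

Lemma num_simple1 : num_simple D 1.
Proof.
have [T simT] := exists_simple; exists (fun=> T); split=> // [i j _|S simS].
  by rewrite !ord1.
by exists ord0; apply: unique_simple.
Qed.

Lemma local_of_basic : basic_algebra D -> local_algebra D.
Proof.
have [T simT] := exists_simple.
apply: (@basic_local _ _ T simT) => S simS; exact: unique_simple.
Qed.

End EmbeddingSimple.

(** * The residue character of a split local algebra *)

Section LocalAlgebra.
Variables (k : fieldType) (D : falgType k).
Hypothesis nil_or_unit : forall a : D, (exists n, a ^+ n = 0) \/ a \is a GRing.unit.
Hypothesis splitD : split_algebra D.
Variable T : fdmod D.
Hypothesis simT : simple_mod T.
Hypothesis uniqT : forall S, simple_mod S -> isomorphic (S : modcat D) T.

Lemma nonunit_mull (a b : D) : a \isn't a GRing.unit -> b * a \isn't a GRing.unit.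
Proof.
move=> na; have [[n an]|] := nil_or_unit a; last by rewrite (negPf na).
apply/negP => ba; have ca : (b * a)^-1 * b * a = 1 by rewrite -mulrA mulVr.
have step m : a ^+ m.+1 = 0 -> a ^+ m = 0.
  move=> am; have : (b * a)^-1 * b * (a * a ^+ m) = a ^+ m by rewrite mulrA ca mul1r.
  by rewrite -exprS am mulr0 => <-.
have : a ^+ 0 = 0 by elim: n an => // n IH /step/IH.
by move/eqP; rewrite expr0 oner_eq0.
Qed.

Lemma simple_gen (x : T) : x != 0 -> forall y, exists d, y = mact T d x.
Proof.
move=> x0 y; have [_ sim] := simT.
have L : linear (fun d : D => mact T d x).
  by move=> c a b; rewrite linearP add_lfunE scale_lfunE.
have sub : submodule (limg (lmap L)).
  move=> a _ /memv_imgP[d _ ->]; apply/memv_imgP; exists (a * d); rewrite ?memvf //.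
  by rewrite !lmapE mactM comp_lfunE.
have [E|E] := sim _ sub; last first.
  by have := memvf y; rewrite -E => /memv_imgP[d _ ->]; exists d; rewrite lmapE.
have : mact T 1 x \in limg (lmap L) by apply/memv_imgP; exists 1; rewrite ?memvf ?lmapE.
by rewrite E memv0 mact1 id_lfunE (negPf x0).
Qed.

(** If [x = b a x] then [1 - b a] kills [x]; but [b a] is nilpotent, so
    [1 - b a] is invertible. *)
Lemma nonunit_kills a x : a \isn't a GRing.unit -> mact T a x = 0.
Proof.
move=> na; apply/eqP; apply: contraT => ax0.
have [b xE] := simple_gen ax0 x.
have ba := nonunit_mull b na.
have [[n bn]|] := nil_or_unit (b * a); last by rewrite (negPf ba).
have u := sub1_nil_unit bn.
have : mact T (1 - b * a) x = 0.
  rewrite linearB add_lfunE opp_lfunE mact1 id_lfunE mactM comp_lfunE -xE.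
  exact: subrr.
move/(congr1 (mact T (1 - b * a)^-1)); rewrite -comp_lfunE -mactM mulVr //.
rewrite mact1 id_lfunE linear0 => x0.
by rewrite x0 linear0 eqxx in ax0.
Qed.

Lemma simple_vec : exists t : T, t != 0.
Proof.
have [T0 _] := simT; apply: contrapT => n0; apply: T0; apply/vspaceP => x.
rewrite memvf memv0; symmetry; apply/negPn/negP => x0; apply: n0.
by exists x.
Qed.

(** An element acts on the simple module by zero or invertibly, so every [s] gives
    a well-defined endomorphism [d t |-> d s t], which is a scalar as the algebra
    is split; hence the module is one-dimensional. *)
Lemma local_character : exists (t : T) (eps : 'Hom(D, k^o)),
  [/\ t != 0, forall x, exists c : k, x = c *: t,
      forall a x, mact T a x = (eps a : k) *: x,
      eps 1 = 1 :> k /\ (forall a b, eps (a * b) = (eps a : k) * (eps b : k) :> k) &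
      forall a, (eps a : k) = 0 <-> a \isn't a GRing.unit].
Proof.
have [t t0] := simple_vec.
have L (s : T) : linear (fun d : D => mact T d s).
  by move=> c a b; rewrite linearP add_lfunE scale_lfunE.
pose m := lmap (L t).
have mE d : m d = mact T d t by apply: lmapE.
clearbody m.
have msurj y : m (m^-1%VF y) = y.
  apply: limg_lfunVK; have [d ->] := simple_gen t0 y.
  by apply/memv_imgP; exists d; rewrite ?memvf ?mE.
have m0 d x : m d = 0 -> mact T d x = 0.
  rewrite mE => dt; apply: nonunit_kills; apply/negP => du.
  move/(congr1 (mact T d^-1)): dt; rewrite -comp_lfunE -mactM mulVr // mact1.
  by rewrite id_lfunE linear0 => /eqP; rewrite (negPf t0).
have scal s : exists c : k, mact T s t = c *: t.
  pose f := (lmap (L (mact T s t)) \o m^-1)%VF.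
  have fE d : f (mact T d t) = mact T d (mact T s t).
    rewrite comp_lfunE -mE lmapE; apply/eqP; rewrite -subr_eq0.
    rewrite -opp_lfunE -add_lfunE -linearB; apply/eqP/m0.
    rewrite -mE; have -> : m (m^-1%VF (m d) - d) = m (m^-1%VF (m d)) - m d by rewrite linearB.
    by rewrite msurj subrr.
  have fA : f \in mod_linear T T.
    apply/asboolP => a x; have [d ->] := simple_gen t0 x.
    by rewrite -[mact T a (mact T d t)]comp_lfunE -mactM !fE mactM comp_lfunE.
  have [c fc] := splitD simT (ModHom fA); exists c.
  have := congr1 (fun h : modhom T T => h t) fc.
  rewrite scale_lfunE id_lfunE => <-; have := fE 1.
  by rewrite !mact1 !id_lfunE.
have [phi phit] : exists phi : 'Hom(T, k^o), phi t = 1 :> k.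
  have [i ti] := exists_dual_neq0 t0.
  exists ((dual_basis i t : k)^-1 *: dual_basis i); rewrite scale_lfunE.
  exact: mulVf.
have epsL : linear (fun s => phi (mact T s t)).
  by move=> c a b; rewrite linearP add_lfunE scale_lfunE linearP.
pose eps := lmap epsL.
have epsE a : mact T a t = (eps a : k) *: t.
  have [c E] := scal a; rewrite lmapE E linearZ /= phit.
  by congr (_ *: _); apply/esym/mulr1.
have gen x : exists c : k, x = c *: t.
  by have [d ->] := simple_gen t0 x; exists (eps d); apply: epsE.
have inj c d : c *: t = d *: t -> c = d.
  move/eqP; rewrite -subr_eq0 -scalerBl scaler_eq0 (negPf t0) orbF subr_eq0.
  by move/eqP.
exists t, eps; split=> //.
- by move=> a x; have [c ->] := gen x; rewrite linearZ /= epsE !scalerA mulrC.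
- split=> [|a b]; apply: inj; first by rewrite -epsE mact1 id_lfunE scale1r.
  by rewrite -epsE mactM comp_lfunE epsE linearZ /= epsE scalerA mulrC.
- move=> a; split=> [a0|na]; last by apply: inj; rewrite -epsE nonunit_kills // scale0r.
  apply/negP => au; have := epsE a; rewrite a0 scale0r.
  move/(congr1 (mact T a^-1)); rewrite -comp_lfunE -mactM mulVr // mact1 id_lfunE.
  by rewrite linear0 => /eqP; rewrite (negPf t0).
Qed.

(** The powers [D], [J D], [J J D], ... of an ideal [J]; starting from [D] makes
    them left ideals by construction. *)
Fixpoint lideal_pow (J : {vspace D}) (m : nat) : {vspace D} :=
  if m is n.+1 then (J * lideal_pow J n)%VS else fullv.

(** Every nonzero left ideal has a simple quotient, killed by [J], so the powers of
    [J] decrease strictly until they vanish. *)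
Lemma radical_nilpotent (eps : 'Hom(D, k^o)) :
  (forall a x, mact T a x = (eps a : k) *: x) ->
  (forall a b, eps (a * b) = (eps a : k) * (eps b : k) :> k) ->
  exists N, lideal_pow (lker eps) N = 0%VS.
Proof.
move=> epsT epsM; set J := lker eps.
have JI a x : x \in J -> a * x \in J.
  by rewrite !memv_ker epsM => /eqP->; rewrite mulr0.
have PI m a x : x \in lideal_pow J m -> a * x \in lideal_pow J m.
  case: m => [|m]; first by rewrite !memvf.
  have /subvP sub : (J * lideal_pow J m <= amull a @^-1: (J * lideal_pow J m))%VS.
    apply/prodvP => u v uJ vW; rewrite -memv_preim amullE mulrA.
    by rewrite memv_mul ?JI.
  by move/sub; rewrite -memv_preim amullE.
have subJ m : (lideal_pow J m.+1 <= lideal_pow J m)%VS.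
  by apply/prodvP => u v _; apply: PI.
have lt m : lideal_pow J m != 0%VS ->
    (\dim (lideal_pow J m.+1) < \dim (lideal_pow J m))%N.
  move=> W0; rewrite ltn_neqAle dimvS ?subJ // andbT; apply/negP => dE.
  have : (lideal_pow J m.+1 == lideal_pow J m) by rewrite -(dimv_leqif_eq (subJ m)).
  move/eqP=> WE; pose W := lideal_pow J m.
  have subW : @submodule k D (regular_mod D) W.
    by move=> a x xW; rewrite /= amullE; apply: PI.
  have [|q qT] := onto_simple uniqT (V := sub_mod subW).
    move=> E; case/negP: W0; rewrite -/W -subv0; apply/subvP => x xW.
    have := memvf (Subvs xW : sub_mod subW); rewrite E memv0 memv0 => /eqP.
    by move/(congr1 (fun y : subvs_of W => vsval y)) => /= ->.
  pose f := ((q : 'Hom(subvs_of W, T)) \o linfun (vsproj W))%VF.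
  have fE x (xW : x \in W) : f x = q (Subvs xW : sub_mod subW).
    by rewrite comp_lfunE lfunE SubvsE.
  have sub : (W <= lker f)%VS.
    suff : (lideal_pow J m.+1 <= lker f)%VS by rewrite WE.
    apply/prodvP => u v uJ vW.
    have uvW : u * v \in W by apply: PI.
    rewrite memv_ker (fE _ uvW).
    have -> : (Subvs uvW : sub_mod subW) = mact (sub_mod subW) u (Subvs vW).
      apply: subvs_inj; apply: etrans (esym (sub_actE subW u (Subvs vW))).
      exact: (esym (amullE u v)).
    by rewrite modhomP epsT; move: uJ; rewrite memv_ker => /eqP ->; rewrite scale0r.
  have [T0 _] := simT; apply: T0; rewrite -qT; apply/vspaceP => x; rewrite memv0.
  apply/memv_imgP/eqP => [[y _ ->]|->]; last by exists 0; rewrite ?memvf ?linear0.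
  have yW := subvsP y; have := subvP sub _ yW; rewrite memv_ker (fE _ yW) => /eqP <-.
  by congr (hval q _); apply: subvs_inj.
have bd m : lideal_pow J m = 0%VS \/ (\dim (lideal_pow J m) + m <= \dim {:D})%N.
  elim: m => [|m [IH|IH]]; first by right; rewrite addn0.
    by left; rewrite /= IH prodv0.
  have [W0|W0] := eqVneq (lideal_pow J m) 0%VS; first by left; rewrite /= W0 prodv0.
  by right; apply: leq_trans IH; rewrite addnS ltn_add2r lt.
exists (\dim {:D}).+1; have [//|] := bd (\dim {:D}).+1.
by rewrite addnS ltnNge leq_addl.
Qed.

End LocalAlgebra.

(** * Balanced maps and right modules *)

Section BalancedMaps.
Variables (k : fieldType) (A B : falgType k) (Y : bimod A B) (M : fdmod B).

Fact kap_linear (x : M) : linear (fun y : Y => quot_pi (balanced_rel Y M) (tens y x)).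
Proof. by move=> c y z; rewrite tens_linl linearP. Qed.
(** The map [y |-> y ⊗ x]. *)
Definition kap (x : M) : 'Hom(Y, btens Y M) := lmap (kap_linear x).

Lemma kapE x y : kap x y = quot_pi (balanced_rel Y M) (tens y x).
Proof. exact: lmapE. Qed.

Lemma kap_is_linear : linear kap.
Proof.
move=> c x z; apply/lfunP => y; rewrite add_lfunE scale_lfunE !kapE tens_linr.
by rewrite linearP.
Qed.

Lemma kap_balanced b x y : kap x (ract Y b y) = kap (mact M b x) y.
Proof. by rewrite !kapE; apply: quot_pi_congr; apply: balanced_relP. Qed.

Lemma kap_act a x y : mact (btens_mod Y M) a (kap x y) = kap x (lact Y a y).
Proof.
rewrite !kapE [LHS]btens_map_pi ?tens_map_tens ?id_lfunE //.
  exact: ends_compat_lact.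
exact: hom_compat1.
Qed.

Lemma btens_ext (W : vectType k) (f g : 'Hom(btens Y M, W)) :
  (forall x y, f (kap x y) = g (kap x y)) -> f = g.
Proof.
move=> fg; apply/lfunP => z; rewrite -(quot_reprK z).
rewrite (tens_decomp (quot_repr (balanced_rel Y M) z)) !linear_sum.
by apply: eq_bigr => i _; rewrite /= -!kapE.
Qed.

Lemma btens_lift (W : vectType k) (b : Y -> M -> W) :
  (forall x, linear (fun y => b y x)) -> (forall y, linear (b y)) ->
  (forall d x y, b (ract Y d y) x = b y (mact M d x)) ->
  exists H : 'Hom(btens Y M, W), forall x y, H (kap x y) = b y x.
Proof.
move=> bl br bal; have [h [hE _]] := tens_universal bl br.
exists (h \o quot_repr (balanced_rel Y M))%VF => x y.
rewrite comp_lfunE kapE -hE; apply/eqP; rewrite -subr_eq0 -linearB /=.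
have := quot_piK (balanced_rel Y M) (tens y x); rewrite -opprB rpredN.
set s := _ - _; case/memv_sumP=> u uP ->; rewrite linear_sum big1 // => i _ /=.
have /memv_imgP[t _ ->] := uP i isT.
suff E : (h \o balancing Y M (vbasis {:B})`_i)%VF = 0 by rewrite -comp_lfunE E zero_lfunE.
apply/lfunP => z; rewrite zero_lfunE (tens_decomp z) linear_sum big1 // => j _.
rewrite /= comp_lfunE add_lfunE opp_lfunE !tens_map_tens !id_lfunE linearB /= !hE.
by rewrite bal subrr.
Qed.

End BalancedMaps.

Section RightModules.
Variables (k : fieldType) (B : falgType k).

Section HomRight.
Variables (V : vectType k) (M : rmod B).
Definition hom_ract (b : B) : 'End('Hom(V, M)) := sandwich (ract M b) \1%VF.
Lemma hom_ractE b u : hom_ract b u = (ract M b \o u)%VF.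
Proof. by rewrite sandwichE comp_lfun1r. Qed.
Fact hom_ract_linear : linear hom_ract.
Proof.
move=> c a b; apply/lfunP => u; rewrite add_lfunE scale_lfunE !hom_ractE linearP.
by rewrite comp_lfunDl comp_lfunZl.
Qed.
HB.instance Definition _ := GRing.isSemilinear.Build k _ _ _ hom_ract
  (GRing.semilinear_linear hom_ract_linear).
Fact hom_ract1 : hom_ract 1 = \1%VF.
Proof. by apply/lfunP => u; rewrite hom_ractE ract1 comp_lfun1l id_lfunE. Qed.
Fact hom_ractM a b : hom_ract (a * b) = (hom_ract b \o hom_ract a)%VF.
Proof. by apply/lfunP => u; rewrite comp_lfunE !hom_ractE ractM comp_lfunA. Qed.
Definition hom_rmod : rmod B := @RMod k B 'Hom(V, M) hom_ract hom_ract1 hom_ractM.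

(** [Hom(V, M)] is a direct sum of copies of [M], indexed by a basis of [V]. *)
Lemma projective_hom_rmod : projective_rmod M -> projective_rmod hom_rmod.
Proof.
move=> pM N L g f gr fr gs.
have colL (i : 'I_(\dim {:V})) : linear (fun m : M => rank1 m (dual_basis i) : 'Hom(V, M)).
  exact: rank1_linl.
have cE i m : lmap (colL i) m = rank1 m (dual_basis i) by apply: lmapE.
have /fin_all_exists[h hP] : forall i : 'I_(\dim {:V}), exists h : 'Hom(M, N),
    rlinear h /\ (g \o h)%VF = (f \o lmap (colL i))%VF.
  move=> i; have [|h hr hE] := pM N L g (f \o lmap (colL i))%VF gr _ gs; last by exists h.
  move=> b x; rewrite !comp_lfunE -fr !cE; congr (f _).
  by rewrite [RHS]hom_ractE comp_rank1.
have hL : linear (fun u : 'Hom(V, M) => \sum_i h i (u (basisv i))).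
  move=> c u w; rewrite scaler_sumr -big_split; apply: eq_bigr => i _.
  by rewrite /= add_lfunE scale_lfunE linearP.
have hE u : lmap hL u = \sum_i h i (u (basisv i)) by apply: lmapE.
exists (lmap hL).
  move=> b u; rewrite !hE linear_sum; apply: eq_bigr => i _ /=.
  by rewrite hom_ractE comp_lfunE (hP i).1.
apply/lfunP => u; rewrite comp_lfunE hE linear_sum /= [in RHS](rank1_sum u) linear_sum.
apply: eq_bigr => i _ /=; have /lfunP/(_ (u (basisv i))) := (hP i).2.
by rewrite !comp_lfunE cE.
Qed.
End HomRight.

Fact reg_ract1 : amulr (1 : B) = \1%VF.
Proof. by apply/lfunP => x; rewrite amulrE mulr1 id_lfunE. Qed.
Fact reg_ractM (a b : B) : amulr (a * b) = (amulr b \o amulr a)%VF.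
Proof. by apply/lfunP => x; rewrite comp_lfunE !amulrE mulrA. Qed.
Definition reg_rmod : rmod B := @RMod k B B (@amulr k B) reg_ract1 reg_ractM.

Section ScalarRight.
Variables (eps : 'Hom(B, k^o)) (X : vectType k).
Hypotheses (eps1 : eps 1 = 1 :> k)
  (epsM : forall a b, eps (a * b) = (eps a : k) * (eps b : k) :> k).
Definition scal_ract (b : B) : 'End(X) := (eps b : k) *: \1%VF.
Fact scal_ract_linear : linear scal_ract.
Proof. by move=> c a b; rewrite /scal_ract linearP scalerDl scalerA. Qed.
HB.instance Definition _ := GRing.isSemilinear.Build k _ _ _ scal_ract
  (GRing.semilinear_linear scal_ract_linear).
Fact scal_ract1 : scal_ract 1 = \1%VF.
Proof. by rewrite /scal_ract eps1 scale1r. Qed.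
Fact scal_ractM a b : scal_ract (a * b) = (scal_ract b \o scal_ract a)%VF.
Proof.
by rewrite /scal_ract epsM -comp_lfunZl comp_lfun1l scalerA mulrC.
Qed.
(** Right modules on which [B] acts through a character. *)
Definition scal_rmod : rmod B := @RMod k B X scal_ract scal_ract1 scal_ractM.
Lemma scal_ractE b x : ract scal_rmod b x = (eps b : k) *: x.
Proof. by rewrite /= scale_lfunE id_lfunE. Qed.
End ScalarRight.

End RightModules.

(** * Splitting Hom(V, Y) as a right module *)

Section HomSplitting.
Variables (p : nat) (P : finGroupType) (k : fieldType).
Hypotheses (pk : p \in [pchar k]) (pP : (p.-group [set: P])%g)
  (ntP : (1 < #|[set: P]|)%N).
Local Notation kP := (group_alg k P).
Variables (V : fdmod kP).
Hypotheses (scV : stably_scalar V) (dV : (\dim {:V})%:R != 0 :> k).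

(** Transport the splitting of [End(V)] into scalars and maps of trace zero along
    the stable isomorphism. *)
Lemma stiso_hom_splitting (Z : fdmod kP) : stiso V Z ->
  exists (i0 : 'Hom(V, Z)) (rf : 'Hom('Hom(V, Z), k^o)) (thb : 'End('Hom(V, Z))),
  rf i0 = 1 :> k /\ forall f, f = (rf f : k) *: i0 + gtr (hom_rep V Z) thb f.
Proof.
move=> [i0 [r0 [i0C r0C [zeta ri] [eta ir]]]].
have [psi _ psiE] := trace_complement pk pP ntP scV dV.
pose d := (\dim {:V})%:R : k.
have rfL : linear (fun f : 'Hom(V, Z) => d^-1 * ltr (r0 \o f)%VF : k^o).
  by move=> c f g; rewrite comp_lfunDr -comp_lfunZr ltrD ltrZ mulrDr mulrCA.
have thL : linear (fun f : 'Hom(V, Z) => ((i0 \o psi (r0 \o f)) - (eta \o f))%VF).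
  move=> c f g; rewrite !comp_lfunDr -!comp_lfunZr linearP comp_lfunDr -comp_lfunZr.
  by rewrite opprD addrACA scalerBr.
have rfE f : (lmap rfL f : k) = d^-1 * ltr (r0 \o f)%VF := lmapE rfL f.
have thE f : lmap thL f = ((i0 \o psi (r0 \o f)) - (eta \o f))%VF by apply: lmapE.
exists i0, (lmap rfL), (lmap thL); split.
  by rewrite rfE ri ltrD ltr1 (ltr_htr pk pP ntP) addr0 mulVf.
move=> f; rewrite rfE; set c := _ * _.
have E1 : (i0 \o (r0 \o f) = c *: i0 + (i0 \o gtr (hom_rep V V) psi (r0 \o f)))%VF.
  by rewrite {1}(psiE (r0 \o f)%VF) comp_lfunDr -comp_lfunZr comp_lfun1r.
have E2 : (i0 \o (r0 \o f) = f + (htr eta \o f))%VF.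
  by rewrite comp_lfunA ir comp_lfunDl comp_lfun1l.
have -> : gtr (hom_rep V Z) (lmap thL) f = ((i0 \o gtr (hom_rep V V) psi (r0 \o f)) - (htr eta \o f))%VF.
  rewrite !gtrE; apply/lfunP => v; rewrite add_lfunE opp_lfunE !comp_lfunE !sum_lfunE.
  rewrite linear_sum -sumrB; apply: eq_bigr => g _ /=.
  
  rewrite thE !hom_repE invgK !comp_lfunE add_lfunE opp_lfunE linearB /=.
  rewrite !comp_lfunE i0C rhoKV; congr (rho Z g (i0 (psi _ _)) - _).
  by apply/lfunP => w; rewrite !comp_lfunE r0C.
by rewrite addrA -E1 E2 addrK.
Qed.

End HomSplitting.

(** The setting is that of [U = Hom(V, Y)] and [Ub = Hom(V, Y ⊗ T) = U / U J],
    with the splitting of [Ub] given by [stiso_hom_splitting]. *)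
Section LiftSplitting.
Variables (k : fieldType) (P : finGroupType) (D : falgType k).
Variables (eps : 'Hom(D, k^o)) (N : nat).
Hypotheses (eps1 : eps 1 = 1 :> k)
  (epsM : forall a b, eps (a * b) = (eps a : k) * (eps b : k) :> k)
  (eps_unit : forall a, (eps a : k) <> 0 -> a \is a GRing.unit)
  (nilJ : lideal_pow (lker eps) N = 0%VS).
Variables (U : rmod D) (r : P -> 'End(U)) (Ub : vectType k) (rb : P -> 'End(Ub)).
Hypotheses (r1 : r 1%g = \1%VF) (rM : forall g h, r (g * h)%g = (r g \o r h)%VF).
Hypothesis projU : projective_rmod U.
Hypothesis r_ract : forall g b u, r g (ract U b u) = ract U b (r g u).
Variable pi : 'Hom(U, Ub).
Hypotheses (pi_rep : forall g u, pi (r g u) = rb g (pi u))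
  (pi_ract : forall b u, pi (ract U b u) = (eps b : k) *: pi u)
  (pi_surj : forall f, exists u, f = pi u).
Let nj := \dim (lker eps).
Let jb (l : 'I_nj) : D := (vbasis (lker eps))`_l.
Hypothesis pi_ker : forall u, pi u = 0 ->
  exists w : 'I_nj -> U, u = \sum_l ract U (jb l) (w l).
Variables (i0 : Ub) (rf : 'Hom(Ub, k^o)) (thb : 'End(Ub)).
Hypotheses (rf1 : rf i0 = 1 :> k)
  (splitb : forall f, f = (rf f : k) *: i0 + gtr rb thb f).

Let jbJ l : jb l \in lker eps.
Proof. by apply: vbasis_mem; rewrite mem_nth // size_tuple. Qed.

Definition right_linear (f : 'End(U)) : Prop :=
  forall b u, f (ract U b u) = ract U b (f u).

Lemma gtr_right_linear f : right_linear f -> right_linear (gtr r f).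
Proof.
move=> fR b u; rewrite !gtrE linear_sum; apply: eq_bigr => g _ /=.
by rewrite r_ract fR r_ract.
Qed.

(** Lift the relative trace [1 - i0 rf] of [Ub] to a right linear relative trace
    of [U], using that [U] is a projective right module.  Its complement [F]
    induces the idempotent [i0 rf], and so does the Fitting idempotent [e] of
    [F]; moreover [1 - e] is again a relative trace, since it is a multiple of
    [1 - F^m].  So [e U] is a direct summand with [e U / e U J] of dimension one,
    and it is free of rank one, generated by a lift [v0] of [i0]. *)
Lemma lift_splitting : exists (v0 : U) (q : 'Hom(U, D)) (theta : 'End(U)),
  [/\ right_linear theta, forall b u, q (ract U b u) = q u * b,
      q v0 = 1 & forall u, u = ract U (q u) v0 + gtr r theta u].
Proof.
have pifull : limg pi = fullv.
  apply/vspaceP => f; rewrite memvf; have [u ->] := pi_surj f.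
  by rewrite memv_img ?memvf.
have [||theta thR thE] := @projU U (scal_rmod Ub eps1 epsM) pi (thb \o pi)%VF _ _ pifull.
- by move=> b u; rewrite scal_ractE; apply: pi_ract.
- move=> b u; rewrite scal_ractE !comp_lfunE -linearZ; congr (thb _); exact: pi_ract.
pose F : 'End(U) := \1%VF - gtr r theta.
have FE u : F u = u - gtr r theta u by rewrite add_lfunE opp_lfunE id_lfunE.
have piF u : pi (F u) = (rf (pi u) : k) *: i0.
  rewrite FE linearB /= !gtrE linear_sum {1}(splitb (pi u)) gtrE.
  rewrite -addrA -[RHS]addr0; congr (_ + _); apply/eqP; rewrite subr_eq0; apply/eqP.
  apply: eq_bigr => g _ /=; rewrite pi_rep; congr (rb g _).
  by rewrite -pi_rep; have /lfunP/(_ (r g^-1 u)) := thE; rewrite !comp_lfunE => ->.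
have FR : right_linear F.
  by move=> b u; rewrite !FE (gtr_right_linear thR) [RHS]linearB.
have FC g u : F (r g u) = r g (F u) by rewrite !FE linearB /= (gtr_rep r1 rM).
clearbody F.
have [n [q0 [ee Fe]]] := fitting F.
set e := peval F _ in ee Fe.
have eR : right_linear e.
  move=> b u; have /lfunP/(_ u) : (ract U b \o e = e \o ract U b)%VF.
    apply: peval_comm; apply/lfunP => w; rewrite !comp_lfunE.
    by rewrite FR.
  by rewrite !comp_lfunE.
have eC g u : e (r g u) = r g (e u).
  have /lfunP/(_ u) : (r g \o e = e \o r g)%VF.
    by apply: peval_comm; apply/lfunP => w; rewrite !comp_lfunE FC.
  by rewrite !comp_lfunE.
have eF : (e \o lpow F n.+1 = lpow F n.+1)%VF.
  by rewrite -pevalXn -pevalM mulrC pevalM pevalXn.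
have powR m : right_linear (lpow F m).
  by move=> b u; rewrite !lpowE; elim: m => //= m ->; rewrite FR.
have powC m g u : lpow F m (r g u) = r g (lpow F m u).
  by rewrite !lpowE; elim: m => //= m ->; rewrite FC.
(* [e] induces a polynomial in the idempotent [rank1 i0 rf], with the same image *)
have pie u : pi (e u) = (rf (pi u) : k) *: i0.
  pose Fb := rank1 i0 rf.
  have piFb : (pi \o F = Fb \o pi)%VF.
    by apply/lfunP => w; rewrite !comp_lfunE rank1E piF.
  have FbFb : (Fb \o Fb = Fb)%VF.
    apply/lfunP => f; rewrite comp_lfunE !rank1E linearZ /=.
    by rewrite rf1; congr (_ *: _); apply: mulr1.
  have Fbm m : lpow Fb m.+1 = Fb.
    elim: m => [|m IH]; first by rewrite lpowS [lpow _ _]/(\1%VF) comp_lfun1r.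
    by rewrite lpowS IH.
  have pe : (pi \o e = peval Fb (q0 * 'X^(n.+1)) \o pi)%VF := peval_comm _ piFb.
  have eb1 : (Fb \o peval Fb (q0 * 'X^(n.+1)) = peval Fb (q0 * 'X^(n.+1)))%VF.
    by rewrite mulrC pevalM pevalXn Fbm comp_lfunA FbFb.
  have piFm : (pi \o lpow F n.+1 = Fb \o pi)%VF.
    by rewrite -pevalXn (peval_comm _ piFb) pevalXn Fbm.
  have : (pi \o lpow F n.+1 \o e = pi \o lpow F n.+1)%VF by rewrite -comp_lfunA Fe.
  rewrite !piFm -comp_lfunA pe comp_lfunA eb1 -pe => /lfunP/(_ u).
  by rewrite !comp_lfunE rank1E.
have epsfull : limg eps = fullv.
  apply/vspaceP => c; rewrite memvf; apply/memv_imgP; exists ((c : k) *: 1).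
    exact: memvf.
  by rewrite linearZ /= eps1; apply/esym/mulr1.
have [||q1 q1R q1E] := @projU (reg_rmod D) (scal_rmod k^o eps1 epsM) eps (rf \o pi)%VF _ _ epsfull.
- by move=> b x; rewrite scal_ractE [ract _ b x]amulrE epsM; apply: mulrC.
- by move=> b u; rewrite scal_ractE !comp_lfunE [X in rf X]pi_ract linearZ.
have q1M b u : q1 (ract U b u) = q1 u * b by rewrite [LHS]q1R amulrE.
have epsq u : eps (q1 u) = rf (pi u) by rewrite -[LHS]comp_lfunE q1E comp_lfunE.
have [v1 pv1] := pi_surj i0.
pose v0 := e v1; have piv0 : pi v0 = i0 by rewrite pie -pv1 rf1 scale1r.
have ev0 : e v0 = v0 by rewrite -[LHS]comp_lfunE ee.
(* the coordinate of [v0] is [1] modulo the radical *)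
have unitq : q1 v0 \is a GRing.unit.
  by apply: eps_unit; rewrite epsq piv0 rf1; apply/eqP; exact: oner_neq0.
have qL : linear (fun u : U => (q1 v0)^-1 * q1 (e u)).
  by move=> c u w; rewrite !linearP mulrDr scalerAr.
pose q := lmap qL; have qE u : q u = (q1 v0)^-1 * q1 (e u) by apply: lmapE.
clearbody q.
have qR b u : q (ract U b u) = q u * b by rewrite !qE eR q1M mulrA.
have qv0 : q v0 = 1 by rewrite qE ev0 mulVr.
have epsqq u : (eps (q u) : k) = (rf (pi u) : k).
  have invE : (eps (q1 v0)^-1 : k) = 1.
    have E : (eps (q1 v0) : k) = 1 by rewrite epsq piv0.
    have := epsM (q1 v0)^-1 (q1 v0); rewrite mulVr // eps1 E => ->.
    exact/esym/mulr1.
  rewrite qE epsM invE mul1r epsq pie linearZ /= rf1; exact: mulr1.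
(* [kp] is an idempotent endomorphism of [U] with values in [U J], so it vanishes
   because [J] is nilpotent *)
pose kp u := e u - ract U (q u) v0.
have kpR b u : kp (ract U b u) = ract U b (kp u).
  by rewrite /kp eR qR linearB /= ractM comp_lfunE.
have kp_sum (I : finType) (w : I -> U) : kp (\sum_i w i) = \sum_i kp (w i).
  by rewrite /kp !linear_sum /= sum_lfunE -sumrB.
have kpK u : kp (kp u) = kp u.
  rewrite {2}/kp; have kpB x y : kp (x - y) = kp x - kp y.
    have sw (a b c d : U) : a - b - (c - d) = a - c - (b - d).
      by rewrite !opprB addrACA [RHS]addrACA [- b - c]addrC.
    by rewrite /kp (linearB e) (linearB q) (linearB (ract U)) /= add_lfunE opp_lfunE sw.
  rewrite kpB kpR; have -> : kp v0 = 0 by rewrite /kp ev0 qv0 ract1 id_lfunE subrr.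
  rewrite linear0 subr0 /kp -[e (e u)]comp_lfunE ee.
  congr (_ - ract U _ v0); by rewrite !qE -[e (e u)]comp_lfunE ee.
have pikp u : pi (kp u) = 0.
  by rewrite /kp linearB /= pie pi_ract piv0 epsqq subrr.
(* if [J^(m + 1)] annihilates the image of [kp] then so does [J^m] *)
have kp0 u : kp u = 0.
  have kill m z : (m <= N)%N -> z \in lideal_pow (lker eps) (N - m) ->
      forall w, ract U z (kp w) = 0.
    elim: m z => [|m IH] z.
      rewrite subn0 nilJ memv0 => _ /eqP -> w.
      by rewrite linear0 zero_lfunE.
    move=> ltm zJ w; have [x xE] := pi_ker (pikp w).
    rewrite -kpK xE kp_sum linear_sum big1 // => l _ /=.
    rewrite kpR -comp_lfunE -ractM IH //; first exact: ltnW.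
    by rewrite -(subnSK ltm); apply: memv_mul => //; apply: jbJ.
  have := kill N 1 (leqnn N); rewrite subnn => /(_ (memvf _) u).
  by rewrite ract1 id_lfunE.
have [th' th'R thE'] : exists2 th, right_linear th & \1%VF - lpow F n.+1 = gtr r th.
  elim: n.+1 => [|m [th thR0 IH]].
    exists 0; first by move=> b u; rewrite !zero_lfunE linear0.
    by rewrite subrr; apply/lfunP => u; rewrite gtrE zero_lfunE big1 // => g _;
       rewrite zero_lfunE linear0.
  exists (th + (lpow F m \o theta))%VF.
    by move=> b u; rewrite !add_lfunE !comp_lfunE thR0 [theta _]thR powR linearD.
  rewrite -[th]scale1r gtr_linear scale1r -IH -gtr_compl //.
  rewrite lpowSr; apply/lfunP => u.
  rewrite !(add_lfunE, opp_lfunE) !comp_lfunE FE (linearB (lpow F m)) /=.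
  by rewrite opprB addrA addrAC.
have e1R : right_linear (\1 - e)%VF.
  by move=> b u; rewrite !add_lfunE !opp_lfunE !id_lfunE eR linearB.
have e1C g u : (\1 - e)%VF (r g u) = r g ((\1 - e)%VF u).
  by rewrite !add_lfunE !opp_lfunE !id_lfunE eC linearB.
exists v0, q, ((\1 - e) \o th')%VF; split=> // [b u|u].
  by rewrite !comp_lfunE th'R e1R.
rewrite -gtr_compl // -thE' comp_lfunDr comp_lfun1r comp_lfunNr comp_lfunDl.
rewrite comp_lfun1l comp_lfunNl eF subrr subr0 add_lfunE opp_lfunE id_lfunE.
have := kp0 u; rewrite /kp => /eqP; rewrite subr_eq0 => /eqP <-.
by rewrite addrC subrK.
Qed.

End LiftSplitting.

Section BimoduleSplitting.
Variables (p : nat) (P : finGroupType) (k : fieldType) (D : falgType k).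
Hypotheses (pk : p \in [pchar k]) (pP : (p.-group [set: P])%g)
  (ntP : (1 < #|[set: P]|)%N).
Local Notation kP := (group_alg k P).
Variables (V : fdmod kP) (Y : bimod kP D).
Hypotheses (scV : stably_scalar V) (dV : (\dim {:V})%:R != 0 :> k).
Hypothesis projY : projective_rmod (bi_right Y).
Variables (T : fdmod D) (t : T) (eps : 'Hom(D, k^o)) (N : nat).
Hypotheses (t0 : t != 0) (genT : forall x : T, exists c : k, x = c *: t)
  (epsT : forall a (x : T), mact T a x = (eps a : k) *: x)
  (eps1 : eps 1 = 1 :> k)
  (epsM : forall a b, eps (a * b) = (eps a : k) * (eps b : k) :> k)
  (eps_unit : forall a, (eps a : k) <> 0 -> a \is a GRing.unit)
  (nilJ : lideal_pow (lker eps) N = 0%VS).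

Definition bimod_left : fdmod kP := @FdMod k kP Y (lact Y) (lact1 Y) (lactM Y).

Local Notation Z := (btens_mod Y T).
Local Notation U := ('Hom(V, bimod_left)).
Local Notation Ub := ('Hom(V, Z)).
Local Notation r := (hom_rep V bimod_left).
Local Notation rb := (hom_rep V Z).

Hypothesis isoV : stiso V Z.

Let r1 : r 1%g = \1%VF := hom_rep1 V bimod_left.
Let rM : forall g h, r (g * h)%g = (r g \o r h)%VF := @hom_repM _ _ V bimod_left.

(** The two actions on [Hom(V, Y)] commute as those on [Y] do. *)
Lemma hom_rep_ract g b u : r g (hom_ract V Y b u) = hom_ract V Y b (r g u).
Proof.
rewrite !hom_repE !hom_ractE; apply/lfunP => v; rewrite !comp_lfunE.
by have /lfunP/(_ (u (rho V g^-1 v))) := lactC Y (galg_elt k g) b; rewrite !comp_lfunE.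
Qed.

Lemma hom_act_hom_ract x b u : mact (hom_mod V bimod_left) x (hom_ract V Y b u) =
  hom_ract V Y b (mact (hom_mod V bimod_left) x u).
Proof.
rewrite !(@mact_rho k P) !sum_lfunE linear_sum; apply: eq_bigr => g _ /=.
by rewrite !scale_lfunE linearZ /= !rho_rep_mod hom_rep_ract.
Qed.

Let kt : 'Hom(bimod_left, Z) := kap Y t.
Let pi : 'Hom(U, Ub) := sandwich kt \1%VF.

Let piE u : pi u = (kt \o u)%VF.
Proof. by rewrite sandwichE comp_lfun1r. Qed.

Let ktC g y : kt (rho bimod_left g y) = rho Z g (kt y).
Proof. by rewrite [RHS]kap_act. Qed.

Let pi_rep g u : pi (r g u) = rb g (pi u).
Proof.
have kC : (kt \o rho bimod_left g = rho Z g \o kt)%VF.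
  by apply/lfunP => y; rewrite comp_lfunE ktC [RHS]comp_lfunE.
by rewrite !piE !hom_repE !comp_lfunA kC.
Qed.

Let kt_ract b y : kt (ract Y b y) = (eps b : k) *: kt y.
Proof.
rewrite [LHS]kap_balanced epsT.
have L : linear (fun x : T => kap Y x y).
  by move=> c x x'; rewrite kap_is_linear add_lfunE scale_lfunE.
by rewrite -(lmapE L) linearZ /= lmapE.
Qed.

Let pi_ract b u : pi (hom_ract V Y b u) = (eps b : k) *: pi u.
Proof.
rewrite !piE hom_ractE; apply/lfunP => v; rewrite scale_lfunE !comp_lfunE.
exact: kt_ract.
Qed.

Let kt_surj z : exists y, z = kt y.
Proof.
have kapZ (c : k) (y : Y) : kap Y (c *: t) y = kt (c *: y).
  have L : linear (fun x : T => kap Y x y).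
    by move=> d x x'; rewrite kap_is_linear add_lfunE scale_lfunE.
  by rewrite -(lmapE L) linearZ /= lmapE linearZ.
have : z \in limg kt; last by case/memv_imgP=> y _ ->; exists y.
rewrite -(quot_reprK z) (tens_decomp (quot_repr (balanced_rel Y T) z)) linear_sum.
apply: memv_suml => i _ /=; rewrite -kapE.
have [c ->] := genT (quot_repr (balanced_rel Y T) z (dual_basis i)).
by rewrite kapZ memv_img ?memvf.
Qed.

Let pi_surj f : exists u, f = pi u.
Proof.
have ks z : kt (kt^-1%VF z) = z.
  by apply: limg_lfunVK; have [y ->] := kt_surj z; rewrite memv_img ?memvf.
exists (kt^-1 \o f)%VF; rewrite piE; apply/lfunP => v; rewrite !comp_lfunE.
by rewrite ks.
Qed.

Let nj := \dim (lker eps).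
Let jb (l : 'I_nj) : D := (vbasis (lker eps))`_l.
Let jbJ l : jb l \in lker eps.
Proof. by apply: vbasis_mem; rewrite mem_nth // size_tuple. Qed.

(** [Y ⊗ T = Y / Y J], since [T] is the quotient of [D] by [J]. *)
Let kt_ker y : kt y = 0 -> exists w : 'I_nj -> Y, y = \sum_l ract Y (jb l) (w l).
Proof.
pose YJ : {vspace Y} := (\sum_l limg (ract Y (jb l)))%VS.
have YJP z : z \in YJ -> exists w : 'I_nj -> Y, z = \sum_l ract Y (jb l) (w l).
  case/memv_sumP=> v vP ->.
  have /fin_all_exists[w wP] : forall l : 'I_nj, exists w, v l = ract Y (jb l) w.
    by move=> l; have /memv_imgP[w _ ->] := vP l isT; exists w.
  by exists w; apply: eq_bigr => l _; apply: wP.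
have inYJ a z : a \in lker eps -> ract Y a z \in YJ.
  move=> aJ; rewrite (coord_vbasis aJ) linear_sum sum_lfunE; apply: memv_sumr => l _.
  by rewrite /= linearZ scale_lfunE memvZ // memv_img ?memvf.
have [i ti] := exists_dual_neq0 t0.
pose phi : 'Hom(T, k^o) := (dual_basis i t : k)^-1 *: dual_basis i.
have phit : phi t = 1 :> k by rewrite scale_lfunE; apply: mulVf.
pose b (y : Y) (x : T) := quot_pi YJ ((phi x : k) *: y).
have [|||H HE] := @btens_lift _ _ _ Y T _ b.
- by move=> x c z z'; rewrite /b scalerDr scalerA mulrC -scalerA linearP.
- by move=> z c x x'; rewrite /b linearP scalerDl -scalerA linearP.
- move=> d x z; rewrite /b; apply: quot_pi_congr.
  have -> : phi (mact T d x) = (eps d : k) * (phi x : k) :> k by rewrite epsT linearZ.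
  rewrite mulrC -scalerA -scalerBr.
  apply: memvZ.
  have -> : ract Y d z - (eps d : k) *: z = ract Y (d - (eps d : k) *: 1) z.
    rewrite [ract Y (d - _)]linearB [ract Y (_ *: 1)]linearZ /= ract1.
    rewrite add_lfunE opp_lfunE scale_lfunE id_lfunE.
    by [].
  apply: inYJ; rewrite memv_ker linearB linearZ /= eps1.
  by rewrite [_ *: _]mulr1 subrr.
move=> yt; apply: YJP; rewrite -quot_pi_eq0.
have := HE t y; rewrite -/kt yt linear0 /b phit scale1r => <-.
exact: eqxx.
Qed.

Let pi_ker u : pi u = 0 -> exists w : 'I_nj -> U, u = \sum_l hom_ract V Y (jb l) (w l).
Proof.
move=> pu; have /fin_all_exists[w wP] : forall i : 'I_(\dim {:V}),
    exists w : 'I_nj -> Y, u (basisv i) = \sum_l ract Y (jb l) (w l).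
  move=> i; apply: kt_ker; move: pu; rewrite piE => /lfunP/(_ (basisv i)).
  by rewrite comp_lfunE zero_lfunE.
exists (fun l => \sum_i rank1 (w i l : bimod_left) (dual_basis i)).
rewrite {1}(rank1_sum u).
transitivity (\sum_i \sum_l hom_ract V Y (jb l) (rank1 (w i l : bimod_left) (dual_basis i))).
  apply: eq_bigr => i _; rewrite wP.
  apply/lfunP => v; rewrite rank1E sum_lfunE scaler_sumr; apply: eq_bigr => l _.
  by rewrite hom_ractE comp_lfunE rank1E linearZ.
by rewrite exchange_big; apply: eq_bigr => l _; rewrite linear_sum.
Qed.

(** As a right module with action of [P], [Hom(V, Y)] is the sum of a free right
    module of rank one and a module on which the identity is a relative trace. *)
Lemma bimodule_splitting : exists (v0 : U) (q : 'Hom(U, D)) (theta : 'End(U)),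
  [/\ forall b u, theta (hom_ract V Y b u) = hom_ract V Y b (theta u),
      forall b u, q (hom_ract V Y b u) = q u * b,
      q v0 = 1 & forall u, u = hom_ract V Y (q u) v0 + gtr r theta u].
Proof.
have [i0 [rf [thb [rf1 splitb]]]] := stiso_hom_splitting pk pP ntP scV dV isoV.
exact: (@lift_splitting k P D eps N eps1 epsM eps_unit nilJ (hom_rmod V Y) r Ub rb r1 rM
  (projective_hom_rmod projY) hom_rep_ract pi pi_rep pi_ract pi_surj pi_ker i0 rf thb rf1 splitb).
Qed.

End BimoduleSplitting.

(** * The functor Hom(V, -) *)

Section HomFunctor.
Variables (k : fieldType) (P : finGroupType).
Local Notation kP := (group_alg k P).
Implicit Types U V W Z : fdmod kP.

Lemma postcomp_equivariant U V W (f : 'Hom(V, W)) : equivariant f ->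
  equivariant (sandwich f \1%VF : 'Hom(hom_mod U V, hom_mod U W)).
Proof.
move=> fC g u; rewrite !sandwichE !comp_lfun1r !rho_hom; apply/lfunP => v.
by rewrite !comp_lfunE fC.
Qed.

Lemma postcomp_htr U V W (theta : 'Hom(V, W)) :
  sandwich (htr theta) \1%VF =
  htr (sandwich theta \1%VF : 'Hom(hom_mod U V, hom_mod U W)).
Proof.
apply/lfunP => u; rewrite sandwichE comp_lfun1r.
rewrite [RHS](@htrE _ _ (hom_mod U V) (hom_mod U W)); apply/lfunP => v.
rewrite comp_lfunE htrE sum_lfunE; apply: eq_bigr => g _.
by rewrite rho_hom sandwichE comp_lfun1r rho_hom invgK !comp_lfunE rhoKV.
Qed.

Lemma postcomp_linear U V W : linear (fun f : 'Hom(V, W) => sandwich f (\1%VF : 'End(U))).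
Proof.
move=> c f g; apply/lfunP => u; rewrite add_lfunE scale_lfunE !sandwichE !comp_lfun1r.
by rewrite comp_lfunDl comp_lfunZl.
Qed.

Lemma postcomp_comp U V W Z (g : 'Hom(W, Z)) (f : 'Hom(V, W)) :
  sandwich (g \o f) (\1%VF : 'End(U)) = (sandwich g \1 \o sandwich f \1)%VF.
Proof. by apply/lfunP => u; rewrite comp_lfunE !sandwichE !comp_lfun1r comp_lfunA. Qed.

Lemma postcomp1 U V : sandwich (\1%VF : 'End(V)) (\1%VF : 'End(U)) = \1%VF.
Proof. by apply/lfunP => u; rewrite sandwichE comp_lfun1r comp_lfun1l id_lfunE. Qed.

Lemma postcomp_steq U V W (f f' : 'Hom(V, W)) : steq f f' ->
  steq (sandwich f \1%VF : 'Hom(hom_mod U V, hom_mod U W)) (sandwich f' \1%VF).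
Proof.
move=> [theta ->]; exists (sandwich theta \1%VF); rewrite -postcomp_htr.
by rewrite -{1}[f']scale1r postcomp_linear scale1r.
Qed.

Lemma hom_stiso U V W : stiso V W -> stiso (hom_mod U V) (hom_mod U W).
Proof.
move=> [f [g [fC gC gf fg]]].
exists (sandwich f \1%VF), (sandwich g \1%VF); split; try exact: postcomp_equivariant.
  by rewrite -postcomp_comp -postcomp1; apply: postcomp_steq.
by rewrite -postcomp_comp -postcomp1; apply: postcomp_steq.
Qed.

(** The two modules have the same carrier, by the construction of the tensor
    product. *)
Lemma tens_hom_stiso V W : stiso (tens_mod V W) (hom_mod (dual_mod V) W).
Proof.
have E g (t : tens_mod V W) : rho (hom_mod (dual_mod V) W) g t = rho (tens_mod V W) g t.
  by rewrite rho_tens rho_rep_mod.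
apply: (@stiso_refl_eq _ _ (tens_mod V W) (hom_mod (dual_mod V) W) \1%VF \1%VF).
- by move=> g t; rewrite !id_lfunE E.
- by move=> g t; rewrite !id_lfunE -E.
- exact: comp_lfun1l.
- exact: comp_lfun1l.
Qed.

Lemma tens_stiso V W Z : stiso W Z -> stiso (tens_mod V W) (tens_mod V Z).
Proof.
move=> WZ; apply: stiso_trans (tens_hom_stiso V W) _.
apply: stiso_trans (hom_stiso (dual_mod V) WZ) _.
exact: stiso_sym (tens_hom_stiso V Z).
Qed.

Section Curry.
Variables V Z : fdmod kP.

Fact curry_inner_linear (s : 'Hom('End(V), Z)) (phi : dualv V) :
  linear (fun v => s (rank1 v phi)).
Proof. by move=> c v w; rewrite rank1_linl linearP. Qed.
Fact curry_outer_linear (s : 'Hom('End(V), Z)) :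
  linear (fun phi => lmap (curry_inner_linear s phi)).
Proof.
move=> c phi psi; apply/lfunP => v; rewrite add_lfunE scale_lfunE !lmapE.
by rewrite rank1_linr linearP.
Qed.
Fact curry_linear : linear (fun s => lmap (curry_outer_linear s)).
Proof.
have E s phi v : lmap (curry_outer_linear s) phi v = s (rank1 v phi) by rewrite !lmapE.
move=> c s s'; apply/lfunP => phi; apply/lfunP => v.
by rewrite !(add_lfunE, scale_lfunE) !E !(add_lfunE, scale_lfunE).
Qed.
(** The isomorphism [Hom(V ⊗ V^*, Z) = Hom(V^*, Hom(V, Z))]. *)
Definition curry : 'Hom(hom_mod (hom_mod V V) Z, hom_mod (dual_mod V) (hom_mod V Z)) :=
  lmap curry_linear.

Lemma curryE s phi v : curry s phi v = s (rank1 v phi).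
Proof. by rewrite !lmapE. Qed.

Fact uncurry_inner_linear (t : 'Hom(dualv V, 'Hom(V, Z))) :
  linear (fun f : 'End(V) => \sum_i t (dual_basis i \o f)%VF (basisv i)).
Proof.
move=> c f g; rewrite scaler_sumr -big_split; apply: eq_bigr => i _ /=.
by rewrite comp_lfunDr -comp_lfunZr linearP add_lfunE scale_lfunE.
Qed.
Fact uncurry_linear : linear (fun t => lmap (uncurry_inner_linear t)).
Proof.
move=> c t t'; apply/lfunP => f; rewrite add_lfunE scale_lfunE !lmapE.
rewrite scaler_sumr -big_split; apply: eq_bigr => i _ /=.
by rewrite !add_lfunE !scale_lfunE.
Qed.
Definition uncurry : 'Hom(hom_mod (dual_mod V) (hom_mod V Z), hom_mod (hom_mod V V) Z) :=
  lmap uncurry_linear.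

Lemma uncurryE (t : 'Hom(dualv V, 'Hom(V, Z))) f : uncurry t f = \sum_i t (dual_basis i \o f)%VF (basisv i).
Proof. by rewrite !lmapE. Qed.

Lemma curryK : (uncurry \o curry = \1)%VF.
Proof.
apply/lfunP => s; rewrite comp_lfunE id_lfunE; apply/lfunP => f; rewrite uncurryE.
have {2}-> : f = \sum_i rank1 (basisv i) (dual_basis i \o f)%VF.
  by apply/lfunP => v; rewrite sum_lfunE [LHS]basisv_sum; apply: eq_bigr => i _;
     rewrite rank1E comp_lfunE.
by rewrite linear_sum; apply: eq_bigr => i _; rewrite curryE.
Qed.

Lemma uncurryK : (curry \o uncurry = \1)%VF.
Proof.
apply/lfunP => t; rewrite comp_lfunE id_lfunE; apply/lfunP => phi; apply/lfunP => v.
rewrite curryE uncurryE {2}(basisv_sum v) linear_sum; apply: eq_bigr => i _ /=.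
rewrite linearZ /= -scale_lfunE -linearZ; congr (t _ _).
by rewrite comp_rank1; apply/lfunP => w; rewrite rank1E scale_lfunE; apply: mulrC.
Qed.

Lemma curry_equivariant : equivariant curry.
Proof.
move=> g s; apply/lfunP => phi; apply/lfunP => v.
rewrite curryE !rho_hom !comp_lfunE [in RHS]rho_hom !comp_lfunE curryE.
congr (rho Z g (s _)); rewrite rho_hom invgK; apply/lfunP => w.
rewrite !comp_lfunE !rank1E linearZ; congr (_ *: _).
by rewrite rho_dual !invgK dual_mapE comp_lfunE.
Qed.

Lemma uncurry_equivariant : equivariant uncurry.
Proof.
move=> g t; have ck s : uncurry (curry s) = s by rewrite -comp_lfunE curryK id_lfunE.
have {1}-> : t = curry (uncurry t) by rewrite -comp_lfunE uncurryK id_lfunE.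
by rewrite -curry_equivariant ck.
Qed.

End Curry.

End HomFunctor.

(** * Hom(V, -) as a stable equivalence *)

Lemma steq_equivariant (k : fieldType) (P : finGroupType)
    (U V : fdmod (group_alg k P)) (f g : 'Hom(U, V)) :
  steq f g -> equivariant g -> equivariant f.
Proof.
move=> [theta ->] gC h x; rewrite !add_lfunE gC htr_rho.
by rewrite linearD.
Qed.

Section StableInverse.
Variables (p : nat) (P : finGroupType) (k : fieldType).
Hypotheses (pk : p \in [pchar k]) (pP : (p.-group [set: P])%g)
  (ntP : (1 < #|[set: P]|)%N).
Local Notation kP := (group_alg k P).
Variable V : fdmod kP.
Hypotheses (scV : stably_scalar V) (dV : (\dim {:V})%:R != 0 :> k).
Implicit Types Z : fdmod kP.
Let d := (\dim {:V})%:R : k.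

Let lt : 'Hom('End(V), k^o) := lmap (@ltr_linear k V).
Let ltE f : (lt f : k) = ltr f := lmapE (@ltr_linear k V) f.

Fact hom_unit_linear Z : linear (fun z : Z => rank1 z lt).
Proof. exact: rank1_linl. Qed.
(** The maps [z |-> (f |-> tr(f) z)] and [s |-> s(1) / dim V] between [Z] and
    [Hom(End V, Z)]. *)
Definition hom_unit Z : 'Hom(Z, hom_mod (hom_mod V V) Z) := lmap (@hom_unit_linear Z).
Lemma hom_unitE Z z f : hom_unit Z z f = ltr f *: z.
Proof. by rewrite lmapE rank1E ltE. Qed.

Fact hom_counit_linear Z : linear (fun s : 'Hom('End(V), Z) => d^-1 *: s \1%VF).
Proof. by move=> c s s'; rewrite add_lfunE scale_lfunE scalerDr !scalerA mulrC. Qed.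
Definition hom_counit Z : 'Hom(hom_mod (hom_mod V V) Z, Z) := lmap (@hom_counit_linear Z).
Lemma hom_counitE Z (s : 'Hom('End(V), Z)) : hom_counit Z s = d^-1 *: s \1%VF.
Proof. exact: lmapE. Qed.

Lemma hom_unit_equivariant Z : equivariant (hom_unit Z).
Proof.
move=> g z; apply/lfunP => f; rewrite rho_hom !comp_lfunE !hom_unitE linearZ /=.
congr (_ *: _); rewrite rho_hom invgK.
by rewrite ltrC comp_lfunA -rhoM mulgV rho1 comp_lfun1l.
Qed.

Lemma hom_counit_equivariant Z : equivariant (hom_counit Z).
Proof.
move=> g s; rewrite !hom_counitE linearZ rho_hom !comp_lfunE; congr (_ *: rho Z g (s _)).
by rewrite rho_hom invgK comp_lfun1r -rhoM mulVg rho1.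
Qed.

Lemma hom_unitK Z : (hom_counit Z \o hom_unit Z = \1)%VF.
Proof.
apply/lfunP => z; rewrite comp_lfunE id_lfunE hom_counitE hom_unitE ltr1.
by rewrite scalerA mulVf ?scale1r.
Qed.

(** [End V] is the sum of the scalars and a projective module. *)
Lemma hom_end_stiso Z : stiso Z (hom_mod (hom_mod V V) Z).
Proof.
exists (hom_unit Z), (hom_counit Z); split.
- exact: hom_unit_equivariant.
- exact: hom_counit_equivariant.
- by rewrite hom_unitK; apply: steq_refl.
have [psi _ psiE] := trace_complement pk pP ntP scV dV.
apply: steq_sym; exists (sandwich \1%VF psi : 'End(hom_mod (hom_mod V V) Z)).
have RH g (s : 'Hom('End(V), Z)) f : rho (hom_mod (hom_mod V V) Z) g s f =
    rho Z g (s (hom_rep V V g^-1%g f)).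
  rewrite (@rho_hom _ _ (hom_mod V V) Z) !comp_lfunE.
  by rewrite rho_rep_mod.
have SE (s : 'Hom('End(V), Z)) f : sandwich (\1%VF : 'End(Z)) psi s f = s (psi f).
  by rewrite sandwichE comp_lfun1l comp_lfunE.
apply/lfunP => s; rewrite id_lfunE add_lfunE comp_lfunE; apply/lfunP => f.
rewrite add_lfunE hom_unitE hom_counitE {1}(psiE f) linearD linearZ /= scalerA mulrC.
congr (_ + _).
rewrite [in RHS](@htrE _ _ (hom_mod (hom_mod V V) Z) (hom_mod (hom_mod V V) Z)).
rewrite gtrE linear_sum sum_lfunE; apply: eq_bigr => g _ /=.
by rewrite RH SE RH invgK rhoKV.
Qed.

Lemma hom_dual_hom_stiso Z : stiso (hom_mod (dual_mod V) (hom_mod V Z)) Z.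
Proof.
apply: stiso_trans (stiso_sym (hom_end_stiso Z)).
apply: (@stiso_refl_eq _ _ _ _ (uncurry V Z) (curry V Z)).
- exact: uncurry_equivariant.
- exact: curry_equivariant.
- exact: uncurryK.
- exact: curryK.
Qed.

(** [g] is recovered from [Hom(V, g)] by applying [Hom(V^*, -)] and composing
    with the natural maps from [Z] and to [Z']. *)
Lemma postcomp_stably_faithful Z Z' (g : 'Hom(Z, Z')) :
  steq (sandwich g \1%VF : 'Hom(hom_mod V Z, hom_mod V Z')) 0 -> steq g 0.
Proof.
move=> g0; pose H Z := hom_mod (dual_mod V) (hom_mod V Z).
pose A := (hom_counit Z' \o uncurry V Z')%VF; pose C := (curry V Z \o hom_unit Z)%VF.
pose B : 'Hom(H Z, H Z') := sandwich (sandwich g \1%VF) \1%VF.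
have AC : equivariant A.
  by apply: equivariant_comp; [exact: hom_counit_equivariant | exact: uncurry_equivariant].
have CC : equivariant C.
  by apply: equivariant_comp; [exact: curry_equivariant | exact: hom_unit_equivariant].
have B0 : steq B 0.
  have -> : 0 = sandwich (0 : 'Hom(hom_mod V Z, hom_mod V Z')) (\1%VF : 'End(dual_mod V)) :> 'Hom(H Z, H Z').
    by apply/lfunP => t; rewrite zero_lfunE sandwichE !comp_lfun0l.
  exact: (postcomp_steq (dual_mod V) g0).
have -> : g = (A \o (B \o C))%VF.
  apply/lfunP => z; rewrite !comp_lfunE hom_counitE uncurryE sandwichE.
  have E i : ((sandwich g \1 \o curry V Z (hom_unit Z z)) \o \1)%VF
      (dual_basis i \o \1)%VF (basisv i) = g z.
    rewrite comp_lfun1r comp_lfunE sandwichE !comp_lfun1r comp_lfunE curryE hom_unitE.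
    by rewrite ltr_rank1 dual_basisE eqxx scale1r.
  rewrite (eq_bigr (fun=> g z)) => [|i _]; last exact: E.
  by rewrite sumr_const card_ord -scaler_nat scalerA mulVf ?scale1r.
have -> : 0 = (A \o (0 \o C))%VF :> 'Hom(Z, Z') by rewrite comp_lfun0l comp_lfun0r.
have zC : equivariant (0 : 'Hom(H Z, H Z')) by move=> h x; rewrite !zero_lfunE linear0.
apply: steq_comp => //; [exact: equivariant_comp|exact: steq_refl|].
apply: steq_comp => //; last exact: steq_refl.
exact: steq_equivariant B0 zC.
Qed.

End StableInverse.

(** * The algebra morphism afforded by a splitting *)

Section SplittingCharacter.
Variables (P : finGroupType) (k : fieldType) (D : falgType k).
Local Notation kP := (group_alg k P).
Variables (V : fdmod kP) (Y : bimod kP D).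
Local Notation U := ('Hom(V, bimod_left Y)).
Local Notation HU := (hom_mod V (bimod_left Y)).
Local Notation r := (hom_rep V (bimod_left Y)).
Variables (v0 : U) (q : 'Hom(U, D)) (theta : 'End(U)).
Hypotheses (thR : forall b u, theta (hom_ract V Y b u) = hom_ract V Y b (theta u))
  (qR : forall b u, q (hom_ract V Y b u) = q u * b) (qv0 : q v0 = 1)
  (split : forall u, u = hom_ract V Y (q u) v0 + gtr r theta u).

(** The projection onto the free summand commutes with the group algebra, since
    the complementary projection is a relative trace. *)
Lemma act_split x u : mact HU x (hom_ract V Y (q u) v0) = hom_ract V Y (q (mact HU x u)) v0.
Proof.
have gE w : hom_ract V Y (q w) v0 = w - gtr r theta w.
  by rewrite {2}(split w) addrK.
rewrite !gE [mact HU x _]linearB; congr (_ - _).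
have aE w : mact HU x w = \sum_g galg_coef x g *: r g w.
  rewrite mact_rho sum_lfunE; apply: eq_bigr => g _.
  by rewrite scale_lfunE rho_rep_mod.
rewrite [LHS]aE [in RHS]aE [RHS]linear_sum; apply: eq_bigr => g _.
by rewrite [RHS]linearZ; congr (_ *: _); 
   rewrite [RHS](gtr_rep (hom_rep1 V (bimod_left Y)) (@hom_repM _ _ V (bimod_left Y))).
Qed.

Lemma q_act x u : q (mact HU x u) = q (mact HU x v0) * q u.
Proof.
have := congr1 q (act_split x u); rewrite hom_act_hom_ract !qR qv0 mul1r.
by move=> <-.
Qed.

Lemma act_v0 x : mact HU x v0 = hom_ract V Y (q (mact HU x v0)) v0.
Proof. by rewrite -act_split qv0 hom_ract1 id_lfunE. Qed.

(** The group algebra acts on the free summand [v0 D] by right linear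
    endomorphisms, that is, by left multiplications by elements of [D]. *)
Lemma splitting_morphism : exists alpha : {lrmorphism kP -> D},
  forall x, alpha x = q (mact HU x v0).
Proof.
pose a x := q (mact HU x v0).
have aL : linear a by move=> c x y; rewrite /a linearP add_lfunE scale_lfunE linearP.
have aM : monoid_morphism a.
  split=> [|x y]; first by rewrite /a mact1 id_lfunE.
  by rewrite /a mactM comp_lfunE q_act.
pose L := GRing.isSemilinear.Build k kP D _ a (GRing.semilinear_linear aL).
pose M := GRing.isMonoidMorphism.Build kP D a aM.
by exists (HB.pack a L M : {lrmorphism kP -> D}).
Qed.

Section Transport.
Variable alpha : {lrmorphism kP -> D}.
Hypothesis alphaE : forall x, alpha x = q (mact HU x v0).

Section Module.
Variable X : fdmod D.
Local Notation Z := (btens_mod Y X).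

(** [Hom(V, Y ⊗ X)] is the balanced product of [U] and [X], as one sees on a basis
    of [V]. *)
Lemma hom_btens_lift (W : vectType k) (b : U -> X -> W) :
  (forall x, linear (fun u => b u x)) -> (forall u, linear (b u)) ->
  (forall d x u, b (hom_ract V Y d u) x = b u (mact X d x)) ->
  exists H : 'Hom('Hom(V, Z), W), forall x u, H (kap Y x \o u)%VF = b u x.
Proof.
move=> bl br bal.
have /fin_all_exists[h hE] : forall i : 'I_(\dim {:V}), exists h : 'Hom(btens Y X, W),
    forall x y, h (kap Y x y) = b (rank1 (y : bimod_left Y) (dual_basis i)) x.
  move=> i; apply: (@btens_lift _ _ _ Y X W (fun y x => b (rank1 (y : bimod_left Y) (dual_basis i)) x)).
  - by move=> x c y z; rewrite rank1_linl bl.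
  - by move=> y; apply: br.
  - move=> d x y; rewrite -bal; congr (b _ x).
    by rewrite hom_ractE comp_rank1.
have HL : linear (fun f : 'Hom(V, Z) => \sum_i h i (f (basisv i))).
  move=> c f g; rewrite scaler_sumr -big_split; apply: eq_bigr => i _ /=.
  by rewrite add_lfunE scale_lfunE linearP.
exists (lmap HL) => x u; rewrite lmapE {2}(rank1_sum u).
have bS (I : finType) (F : I -> U) : b (\sum_i F i) x = \sum_i b (F i) x.
  rewrite -(lmapE (bl x)) linear_sum; apply: eq_bigr => i _.
  exact: (lmapE (bl x)).

by rewrite bS; apply: eq_bigr => i _; rewrite comp_lfunE hE.
Qed.

Lemma hom_btens_ext (W : vectType k) (f g : 'Hom('Hom(V, Z), W)) :
  (forall x (u : U), f (kap Y x \o u)%VF = g (kap Y x \o u)%VF) -> f = g.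
Proof.
move=> fg; apply/lfunP => h; rewrite (rank1_sum h) !linear_sum; apply: eq_bigr => i _ /=.
have L : linear (fun z : btens Y X => rank1 (z : Z) (dual_basis i) : 'Hom(V, Z)).
  exact: rank1_linl.
have E : (f \o lmap L = g \o lmap L)%VF.
  apply: btens_ext => x y; rewrite !comp_lfunE lmapE.
  by have := fg x (rank1 (y : bimod_left Y) (dual_basis i)); rewrite comp_rank1.
by have /lfunP/(_ (h (basisv i))) := E; rewrite !comp_lfunE lmapE.
Qed.

Fact splitting_in_linear : linear (fun x : X => (kap Y x \o v0)%VF : 'Hom(V, Z)).
Proof. by move=> c x y; rewrite kap_is_linear comp_lfunDl comp_lfunZl. Qed.
(** The map [x |-> v0 ⊗ x]. *)
Definition splitting_in : 'Hom(res_mod alpha X, hom_mod V Z) := lmap splitting_in_linear.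
Lemma splitting_inE x : splitting_in x = (kap Y x \o v0)%VF.
Proof. exact: lmapE. Qed.

Lemma rho_kap g x (u : U) : rho (hom_mod V Z) g (kap Y x \o u)%VF = (kap Y x \o r g u)%VF.
Proof.
rewrite rho_hom hom_repE !comp_lfunA; congr (_ \o _ \o _)%VF; apply/lfunP => y.
by rewrite [RHS]comp_lfunE -[RHS]kap_act [LHS]comp_lfunE.
Qed.

Lemma kap_ract d x (u : U) : (kap Y x \o hom_ract V Y d u)%VF = (kap Y (mact X d x) \o u)%VF.
Proof.
rewrite hom_ractE; apply/lfunP => v; rewrite !comp_lfunE.
exact: kap_balanced.
Qed.

Lemma splitting_in_equivariant : equivariant splitting_in.
Proof.
move=> g x; rewrite !splitting_inE rho_kap -[rho _ g x]/(mact X (alpha (galg_elt k g)) x).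
rewrite -kap_ract alphaE -act_v0; congr (_ \o _)%VF.
by rewrite -(rho_rep_mod (hom_rep1 V (bimod_left Y)) (@hom_repM _ _ V (bimod_left Y))).
Qed.

(** The splitting of [U] induces one of [Hom(V, Y ⊗ X) = U ⊗ X] with the summand
    [v0 D ⊗ X = X]; the projection onto the other summand is still a relative
    trace. *)
Lemma splitting_stiso : exists out : 'Hom(hom_mod V Z, res_mod alpha X),
  [/\ equivariant out, (out \o splitting_in = \1)%VF &
      steq (splitting_in \o out)%VF \1%VF].
Proof.
have [|||out outE] := @hom_btens_lift X (fun u x => mact X (q u) x).
- by move=> x c u w; rewrite !linearP add_lfunE scale_lfunE.
- by move=> u c x y; rewrite linearP.
- by move=> d x u; rewrite qR mactM comp_lfunE.
have [|||Th ThE] := @hom_btens_lift 'Hom(V, Z) (fun u x => (kap Y x \o theta u)%VF).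
- by move=> x c u w; rewrite linearP comp_lfunDr -comp_lfunZr.
- by move=> u c x y; rewrite kap_is_linear comp_lfunDl comp_lfunZl.
- by move=> d x u; rewrite thR kap_ract.
exists out; split.
- move=> g; suff /lfunP : (out \o rho (hom_mod V Z) g = rho (res_mod alpha X) g \o out)%VF.
    by move=> E f; have := E f; rewrite [RHS]comp_lfunE [LHS]comp_lfunE.
  apply: hom_btens_ext => x u; rewrite [LHS]comp_lfunE rho_kap outE [RHS]comp_lfunE outE.
  rewrite -[rho _ g _]/(mact X (alpha (galg_elt k g)) (mact X (q u) x)).
  rewrite alphaE -comp_lfunE -mactM -q_act; congr (mact X (q _) x).
  by rewrite -(rho_rep_mod (hom_rep1 V (bimod_left Y)) (@hom_repM _ _ V (bimod_left Y))).
- by apply/lfunP => x; rewrite comp_lfunE splitting_inE outE qv0 mact1.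
apply: steq_sym; exists (Th : 'End(hom_mod V Z)).
apply: hom_btens_ext => x u; rewrite id_lfunE add_lfunE comp_lfunE outE splitting_inE -kap_ract.
rewrite {1}(split u) comp_lfunDr; congr (_ + _).
rewrite [RHS](@htrE _ _ (hom_mod V Z) (hom_mod V Z)) gtrE; apply/lfunP => v.
rewrite comp_lfunE !sum_lfunE linear_sum; apply: eq_bigr => g _ /=.
by rewrite rho_kap ThE rho_kap comp_lfunE.
Qed.

End Module.

Lemma splitting_in_natural (X X' : fdmod D) (f : modhom X X') :
  (splitting_in X' \o f = sandwich (btens_hom Y f) \1 \o splitting_in X)%VF.
Proof.
apply/lfunP => x; rewrite !comp_lfunE !splitting_inE sandwichE comp_lfun1r.
suff E : kap Y (f x) = (btens_hom Y f \o kap Y x)%VF by rewrite E comp_lfunA.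
apply/lfunP => y; rewrite [RHS]comp_lfunE !kapE.
rewrite [RHS]btens_map_pi ?tens_map_tens ?id_lfunE //.
  exact: ends_compat1.
exact: hom_compat_hom.
Qed.

End Transport.
End SplittingCharacter.

(** * Modules over the dual numbers *)

Section TangentModule.
Variables (k : fieldType) (D : falgType k) (T : vectType k) (eps lam : 'Hom(D, k^o)).
Hypotheses (eps1 : eps 1 = 1 :> k)
  (epsM : forall a b, eps (a * b) = (eps a : k) * (eps b : k) :> k).
Hypotheses (lam1 : lam 1 = 0 :> k)
  (lamM : forall a b, lam (a * b) = (eps a : k) * (lam b : k) + (lam a : k) * (eps b : k) :> k).
Local Notation T2 := (T * T)%type.

Fact tangent_fun_linear a :
  linear (fun x : T2 => ((eps a : k) *: x.1 + (lam a : k) *: x.2, (eps a : k) *: x.2) : T2).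
Proof.
move=> c x y; congr pair => /=.
  by rewrite !scalerDr !scalerA ![c * _]mulrC addrACA.
by rewrite scalerDr !scalerA mulrC.
Qed.
Definition tangent_act (a : D) : 'End(T2) := lmap (tangent_fun_linear a).
Lemma tangent_actE a x : tangent_act a x =
  ((eps a : k) *: x.1 + (lam a : k) *: x.2, (eps a : k) *: x.2).
Proof. exact: lmapE. Qed.
Fact tangent_act_linear : linear tangent_act.
Proof.
have scD (f : 'Hom(D, k^o)) c a b (x : T) :
    (f (c *: a + b) : k) *: x = c *: ((f a : k) *: x) + (f b : k) *: x.
  by rewrite linearP scalerDl scalerA.
move=> c a b; apply/lfunP => x; rewrite add_lfunE scale_lfunE !tangent_actE.
by congr pair; rewrite /= !scD // scalerDr addrACA.
Qed.
HB.instance Definition _ := GRing.isSemilinear.Build k _ _ _ tangent_act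
  (GRing.semilinear_linear tangent_act_linear).
Fact tangent_act1 : tangent_act 1 = \1%VF.
Proof.
apply/lfunP => x; rewrite tangent_actE id_lfunE eps1 lam1 !scale1r scale0r addr0.
by case: x.
Qed.
Fact tangent_actM a b : tangent_act (a * b) = (tangent_act a \o tangent_act b)%VF.
Proof.
apply/lfunP => x; rewrite comp_lfunE !tangent_actE epsM lamM.
by congr pair; rewrite /= ?scalerDr !scalerA // scalerDl addrA.
Qed.
(** The restriction of the module [T ⊗ k[x]/(x^2)] along the morphism
    [d |-> eps d + lam d x], for a tangent vector [lam]. *)
Definition tangent_mod : fdmod D := @FdMod k D T2 tangent_act tangent_act1 tangent_actM.

Variable t : T.
Hypothesis genT : forall x : T, exists c : k, x = c *: t.
Variable d : D.
Hypotheses (d0 : eps d = 0 :> k) (ld : lam d != 0 :> k).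

(** Endomorphisms commute with [d], which acts as a multiple of [x]. *)
Lemma tangent_endE (f : modhom tangent_mod tangent_mod) :
  exists a b : k, forall x, f x = (a *: x.1 + b *: x.2, a *: x.2).
Proof.
pose e1 : T2 := (t, 0); pose e2 : T2 := (0, t).
have dE x : mact tangent_mod d x = ((lam d : k) *: x.2, 0).
  by rewrite [LHS]tangent_actE d0 !scale0r add0r.
have e1E : e1 = (lam d : k)^-1 *: mact tangent_mod d e2.
  rewrite dE; congr pair; last by rewrite /= scaler0.
  by rewrite /= scalerA mulVf // scale1r.
have fe1 : f e1 = ((f e2).2, 0).
  have fd : f (mact tangent_mod d e2) = ((lam d : k) *: (f e2).2, 0) by rewrite modhomP dE.
  rewrite e1E linearZ; apply: etrans (congr1 (GRing.scale _) fd) _.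
  congr pair; last by rewrite /= scaler0.
  by rewrite /= scalerA mulVf // scale1r.
have [b bE] := genT (f e2).1; have [a aE] := genT (f e2).2.
exists a, b => x; have [c cE] := genT x.1; have [c' c'E] := genT x.2.
have -> : x = c *: e1 + c' *: e2.
  by case: x cE c'E => x y /= -> ->; congr pair; rewrite /= scaler0 ?addr0 ?add0r.
have -> : f (c *: e1 + c' *: e2) = c *: f e1 + c' *: f e2 by rewrite linearP linearZ.
rewrite fe1; congr pair; rewrite /= ?scaler0 ?addr0 ?add0r.
  by rewrite aE bE !scalerA ![c * _]mulrC ![c' * _]mulrC.
by rewrite aE !scalerA mulrC.
Qed.

Lemma tangent_end_comm (f g : modhom tangent_mod tangent_mod) :
  modhom_comp f g = modhom_comp g f.
Proof.
have [a [b fE]] := tangent_endE f; have [a' [b' gE]] := tangent_endE g.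
apply: modhomE => x; rewrite !modcompE !fE !gE; congr pair => /=.
  rewrite !scalerDr !scalerA -!addrA [a' * a]mulrC; congr (_ + _).
  by rewrite addrC [b * a']mulrC [a * b']mulrC.
by rewrite !scalerA mulrC.
Qed.

End TangentModule.

(** * Generation modulo the square of the radical *)

Section GenerateModuloSquare.
Variables (k : fieldType) (D : falgType k) (J S : {vspace D}).
Hypotheses (Jl : (fullv * J <= J)%VS) (Jr : (J * fullv <= J)%VS).
Hypothesis SM : (S * S <= S)%VS.
Hypothesis SJ2 : (fullv <= S + lideal_pow J 2)%VS.

(** By induction [J^m] lies in [S + J^(m + 1)], since a product of [m] factors
    from [J] can be changed modulo [J^(m + 1)] into one of factors from [S]. *)
Lemma generate_mod_square N : lideal_pow J N = 0%VS -> S = fullv.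
Proof.
have powl m : (fullv * lideal_pow J m <= lideal_pow J m)%VS.
  case: m => [|m] /=; first exact: subvf.
  by rewrite prodvA; apply: prodvSl.
have pow2J : (lideal_pow J 2 <= J)%VS.
  by apply: subv_trans (prodvSr _ (subvf _)) Jr.
have step m : (lideal_pow J m <= S + lideal_pow J m.+1)%VS.
  elim: m => [|m IH].
    by apply: subv_trans SJ2 _; apply: addvS => //; apply: prodvSr; apply: subvf.
  apply/prodvP => u v uJ vm.
  have /memv_addP[s1 s1S [y1 y1J uE]] := subvP SJ2 u (memvf u).
  have /memv_addP[s2 s2S [y2 y2J vE]] := subvP IH v vm.
  have s1J : s1 \in J.
    have -> : s1 = u - y1 by rewrite uE addrK.
    by apply: memvB => //; apply: (subvP pow2J).
  have -> : u * v = s1 * s2 + (s1 * y2 + y1 * v).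
    by rewrite addrA -mulrDr -vE -mulrDl -uE.
  apply: memv_add; first by apply: (subvP SM); apply: memv_mul.
  apply: memvD; first exact: memv_mul.
  have sub : (lideal_pow J 2 * lideal_pow J m <= lideal_pow J m.+2)%VS.
    by rewrite /= -!prodvA; do 2!apply: prodvSr; apply: powl.
  by apply: (subvP sub); apply: memv_mul.
move=> JN; apply/eqP; rewrite eqEsubv subvf /=.
have all m : (fullv <= S + lideal_pow J m)%VS.
  elim: m => [|m IH]; first exact: addvSr.
  apply: subv_trans IH _; rewrite subv_add addvSl /=; exact: step.
by have := all N; rewrite JN addv0.
Qed.

End GenerateModuloSquare.

Section StableEndomorphisms.
Variables (P : finGroupType) (k : fieldType) (D : falgType k).
Local Notation kP := (group_alg k P).
Variable Phi : functor (modcat D) (stmod kP).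
Hypothesis PhiFull : full_functor Phi.

(** Conjugate with the isomorphism and lift along the full functor. *)
Lemma stable_end_comm (X : fdmod D) (W : fdmod kP) : stiso W (Phi X) ->
  (forall f g : modhom X X, modhom_comp f g = modhom_comp g f) ->
  forall u v : 'End(W), equivariant u -> equivariant v -> steq (u \o v)%VF (v \o u)%VF.
Proof.
move=> [i [j [iC jC ji _]]] comm.
pose tr (u : 'End(W)) : 'End(Phi X : fdmod kP) := (i \o u \o j)%VF.
have trC u : equivariant u -> equivariant (tr u).
  by move=> uC; do !apply: equivariant_comp.
have tr_comm u v : equivariant u -> equivariant v -> steq (tr u \o tr v)%VF (tr v \o tr u)%VF.
  move=> uC vC; have [f fE] := PhiFull (mkhom (trC u uC) : @hom k (stmod kP) (Phi X) (Phi X)).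
  have [g gE] := PhiFull (mkhom (trC v vC) : @hom k (stmod kP) (Phi X) (Phi X)).
  suff : (mkhom (trC u uC) : @hom k (stmod kP) (Phi X) (Phi X)) ∘ mkhom (trC v vC) ≈
         (mkhom (trC v vC) : @hom k (stmod kP) (Phi X) (Phi X)) ∘ mkhom (trC u uC).
    by move/stab_heqP.
  apply: heq_trans (heq_comp (heq_sym fE) (heq_sym gE)) _.
  apply: heq_trans (heq_sym (fhomM Phi f g)) _.
  have -> : f ∘ g = g ∘ f by apply: comm.
  apply: heq_trans (fhomM Phi g f) _.
  exact: heq_comp.
have back u v : equivariant u -> equivariant v ->
    steq (j \o (tr u \o tr v) \o i)%VF (u \o v)%VF.
  move=> uC vC; have -> : (j \o (tr u \o tr v) \o i = (j \o i) \o (u \o (j \o i) \o v \o (j \o i)))%VF.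
    by rewrite !comp_lfunA.
  rewrite -[X in steq _ X]comp_lfun1l; apply: steq_comp => //.
  - by do !apply: equivariant_comp.
  - exact: equivariant_comp.
  rewrite -[X in steq _ X]comp_lfun1r; apply: steq_comp => //.
  - by do !apply: equivariant_comp.
  - exact: equivariant1.
  apply: steq_comp => //; [by do !apply: equivariant_comp| |exact: steq_refl].
  rewrite -[X in steq _ X]comp_lfun1r; apply: steq_comp => //.
  - exact: equivariant1.
  - exact: steq_refl.
move=> u v uC vC; apply: steq_trans (steq_sym (back u v uC vC)) _.
apply: steq_trans (back v u vC uC).
apply: steq_comp => //; last exact: steq_refl.
  by do !apply: equivariant_comp => //; apply: trC.
apply: steq_comp => //; last exact: tr_comm.
  by apply: equivariant_comp; apply: trC.
exact: steq_refl.
Qed.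

End StableEndomorphisms.

(** * Surjectivity of the algebra morphism *)

Section Surjectivity.
Variables (p : nat) (P : finGroupType) (k : fieldType) (D : falgType k).
Hypotheses (pk : p \in [pchar k]) (pP : (p.-group [set: P])%g)
  (ntP : (1 < #|[set: P]|)%N).
Local Notation kP := (group_alg k P).
Variable Phi : functor (modcat D) (stmod kP).
Hypothesis PhiFull : full_functor Phi.
Variable V : fdmod kP.
Hypothesis dV : (\dim {:V})%:R != 0 :> k.
Variables (T : fdmod D) (t : T) (eps : 'Hom(D, k^o)) (N : nat).
Hypotheses (t0 : t != 0) (genT : forall x : T, exists c : k, x = c *: t)
  (eps1 : eps 1 = 1 :> k)
  (epsM : forall a b, eps (a * b) = (eps a : k) * (eps b : k) :> k)
  (nilJ : lideal_pow (lker eps) N = 0%VS).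
Variable alpha : {lrmorphism kP -> D}.
Hypothesis isoPhi : forall X : fdmod D, stiso (tens_mod V (res_mod alpha X)) (Phi X).

Let alphaL : 'Hom(kP, D) := linfun alpha.
Let alphaLE x : alphaL x = alpha x. Proof. exact: lfunE. Qed.

(** If [lam] vanishes on the image of [alpha] then the group algebra acts on the
    module of [lam] by scalars, so its restriction has all [2] by [2] matrices as
    endomorphisms, whereas [D] leaves only the commutative algebra of dual
    numbers.  The stable equivalence makes the matrices commute stably after
    tensoring with [V].  But [e12 e21 e11 = e11] and [e21 e12 e11 = 0], so that
    the identity of [V] tensored with [e11] is a relative trace, although its
    trace is [dim V]. *)
Lemma tangent_trivial (lam : 'Hom(D, k^o)) : lam 1 = 0 :> k ->
  (forall a b, lam (a * b) = (eps a : k) * (lam b : k) + (lam a : k) * (eps b : k) :> k) ->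
  (forall x, lam (alpha x) = 0 :> k) -> forall d, eps d = 0 :> k -> lam d = 0 :> k.
Proof.
move=> lam1 lamM lam0 d d0; apply/eqP; apply: contraT => ld.
pose M := tangent_mod T eps1 epsM lam1 lamM; pose R := res_mod alpha M.
have scalR g (x : R) : rho R g x = (eps (alpha (galg_elt k g)) : k) *: x.
  rewrite [LHS]tangent_actE lam0 scale0r addr0; by case: x.
have eqR (f : 'End(R)) : equivariant f by move=> g x; rewrite !scalR linearZ.
pose W := hom_mod (dual_mod V) R.
have isoW : stiso W (Phi M).
  by apply: stiso_trans (isoPhi M); apply: stiso_sym; apply: tens_hom_stiso.
pose F (f : 'End(R)) : 'End(W) := sandwich f \1%VF.
have FC f : equivariant (F f) by apply: postcomp_equivariant; apply: eqR.
have FM f g : F (f \o g)%VF = (F f \o F g)%VF by apply: postcomp_comp.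
have comm := stable_end_comm PhiFull isoW (tangent_end_comm genT d0 ld : forall f g : modhom M M, _).
have L12 : linear (fun x : T * T => (x.2, 0) : T * T).
  by move=> c x y; congr pair; rewrite /= scaler0 addr0.
have L21 : linear (fun x : T * T => (0, x.1) : T * T).
  by move=> c x y; congr pair; rewrite /= scaler0 addr0.
have Lin : linear (fun x : T => (x, 0) : T * T).
  by move=> c x y; congr pair; rewrite /= scaler0 addr0.
have Lout : linear (fun x : T * T => x.1) by [].
pose e12 : 'End(R) := lmap L12; pose e21 : 'End(R) := lmap L21.
pose i : 'Hom(T, R) := lmap Lin; pose o : 'Hom(R, T) := lmap Lout.
have e12E x : e12 x = (x.2, 0) := lmapE L12 x.
have e21E x : e21 x = (0, x.1) := lmapE L21 x.
have iE x : i x = (x, 0) := lmapE Lin x; have oE x : o x = x.1 := lmapE Lout x.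
clearbody e12 e21 i o.
have [theta thE] : steq (F (i \o o)%VF) 0.
  have := steq_comp (equivariant_comp (FC e12) (FC e21)) (FC (i \o o)%VF)
    (comm _ _ (FC e12) (FC e21)) (steq_refl (F (i \o o)%VF)).
  rewrite -!FM; have -> : (e12 \o e21 \o (i \o o) = i \o o)%VF.
    by apply/lfunP => x; rewrite !comp_lfunE oE iE e21E e12E.
  have -> : (e21 \o e12 \o (i \o o) = 0)%VF.
    by apply/lfunP => x; rewrite !comp_lfunE oE iE e12E e21E zero_lfunE.
  have -> : F 0 = 0.
    by apply/lfunP => u; rewrite [LHS]sandwichE !comp_lfun0l zero_lfunE.
  by [].
have : ltr (F (i \o o)%VF) = 0 by rewrite thE add0r (ltr_htr pk pP ntP).
have -> : ltr (F (i \o o)%VF) = (\dim {:V})%:R.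
  have -> : F (i \o o)%VF = (sandwich i \1 \o sandwich o \1)%VF.
    by apply/lfunP => u; rewrite comp_lfunE !sandwichE !comp_lfun1r comp_lfunA.
  rewrite ltrC; have -> : (sandwich o \1 \o sandwich i \1)%VF = \1%VF :> 'End('Hom(dual_mod V, T)).
    apply/lfunP => u; rewrite comp_lfunE !sandwichE !comp_lfun1r id_lfunE comp_lfunA.
    have -> : (o \o i = \1)%VF by apply/lfunP => x; rewrite comp_lfunE iE oE id_lfunE.
    exact: comp_lfun1l.
  rewrite ltr1; congr (_%:R); have <- := dim_dual V.
  have dT : \dim {:T} = 1%N.
    have -> : fullv = <[t]>%VS :> {vspace T}; last by rewrite dim_vline t0.
    apply/vspaceP => x; rewrite memvf; have [c ->] := genT x.
    by rewrite memvZ // memv_line.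
  move: dT; rewrite !dimvf => dT; apply: etrans (muln1 _); rewrite -dT.
  by [].
by move/eqP; rewrite (negPf dV).
Qed.

(** Otherwise, by [generate_mod_square], the image of [alpha] and the square of the
    radical do not span [D], and a linear form vanishing on both is a tangent
    vector as in [tangent_trivial]. *)
Lemma alpha_surjective d : exists x, alpha x = d.
Proof.
pose J := lker eps; pose S := limg alphaL; pose W := (S + lideal_pow J 2)%VS.
have SP x : alpha x \in S by rewrite -alphaLE memv_img ?memvf.
suff SE : S = fullv.
  by have := memvf d; rewrite -SE => /memv_imgP[x _ ->]; exists x.
apply: (@generate_mod_square _ _ J _ _ _ _ _ N) => //.
- apply/prodvP => a x _; rewrite !memv_ker epsM => /eqP ->; rewrite mulr0; exact: eqxx.
- apply/prodvP => x a; rewrite !memv_ker epsM => /eqP -> _; rewrite mul0r; exact: eqxx.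
- apply/prodvP => _ _ /memv_imgP[x _ ->] /memv_imgP[y _ ->].
  by rewrite !alphaLE -rmorphM SP.
apply/subvP => x _; rewrite -quot_pi_eq0; apply: contraT => x0.
have [i xi] := exists_dual_neq0 x0.
pose lam : 'Hom(D, k^o) := (dual_basis i \o quot_pi W)%VF.
have lamW y : y \in W -> lam y = 0 :> k.
  by rewrite -quot_pi_eq0 comp_lfunE => /eqP ->; rewrite linear0.
have lamS y : lam (alpha y) = 0 :> k by apply: lamW; apply: (subvP (addvSl _ _)).
have lam1 : lam 1 = 0 :> k by rewrite -(rmorph1 alpha) lamS.
have eps_sub a : a - (eps a : k) *: 1 \in J.
  by rewrite memv_ker linearB linearZ /= eps1 [_ *: _]mulr1 subrr.
have lam_sub a : lam (a - (eps a : k) *: 1) = lam a.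
  by rewrite linearB linearZ /= lam1 [_ *: _]mulr0 subr0.
have lamM a b : lam (a * b) = (eps a : k) * (lam b : k) + (lam a : k) * (eps b : k) :> k.
  have : lam ((a - (eps a : k) *: 1) * (b - (eps b : k) *: 1)) = 0 :> k.
    apply: lamW; apply: (subvP (addvSr _ _)); apply: memv_mul => //.
    by rewrite -[X in X \in _]mulr1; apply: memv_mul => //; apply: memvf.
  rewrite mulrBl mulrBr -!scalerAl -!scalerAr mul1r mulr1.
  have lamB u v : lam (u - v) = (lam u : k) - (lam v : k) :> k by rewrite linearB.
  have lamZ (c : k) u : lam (c *: u) = c * (lam u : k) :> k by rewrite linearZ.
  rewrite lamB (lamB (a * b)) !lamZ lam_sub => E.
  apply/eqP; rewrite -subr_eq0; apply/eqP; rewrite -[RHS]E.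
  by rewrite opprD addrA addrAC [(lam a : k) * _]mulrC.
have := tangent_trivial lam1 lamM lamS.
move/(_ (x - (eps x : k) *: 1)); rewrite lam_sub => E.
case/negP: xi; apply/eqP; rewrite -[LHS]comp_lfunE; apply: E.
by have := eps_sub x; rewrite memv_ker => /eqP.
Qed.

End Surjectivity.

(** * Full, faithful and essentially surjective functors *)

Section EquivalenceCriterion.
Variables (k : fieldType) (C D : lincat k) (F : functor C D).
Hypotheses (faithF : faithful_functor F) (fullF : full_functor F).

Lemma heq_lin (E : lincat k) (X Y : E) c (f f' g g' : hom X Y) :
  f ≈ f' -> g ≈ g' -> c *: f + g ≈ c *: f' + g'.
Proof.
by move=> ff gg; have := null_lin c ff gg; rewrite /heq scalerBr opprD addrACA.
Qed.

Lemma heq_cancel (E : lincat k) (X Y Z : E) (e : hom Y Z) (e' : hom Z Y) (f : hom X Y) :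
  e' ∘ e ≈ idm Y -> e' ∘ (e ∘ f) ≈ f.
Proof.
move=> ee; rewrite compA; apply: heq_trans (heq_comp ee (heq_refl f)) _.
by rewrite comp1m; apply: heq_refl.
Qed.

(** Choose preimages of objects and of maps; the laws of a functor hold because
    they hold after applying [F]. *)
Lemma full_faithful_equivalence : (forall Y, exists X, isomorphic (F X) Y) ->
  is_equivalence F.
Proof.
move=> ess.
have iso Y : {X : C & {e : hom (F X) Y & {e' : hom Y (F X) |
    e' ∘ e ≈ idm (F X) /\ e ∘ e' ≈ idm Y}}}.
  have [X eX] := cid (ess Y); exists X; have [e e_iso] := cid eX; exists e.
  by have [e' ee] := cid e_iso; exists e'.
pose G Y := projT1 (iso Y); pose e Y : hom (F (G Y)) Y := projT1 (projT2 (iso Y)).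
pose e' Y : hom Y (F (G Y)) := sval (projT2 (projT2 (iso Y))).
have e'e Y : e' Y ∘ e Y ≈ idm (F (G Y)) := (svalP (projT2 (projT2 (iso Y)))).1.
have ee' Y : e Y ∘ e' Y ≈ idm Y := (svalP (projT2 (projT2 (iso Y)))).2.
clearbody e e'; clearbody G.
pose lift X X' (h : hom (F X) (F X')) := sval (cid (fullF h)).
have liftE X X' (h : hom (F X) (F X')) : fhom F (lift X X' h) ≈ h := svalP (cid (fullF h)).
clearbody lift.
pose Gh Y Y' (h : hom Y Y') : hom (G Y) (G Y') := lift _ _ (e' Y' ∘ (h ∘ e Y)).
have GhE Y Y' (h : hom Y Y') : fhom F (Gh Y Y' h) ≈ e' Y' ∘ (h ∘ e Y) by apply: liftE.
clearbody Gh.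
have Gheq Y Y' (f g : hom Y Y') : f ≈ g -> Gh _ _ f ≈ Gh _ _ g.
  move=> fg; apply: faithF; apply: heq_trans (GhE _ _ f) _.
  apply: heq_trans (heq_sym (GhE _ _ g)).
  by apply: heq_comp; [exact: heq_refl | apply: heq_comp => //; exact: heq_refl].
have Glin Y Y' c (f g : hom Y Y') : Gh _ _ (c *: f + g) ≈ c *: Gh _ _ f + Gh _ _ g.
  apply: faithF; apply: heq_trans (GhE _ _ _) _.
  apply: heq_trans (heq_sym (fhom_lin F _ _ _)).
  rewrite comp_linl comp_linr; apply: heq_lin; apply: heq_sym; exact: GhE.
have G1 Y : Gh _ _ (idm Y) ≈ idm (G Y).
  apply: faithF; apply: heq_trans (GhE _ _ _) _.
  by rewrite comp1m; apply: heq_trans (e'e Y) (heq_sym (fhom1 F (G Y))).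
have GM X Y Z (g : hom Y Z) (f : hom X Y) : Gh _ _ (g ∘ f) ≈ Gh _ _ g ∘ Gh _ _ f.
  apply: faithF; apply: heq_trans (GhE _ _ _) _.
  apply: heq_sym; apply: heq_trans (fhomM F _ _) _.
  apply: heq_trans (heq_comp (GhE _ _ _) (GhE _ _ _)) _.
  rewrite -[X in X ≈ _]compA; apply: heq_comp; first exact: heq_refl.
  rewrite -compA -[X in _ ≈ X]compA; apply: heq_comp; first exact: heq_refl.
  exact: heq_cancel.
pose GF := Functor Gheq Glin G1 GM; exists GF; split.
  pose eta X : hom (G (F X)) X := lift _ _ (e (F X)).
  have etaE X : fhom F (eta X) ≈ e (F X) by apply: liftE.
  exists eta; split=> [X | X Y f].
    exists (lift _ _ (e' (F X))); split; apply: faithF.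
      apply: heq_trans (fhomM F _ _) _; apply: heq_trans (heq_comp (liftE _ _ _) (etaE X)) _.
      exact: heq_trans (e'e _) (heq_sym (fhom1 F _)).
    apply: heq_trans (fhomM F _ _) _; apply: heq_trans (heq_comp (etaE X) (liftE _ _ _)) _.
    exact: heq_trans (ee' _) (heq_sym (fhom1 F _)).
  apply: faithF; apply: heq_trans (fhomM F _ _) _.
  apply: heq_trans (heq_comp (etaE Y) (GhE _ _ _)) _.
  apply: heq_trans (heq_cancel _ (ee' _)) _.
  apply: heq_sym; apply: heq_trans (fhomM F _ _) _.
  by apply: heq_comp; [exact: heq_refl | exact: etaE].
exists e; split=> [Y | X Y f]; first by exists (e' Y); split; [exact: e'e | exact: ee'].
apply: heq_trans (heq_comp (heq_refl _) (GhE _ _ _)) _.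
exact: heq_cancel.
Qed.

End EquivalenceCriterion.

(** * The kernel of the algebra morphism *)

Section QuotientByKernel.
Variables (k : fieldType) (A D : falgType k) (alpha : {lrmorphism A -> D}).
Hypothesis alpha_surj : forall d, exists x, alpha x = d.

Definition lfun_of : 'Hom(A, D) := linfun alpha.
Lemma lfun_ofE x : lfun_of x = alpha x. Proof. exact: lfunE. Qed.
Lemma mem_ker_morph x : (x \in lker lfun_of) = (alpha x == 0).
Proof. by rewrite memv_ker lfun_ofE. Qed.

Fact ker_mull a x : x \in lker lfun_of -> a * x \in lker lfun_of.
Proof. by rewrite !mem_ker_morph => /eqP x0; rewrite rmorphM /= x0 mulr0. Qed.
Fact ker_mulr a x : x \in lker lfun_of -> x * a \in lker lfun_of.
Proof. by rewrite !mem_ker_morph => /eqP x0; rewrite rmorphM /= x0 mul0r. Qed.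
Fact ker_proper : 1 \notin lker lfun_of.
Proof. by rewrite mem_ker_morph rmorph1 oner_neq0. Qed.
Definition ker_ideal : ideal A := Ideal ker_mull ker_mulr ker_proper.
Local Notation I := ker_ideal.
Local Notation Q := (quot_alg I).

Lemma quot_proj_congr x y : alpha x = alpha y -> quot_proj I x = quot_proj I y.
Proof.
move=> xy; apply: quot_pi_congr; rewrite mem_ker_morph.
by rewrite linearB subr_eq0; apply/eqP.
Qed.

(** A linear section of [alpha]. *)
Definition ker_section (d : D) : A := (lfun_of^-1)%VF d.
Lemma ker_sectionK d : alpha (ker_section d) = d.
Proof.
rewrite -lfun_ofE /ker_section; apply: limg_lfunVK.
by have [x <-] := alpha_surj d; rewrite -lfun_ofE memv_img ?memvf.
Qed.

Lemma quot_ker_isomorphic : exists (beta : {lrmorphism D -> Q}) (gamma : {lrmorphism Q -> D}),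
  [/\ bijective beta, forall x, beta (alpha x) = quot_proj I x &
      forall x, gamma (quot_proj I x) = alpha x].
Proof.
pose b (d : D) : Q := quot_proj I (ker_section d).
have bE x : b (alpha x) = quot_proj I x by apply: quot_proj_congr; rewrite ker_sectionK.
have bL : linear b by move=> c x y; rewrite /b /ker_section !linearP.
have bM : monoid_morphism b.
  split=> [|x y]; first by rewrite -(rmorph1 alpha) bE rmorph1.
  by rewrite -(ker_sectionK x) -(ker_sectionK y) -rmorphM !bE rmorphM.
pose c (z : Q) : D := alpha (quot_repr I z).
have cE x : c (quot_proj I x) = alpha x.
  apply/eqP; rewrite eq_sym -subr_eq0 -rmorphB -mem_ker_morph; exact: quot_piK.
have cL : linear c by move=> a x y; rewrite /c !linearP.
have pK z : quot_proj I (quot_repr I z) = z := quot_reprK' z.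
have cM : monoid_morphism c.
  split=> [|x y]; first by rewrite -(rmorph1 (quot_proj I)) cE rmorph1.
  by rewrite -(pK x) -(pK y) -rmorphM !cE rmorphM.
pose bL' := GRing.isSemilinear.Build k D Q _ b (GRing.semilinear_linear bL).
pose bM' := GRing.isMonoidMorphism.Build D Q b bM.
pose cL' := GRing.isSemilinear.Build k Q D _ c (GRing.semilinear_linear cL).
pose cM' := GRing.isMonoidMorphism.Build Q D c cM.
exists (HB.pack b bL' bM' : {lrmorphism D -> Q}), (HB.pack c cL' cM' : {lrmorphism Q -> D}).
split=> //; exists c => [d | z] /=.
  by rewrite -[X in b X](ker_sectionK d) bE cE ker_sectionK.
by rewrite -[X in c X](pK z) cE bE pK.
Qed.

End QuotientByKernel.

Section Main.
Variables (p : nat) (P : finGroupType) (k : fieldType) (D : falgType k).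
Hypotheses (pk : p \in [pchar k]) (pP : (p.-group [set: P])%g)
  (ntP : (1 < #|[set: P]|)%N).
Local Notation kP := (group_alg k P).
Variable Phi : functor (modcat D) (stmod kP).
Hypotheses (PhiF : faithful_functor Phi) (PhiFull : full_functor Phi).
Variables (V : fdmod kP) (Y : bimod kP D).
Hypotheses (scV : stably_scalar V) (dV : (\dim {:V})%:R != 0 :> k).
Hypothesis natY : nat_iso Phi (comp_functor (stable_functor kP) (btens_functor Y)).
Local Notation U := ('Hom(V, bimod_left Y)).
Local Notation HU := (hom_mod V (bimod_left Y)).
Variables (v0 : U) (q : 'Hom(U, D)) (theta : 'End(U)).
Hypotheses (thR : forall b u, theta (hom_ract V Y b u) = hom_ract V Y b (theta u))
  (qR : forall b u, q (hom_ract V Y b u) = q u * b) (qv0 : q v0 = 1)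
  (split : forall u, u = hom_ract V Y (q u) v0 + gtr (hom_rep V (bimod_left Y)) theta u).
Variable alpha : {lrmorphism kP -> D}.
Hypothesis alphaE : forall x, alpha x = q (mact HU x v0).

Lemma Phi_btens_stiso (X : fdmod D) : stiso (Phi X) (btens_mod Y X).
Proof. by have [eta [etaI _]] := natY; apply/stisoP; exists (eta X); apply: etaI. Qed.

(** By [splitting_stiso], [V ⊗ X = Hom(V^*, X)] is stably
    [Hom(V^*, Hom(V, Y ⊗ X))], that is, [Y ⊗ X]. *)
Lemma tens_res_stiso (X : fdmod D) : stiso (tens_mod V (res_mod alpha X)) (Phi X).
Proof.
apply: stiso_trans (stiso_sym (Phi_btens_stiso X)).
apply: stiso_trans (hom_dual_hom_stiso pk pP ntP scV dV (btens_mod Y X)).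
apply: stiso_trans (tens_hom_stiso V (res_mod alpha X)) _; apply: hom_stiso.
have [out [outC os so]] := splitting_stiso thR qR qv0 split alphaE X.
exists (splitting_in v0 alpha X), out; split=> //; last by rewrite os; apply: steq_refl.
exact (splitting_in_equivariant qv0 split alphaE (X := X)).
Qed.

(** Restriction along [alpha] is stably [Hom(V, Y ⊗ -)], and both [Hom(V, -)] and
    [Phi] are stably faithful. *)
Lemma res_stably_faithful (X X' : fdmod D) (f : modhom X X') :
  steq (hval f : 'Hom(res_mod alpha X, res_mod alpha X')) 0 -> f = 0.
Proof.
move=> f0; have [out [outC os so]] := splitting_stiso thR qR qv0 split alphaE X.
pose ff : 'Hom(res_mod alpha X, res_mod alpha X') := hval f.
pose sX := splitting_in v0 alpha X; pose sX' := splitting_in v0 alpha X'.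
pose Hf : 'Hom(hom_mod V (btens_mod Y X), hom_mod V (btens_mod Y X')) :=
  sandwich (btens_hom Y f) \1%VF.
have HfC : equivariant Hf by apply: postcomp_equivariant; apply: equivariant_modhom.
have Hf0 : steq Hf 0.
  apply: (@steq_trans _ _ _ _ _ (Hf \o (sX \o out))%VF).
    have sC := equivariant_comp (splitting_in_equivariant qv0 split alphaE (X := X)) outC.
    by have := steq_comp HfC sC (steq_refl Hf) (steq_sym so); rewrite comp_lfun1r.
  have -> : (Hf \o (sX \o out) = sX' \o (ff \o out))%VF.
    have nat : (Hf \o sX = sX' \o ff)%VF := esym (splitting_in_natural v0 alpha f).
    apply: etrans (comp_lfunA Hf sX out) _.
    apply: etrans (congr1 (fun h : 'Hom(res_mod alpha X, _) => (h \o out)%VF) nat) _.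
    exact: (esym (comp_lfunA sX' ff out)).
  have -> : 0 = (sX' \o (0 \o out))%VF :> 'Hom(hom_mod V (btens_mod Y X), hom_mod V (btens_mod Y X')).
    by rewrite comp_lfun0l comp_lfun0r.
  have zC : equivariant (0 : 'Hom(res_mod alpha X, res_mod alpha X')).
    by move=> h x; rewrite !zero_lfunE linear0.
  apply: steq_comp; [|exact: equivariant_comp|exact: steq_refl|].
    exact (splitting_in_equivariant qv0 split alphaE (X := X')).
  apply: steq_comp => //; last exact: steq_refl.
  exact: steq_equivariant f0 zC.
have b0 : (btens_hom Y f : @hom k (stmod kP) (btens_mod Y X) (btens_mod Y X')) ≈ 0.
  by apply/stab_heqP; exact (postcomp_stably_faithful dV Hf0).
have [eta [etaI etaN]] := natY; have [i [i1 i2]] := etaI X'.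
apply: subr0_eq; apply: PhiF.
apply: heq_trans (_ : 0 ≈ _); last first.
  have := fhom_lin Phi (-1) 0 (0 : @hom k (modcat D) X X').
  by rewrite scaler0 addr0 scaleN1r addNr => /heq_sym.
apply: heq_trans (heq_sym (heq_cancel (fhom Phi f) i1)) _.
apply: heq_trans (heq_comp (heq_refl i) (etaN _ _ f)) _.
apply: heq_trans (heq_comp (heq_refl i) (heq_comp b0 (heq_refl (eta X)))) _.
apply/stab_heqP; rewrite /= comp_lfun0l comp_lfun0r; exact: steq_refl.
Qed.

Hypothesis alpha_surj : forall d, exists x, alpha x = d.

(** If [a] annihilates the kernel from the right, then right multiplication by
    [alpha a] on [D] factors through the free module of rank one, by the maps
    [alpha x |-> x a] and [alpha]; so it is stably zero, hence zero. *)
Lemma ker_right_annihilator : contains_right_annihilator (ker_ideal alpha).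
Proof.
move=> a aI; rewrite mem_ker_morph.
have RL : amulr (alpha a) \in mod_linear (regular_mod D) (regular_mod D).
  by apply/asboolP => b x; rewrite ![mact _ _ _]amullE ![amulr _ _]amulrE mulrA.
pose f := ModHom RL.
have fE d : f d = d * alpha a by apply: amulrE.
pose Q := regular_mod kP; pose R := res_mod alpha (regular_mod D).
pose u : 'Hom(R, Q) := (amulr a \o (lfun_of alpha)^-1)%VF.
have uE d : u d = ker_section alpha d * a by rewrite comp_lfunE amulrE.
have uA : u \in mod_linear R Q.
  apply/asboolP => x d; rewrite !uE -[mact R x d]/(amull (alpha x) d) [mact Q x _]amullE.
  rewrite amullE mulrA; apply/eqP; rewrite -subr_eq0 -mulrBl; apply/eqP/aI.
  by rewrite mem_ker_morph rmorphB rmorphM /= !(ker_sectionK alpha_surj) subrr.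
pose v : 'Hom(Q, R) := lfun_of alpha.
have vA : v \in mod_linear Q R.
  apply/asboolP => x y; rewrite [mact Q x y]amullE -[mact R x _]/(amull (alpha x) (v y)) amullE.
  by rewrite ![v _]lfun_ofE rmorphM.
suff f0 : f = 0.
  by have := fE 1; rewrite f0 zero_lfunE mul1r => <-; rewrite eqxx.
apply: res_stably_faithful.
have /factors_projectiveP[th thE] : factors_projective (modhom_comp (ModHom vA) (ModHom uA)).
  by exists Q, (ModHom uA), (ModHom vA); split=> //; apply: projective_regular.
exists th; rewrite add0r -thE; apply/lfunP => d; rewrite fE comp_lfunE [v _]lfun_ofE uE.
by rewrite rmorphM /= ker_sectionK.
Qed.

(** Modules over the quotient by the kernel are modules over [D], and restriction
    from either algebra to the group algebra is the same. *)
Lemma Phi_equivalence : induces_equivalence Phi (tens_sub V (quot_sub (ker_ideal alpha))).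
Proof.
have [beta [gamma [_ betaE gammaE]]] := quot_ker_isomorphic alpha_surj.
have idiso (X X' : fdmod kP) (f : 'Hom(X, X')) (g : 'Hom(X', X)) : equivariant f -> equivariant g ->
    (g \o f)%VF = \1%VF -> (f \o g)%VF = \1%VF -> @isomorphic k (stmod kP) X X'.
  by move=> fC gC gf fg; apply/stisoP; apply: stiso_refl_eq fC gC gf fg.
have FQ X : tens_sub V (quot_sub (ker_ideal alpha)) (Phi X).
  exists (res_mod alpha X); last by apply/stisoP/stiso_sym/tens_res_stiso.
  exists (res_mod gamma X).
  have E x : mact (res_mod (quot_proj (ker_ideal alpha)) (res_mod gamma X)) x = mact (res_mod alpha X) x.
    by rewrite -[LHS]/(mact X (gamma (quot_proj _ x))) gammaE.
  apply: (@idiso (res_mod alpha X) (res_mod (quot_proj (ker_ideal alpha)) (res_mod gamma X))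
    \1%VF \1%VF); rewrite ?comp_lfun1l // => g x; by rewrite !id_lfunE /rho E.
exists FQ; apply: full_faithful_equivalence.
- by move=> X X' f g; apply: PhiF.
- by move=> X X' g; apply: PhiFull.
move=> [W [Z [M ZM] WZ]]; exists (res_mod beta M).
have E x : mact (res_mod alpha (res_mod beta M)) x = mact (res_mod (quot_proj (ker_ideal alpha)) M) x.
  by rewrite -[LHS]/(mact M (beta (alpha x))) betaE.
have i1 : stiso (res_mod alpha (res_mod beta M)) (res_mod (quot_proj (ker_ideal alpha)) M).
  apply: (@stiso_refl_eq _ _ (res_mod alpha (res_mod beta M)) (res_mod (quot_proj (ker_ideal alpha)) M)
    \1%VF \1%VF); rewrite ?comp_lfun1l // => g x; by rewrite !id_lfunE /rho E.
suff : @isomorphic k (stmod kP) (Phi (res_mod beta M)) W by [].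
apply/stisoP; apply: stiso_trans (stiso_sym (tens_res_stiso _)) _.
apply: stiso_trans (stiso_sym ((stisoP W (tens_mod V Z)).1 WZ)).
apply: tens_stiso; apply: stiso_trans i1 _; apply: stiso_sym; exact/stisoP.
Qed.

End Main.

Theorem theorem4p4 (p : nat) (P : finGroupType) (k : fieldType) (D : falgType k)
    (E : forall U : fdmod (group_alg k P), injective_envelope U)
    (Phi : functor (modcat D) (stmod (group_alg k P))) :
  prime p ->
  (p.-group [set: P])%g ->
  (1 < #|[set: P]|)%N ->
  p \in [pchar k] ->
  split_algebra D ->
  basic_algebra D ->
  distinguished_embedding (stable_triangles E) Phi ->
  (num_simple D 1 /\ (split_algebra D /\ local_algebra D))
  /\
  (forall V : modcat (group_alg k P),
     indecomposable V ->
     (exists T : fdmod D, simple_mod T /\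
        @isomorphic k (stmod (group_alg k P)) V (Phi T)) ->
     endotrivial V
     /\
     (forall Y : bimod (group_alg k P) D,
        projective_rmod (bi_right Y) ->
        nat_iso Phi (comp_functor (stable_functor (group_alg k P))
                                  (btens_functor Y)) ->
        exists I : ideal (group_alg k P),
          [/\ contains_right_annihilator I,
              alg_isomorphic D (quot_alg I)
            & induces_equivalence Phi (tens_sub V (quot_sub I))])).
Proof.
move=> pr pP ntP pk splitD basicD [PhiF PhiFull _].
split.
  split; first exact: (num_simple1 pk pP ntP PhiF PhiFull splitD).
  by split=> //; apply: (local_of_basic pk pP ntP PhiF PhiFull splitD).
move=> V _ [T [simT /stisoP isoV]].
have [scV dV] := correspondent_dim pk pP PhiF PhiFull splitD simT isoV.
split; first exact: (stably_scalar_endotrivial pk pP ntP scV dV).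
move=> Y projY natY.
have uniqT S (simS : simple_mod S) : isomorphic (S : modcat D) T.
  exact: (unique_simple pk pP ntP PhiF PhiFull splitD simS simT).
have nil_unit := basic_nil_or_unit simT uniqT basicD.
have [t [eps [t0 genT epsT [eps1 epsM] eps_unit]]] := local_character nil_unit splitD simT.
have [N nilJ] := radical_nilpotent simT uniqT epsT epsM.
have eps_unit' a : (eps a : k) <> 0 -> a \is a GRing.unit.
  by move=> ea; apply: contraT => /eps_unit.
have isoY := stiso_trans isoV (Phi_btens_stiso natY T).
have [v0 [q [theta [thR qR qv0 splitU]]]] := bimodule_splitting pk pP ntP scV dV projY
  t0 genT epsT eps1 epsM eps_unit' nilJ isoY.
have [alpha alphaE] := splitting_morphism qR qv0 splitU.
have isoPhi X := tens_res_stiso pk pP ntP scV dV natY thR qR qv0 splitU alphaE X.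
have alpha_surj := alpha_surjective pk pP ntP PhiFull dV t0 genT eps1 epsM nilJ isoPhi.
exists (ker_ideal alpha); split.
- exact: (ker_right_annihilator PhiF dV natY thR qR qv0 splitU alphaE alpha_surj).
- have [beta [_ [betaB _ _]]] := quot_ker_isomorphic alpha_surj.
  by exists beta.
exact: (Phi_equivalence pk pP ntP PhiF PhiFull scV dV natY thR qR qv0 splitU alphaE alpha_surj).
Qed.
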